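(* Let $V\in\mathcal{E}^2_+$ be of exponential order $N$ with $N^2<6$, and let $p_-=(y,z)=(-1,0)$. For all sufficiently small neighbourhoods $\mathcal{N}(p_-)$ of $p_-$, the set of physical orbits (orbits of the system with potential $V$) intersecting $\mathcal{N}(p_-)$ is homeomorphic to the set of massless scalar field cosmologies $K=t^{-1}$, $\phi=-\sqrt{\tfrac23}\ln\frac tc$, $\dot\phi=-\sqrt{\tfrac23}\,t^{-1}$ $(c>0)$. That is, for each $c>0$ there exists a unique cosmology (orbit) of the model with potential $V$ which, with the origin of proper time $t$ chosen suitably, satisfies as $t\to0^+$ $$K=t^{-1}+O(\epsilon_V(t)),\qquad \phi=-\sqrt{\tfrac23}\,\ln\frac tc+O(t\,\epsilon_V(t)),\qquad \dot\phi=-\sqrt{\tfrac23}\,t^{-1}+O(\epsilon_V(t)),$$ where $\epsilon_V(t)=t\,V\!\left(-\sqrt{\tfrac23}\,\ln t\right)$, and this correspondence between $c\in(0,\infty)$ and the physical orbits intersecting $\mathcal{N}(p_-)$ is continuous (a homeomorphism).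
   Context: **Potentials.** A $C^2$ non-negative function $V:\mathbb{R}\to\mathbb{R}$ is called well behaved at infinity (WBI) of exponential order $N\in\mathbb{R}$ if there exists $\phi_0>0$ such that $V(\phi)>0$ for all $\phi>\phi_0$ and $W_V(\phi)=\frac{V'(\phi)}{V(\phi)}-N$ satisfies $\lim_{\phi\to\infty}W_V(\phi)=0$. For a map $z=f(\phi)$ taking $[\phi_0,\infty)$ onto $(0,f(\phi_0)]$ with $\lim_{\phi\to\infty}f(\phi)=0$, and a function $g$ of $\phi$, write $\overline g(z)=g(f^{-1}(z))$ for $z>0$ and $\overline g(0)=\lim_{\phi\to\infty}g(\phi)$. A $C^k$ potential $V$ is class $k$ WBI, written $V\in\mathcal{E}^k_+$, if it is WBI and there exist $\phi_0>0$ and $f$ mapping $[\phi_0,\infty)$ onto $(0,f(\phi_0)]$ with $\lim_{\phi\to\infty}f(\phi)=0$ such that: (i) $f$ is $C^{k+1}$ and strictly decreasing; (ii) $\overline{W_V}(z)$ and $\overline{f'}(z)$ are $C^k$ on the closed interval $[0,f(\phi_0)]$; (iii) $\frac{d\overline{W_V}}{dz}(0)=\frac{d\overline{f'}}{dz}(0)=0$. **Dynamical system.** The spatially flat FRW scalar field cosmologies with potential $V$ are the solutions, in proper time $t$, of $\frac{d\phi}{dt}=\dot\phi$, $\frac{d\dot\phi}{dt}=-K\dot\phi-V'(\phi)$, $\frac{dK}{dt}=-\frac32\dot\phi^2$ with $K^2=3V(\phi)+\frac32\dot\phi^2$ and $K>0$; solutions differing by a translation of $t$ define the same orbit, and each orbit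 is regarded as a single physical cosmology. The massless scalar field cosmologies are the solutions with $V\equiv0$; those with $\phi\to+\infty$ at the initial time (taken to be $t=0$) are exactly the family displayed in the claim, parametrized by $c>0$ and topologized as $(0,\infty)$. Given $V\in\mathcal{E}^2_+$, fix $f$ as in the definition (with $k=2$) and $\epsilon>0$ small enough that $\epsilon^{-1}\geq\phi_0$ and $V>0$ for $\phi\geq\epsilon^{-1}$. With $y=\sqrt{3/2}\,\dot\phi/K$, $z=f(\phi)$ and time $\tau$ defined by $\frac{d}{dt}=K\frac{d}{d\tau}$, the part of phase space with $\phi>\epsilon^{-1}$ is identified with $$\Omega_\epsilon=\{(y,z):0<z<f(\epsilon^{-1}),\ -1<y<1\},$$ on which the evolution is $$\frac{dy}{d\tau}=-\Big(y+\tfrac{1}{\sqrt6}\big(\overline{W_V}(z)+N\big)\Big)(1-y^2),\qquad \frac{dz}{d\tau}=\sqrt{\tfrac23}\,\overline{f'}(z)\,y,$$ a system that extends to a $C^2$ system on the closure of $\Omega_\epsilon$. Neighbourhoods of $p_-$ are taken in the $(y,z)$-plane, ''physical'' orbits are those in the region $K>0$ finite, $\phi$ finite (near $p_-$: in $\Omega_\epsilon$), and the set of orbits carries the quotient topology from phase space. *)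

(* Defs.v *)
From HB Require Import structures.
From mathcomp Require Import all_boot all_order all_algebra.
From mathcomp Require Import all_classical all_reals all_analysis.

Set Implicit Arguments.
Unset Strict Implicit.
Unset Printing Implicit Defensive.

Import Order.TTheory GRing.Theory Num.Theory.
Import numFieldNormedType.Exports.

Local Open Scope classical_set_scope.
Local Open Scope ring_scope.

Section Potentials.
Context {R : realType}.

Definition class_C (k : nat) (g : R -> R) : Prop :=
  (forall j, (j < k)%N -> forall x, derivable (derive1n j g) x 1) /\
  continuous (derive1n k g).

(* Derivatives relative to an interval D: the increments h are restricted to
   those with h + x in D, which gives the one-sided derivative at an endpoint
   and the library's derive1 when D = setT. *)
Definition diff_quot_on (D : set R) (g : R -> R) (x : R) : set_system R :=
  h^-1 *: (g (h + x) - g x) @[h --> within [set h | D (h + x)] 0^'].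

Definition derive_on (D : set R) (g : R -> R) (x : R) : R :=
  lim (diff_quot_on D g x).

Fixpoint class_C_on (k : nat) (D : set R) (g : R -> R) : Prop :=
  if k is k'.+1 then
    (forall x, D x -> cvg (diff_quot_on D g x)) /\
    class_C_on k' D (derive_on D g)
  else {within D, continuous g}.

Definition W_ (V : R -> R) (N : R) (phi : R) : R := derive1 V phi / V phi - N.

Definition WBI (V : R -> R) (N : R) : Prop :=
  [/\ class_C 2 V,
      forall phi, 0 <= V phi &
      exists phi0 : R,
        [/\ 0 < phi0, forall phi, phi0 < phi -> 0 < V phi &
            W_ V N phi @[phi --> +oo] --> (0 : R)]].

(* The function written g with an overline: g \o f^-1 for z > 0, extended to
   z = 0 by the limit of g at infinity.  If that limit fails to exist then the
   result is not continuous at 0, whatever the default value of lim. *)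
Definition overline (phi0 : R) (f g : R -> R) (z : R) : R :=
  if z == 0 then lim (g phi @[phi --> +oo])
  else g ('pinv_(fun=> point) `[phi0, +oo[ f z).

(* (phi0, f) witness that V is class k WBI.  Positivity of V on [phi0, +oo[ is
   what makes W_ V N, and hence its overline on [0, f phi0], meaningful. *)
Definition WBI_chart (k : nat) (V : R -> R) (N phi0 : R) (f : R -> R) : Prop :=
  let I := `[phi0, +oo[%classic in
  let J := `[0, f phi0]%classic in
  let Wbar := overline phi0 f (W_ V N) in
  let f'bar := overline phi0 f (derive_on I f) in
  [/\ 0 < phi0 /\ (forall phi, phi0 <= phi -> 0 < V phi),
      f @` I = `]0, f phi0]%classic /\ f phi @[phi --> +oo] --> (0 : R),
      class_C_on k.+1 I f /\
        (forall x y, phi0 <= x -> x < y -> f y < f x),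
      class_C_on k J Wbar /\ class_C_on k J f'bar &
      derive_on J Wbar 0 = 0 /\ derive_on J f'bar 0 = 0].

Definition class_WBI (k : nat) (V : R -> R) (N : R) : Prop :=
  [/\ class_C k V, WBI V N & exists phi0 f, WBI_chart k V N phi0 f].

End Potentials.

Section Cosmologies.
Context {R : realType}.
Variable V : R -> R.

(* Points are triples ((phi, phidot), K); the phase space carries the subspace
   topology of R * R * R. *)
Definition phase_set : set (R * R * R) :=
  [set p | 0 < p.2 /\ p.2 ^+ 2 = 3 * V p.1.1 + 3 / 2 * p.1.2 ^+ 2].

Definition phase : topologicalType := set_type phase_set.

Definition phi_ (p : phase) : R := (set_val p).1.1.
Definition phidot_ (p : phase) : R := (set_val p).1.2.
Definition K_ (p : phase) : R := (set_val p).2.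

(* Curves are total functions, but nothing is required outside ]a, b[. *)
Definition is_solution (a b : R) (g : R -> phase) : Prop :=
  forall t, a < t < b ->
  [/\ is_derive t 1 (phi_ \o g) (phidot_ (g t)),
      is_derive t 1 (phidot_ \o g)
        (- K_ (g t) * phidot_ (g t) - derive1 V (phi_ (g t))) &
      is_derive t 1 (K_ \o g) (- (3 / 2) * phidot_ (g t) ^+ 2)].

(* Any two points of a maximal solution lie on its restriction to a bounded
   open interval, so bounded intervals are enough to describe full orbits. *)
Definition flow_orbit (p : phase) : set phase :=
  [set q | exists (a b : R) (g : R -> phase) (s t : R),
     [/\ is_solution a b g, a < s < b, a < t < b, g s = p & g t = q]].

Definition same_orbit (p q : phase) : bool :=
  `[< flow_orbit p = flow_orbit q >].

Lemma same_orbit_refl : reflexive same_orbit.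
Proof. by move=> p; apply/asboolP. Qed.

Lemma same_orbit_sym : symmetric same_orbit.
Proof. by move=> p q; apply/asboolP/asboolP => ->. Qed.

Lemma same_orbit_trans : transitive same_orbit.
Proof. by move=> q p r /asboolP pq /asboolP qr; apply/asboolP; rewrite pq. Qed.

Canonical same_orbit_equiv :=
  EquivRel same_orbit same_orbit_refl same_orbit_sym same_orbit_trans.

Definition orbit_space : topologicalType :=
  quotient_topology {eq_quot same_orbit_equiv}%qT.

Definition orbit_of (p : phase) : orbit_space :=
  (\pi_(quotient_topology {eq_quot same_orbit_equiv}) p)%qT.

(* The coordinates (y, z); for phi > eps^-1 they identify the phase space
   with Omega_eps.  f is only meaningful on [phi0, +oo[, which is why the
   condition phi > eps^-1 below is not expressed through z. *)
Definition yz (f : R -> R) (p : phase) : R * R :=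
  (Num.sqrt (3 / 2) * phidot_ p / K_ p, f (phi_ p)).

Definition orbits_meeting (f : R -> R) (eps : R) (Nb : set (R * R)) :
    set orbit_space :=
  [set o | exists p, [/\ orbit_of p = o, eps^-1 < phi_ p & Nb (yz f p)]].

Definition p_minus : R * R := (-1, 0).

Definition massless_phi (c t : R) : R := - Num.sqrt (2 / 3) * ln (t / c).
Definition massless_phidot (t : R) : R := - Num.sqrt (2 / 3) * t^-1.
Definition massless_K (t : R) : R := t^-1.

Definition eps_V (t : R) : R := t * V (- Num.sqrt (2 / 3) * ln t).

(* The existential over g includes the choice of the origin of proper time. *)
Definition asymptotic_to_massless (c : R) (o : orbit_space) : Prop :=
  exists (T : R) (g : R -> phase),
  [/\ 0 < T /\ is_solution 0 T g,
      forall t : R, 0 < t < T -> orbit_of (g t) = o,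
      (fun t => K_ (g t) - massless_K t) =O_ (0^'+) eps_V,
      (fun t => phi_ (g t) - massless_phi c t)
        =O_ (0^'+) (fun t => t * eps_V t) &
      (fun t => phidot_ (g t) - massless_phidot t) =O_ (0^'+) eps_V].

End Cosmologies.

Arguments orbits_meeting {R} V f eps Nb.
Arguments p_minus {R}.

Definition homeomorphism {X Y : topologicalType} (h : X -> Y) : Prop :=
  continuous h /\
  exists h' : Y -> X, [/\ cancel h h', cancel h' h & continuous h'].

(* Main.v *)
(** On the part of phase space with [phidot < 0] the field [phi] itself can serve
    as independent variable. With [kappa = sqrt (3/2)], [w = ln K - kappa phi]
    and [rho = 3 V / K^2 = 1 - y^2], the system becomes the scalar equation
    [dw/dphi = kappa (sqrt (1 - rho) - 1)]. Because [N < 2 kappa], [rho] decays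
    exponentially along every solution that is close to [p_-]; hence [w] has a
    limit [l], proper time is [t = K^-1 (1 + O(rho))], and the orbit is asymptotic
    to the massless cosmology with [c = exp (- l)].  The right-hand side increases
    with [w], so the distance of two solutions cannot decrease in [phi], while
    Gronwall's inequality bounds its growth: at a fixed large [phi], [w |-> l] is
    expanding and Lipschitz, which yields existence, uniqueness and the continuity
    of [c |-> orbit].  The constant [c] depends on the orbit only, because [K]
    blows up as [t -> 0+] and this fixes the origin of proper time.  Its continuity
    on the quotient is transported from points near [p_-] to all points of an orbit
    by the local flow. *)

Require Import Defs.
From HB Require Import structures.
From mathcomp Require Import all_boot all_order all_algebra.
From mathcomp Require Import all_classical all_reals all_analysis.
From mathcomp Require Import ring lra.
Import Order.TTheory GRing.Theory Num.Theory.
Import numFieldNormedType.Exports.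
Local Open Scope classical_set_scope.
Local Open Scope ring_scope.

Set Implicit Arguments.
Unset Strict Implicit.
Unset Printing Implicit Defensive.

(** In the [(y, z)]-plane the linearisation at [p_-] has a zero eigenvalue in the direction of [z],
    because the derivative of the overlined [f'] vanishes at [0]. With [phi] as independent variable
    this degenerate direction disappears, and [f] only serves to describe neighbourhoods of [p_-].

    The scalar equation loses its meaning when [rho > 1] and its Lipschitz property at [rho = 1].
    Bounding the square root from below by some [theta < 1] gives solutions on all of [R]. For [rho]
    to decay along these as well, [2 kappa theta] must exceed the growth rate of [ln V] by a
    positive [delta], and [N < 2 kappa] leaves room for that. As [rho] decreases from then on, a
    solution on which the truncation is inactive at one point remains a genuine orbit for all larger
    [phi].

    The claimed errors evaluate [V] at [- sqrt (2/3) ln t] and not at [phi (t)]. The two arguments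
    differ by a bounded amount, and [V' / V] is bounded, so the exchange costs a constant factor. *)

(** * Monotonicity, limits and antiderivatives on the real line *)

Section Calculus.
Context {R : realType}.
Implicit Types (f g h df : R -> R) (a b t x : R).

Lemma is_derive_continuous f x d : is_derive x 1 f d -> {for x, continuous f}.
Proof.
move=> fd.
by apply/differentiable_continuous/derivable1_diffP; exact: ex_derive.
Qed.

Lemma is_derive_within_continuous f df a b :
  (forall x, a <= x <= b -> is_derive x 1 f (df x)) ->
  {within `[a, b], continuous f}.
Proof.
move=> fd; apply: continuous_in_subspaceT => x; rewrite inE/= in_itv/= => xab.
exact: is_derive_continuous (fd x xab).
Qed.

Lemma is_derive_mvt f df a b : a <= b ->
  (forall x, a <= x <= b -> is_derive x 1 f (df x)) ->
  exists2 c, a <= c <= b & f b - f a = df c * (b - a).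
Proof.
move=> ab fd; have [||c] := @MVT_segment _ f df a b ab.
- move=> x; rewrite in_itv/= => /andP[ax xb]; apply: fd.
  by rewrite (ltW ax) (ltW xb).
- exact: is_derive_within_continuous fd.
by rewrite in_itv/= => cab e; exists c.
Qed.

Lemma is_derive_ge0_le f df a b : a <= b ->
  (forall x, a <= x <= b -> is_derive x 1 f (df x)) ->
  (forall x, a <= x <= b -> 0 <= df x) -> f a <= f b.
Proof.
move=> ab fd d0; have [c cab e] := is_derive_mvt ab fd.
by rewrite -subr_ge0 e mulr_ge0 ?d0// subr_ge0.
Qed.

Lemma is_derive_le0_ge f df a b : a <= b ->
  (forall x, a <= x <= b -> is_derive x 1 f (df x)) ->
  (forall x, a <= x <= b -> df x <= 0) -> f b <= f a.
Proof.
move=> ab fd d0; have [c cab e] := is_derive_mvt ab fd.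
by rewrite -subr_le0 e mulr_le0_ge0 ?d0// subr_ge0.
Qed.

Lemma is_derive0_eq f a b : a <= b ->
  (forall x, a <= x <= b -> is_derive x 1 f 0) -> f a = f b.
Proof.
move=> ab fd; have [c cab e] := is_derive_mvt (df := cst 0) ab fd.
by apply/eqP; rewrite eq_sym -subr_eq0 e mul0r.
Qed.

Lemma is_derive_near_eq f g x d : (\near x, f x = g x) ->
  is_derive x 1 f d -> is_derive x 1 g d.
Proof. exact: near_eq_is_derive. Qed.

Lemma lipschitz_continuous f (M : R) :
  (forall s t, `|f s - f t| <= M * `|s - t|) -> continuous f.
Proof.
move=> fM x; apply/cvgrPdist_lt => e e0; near=> y.
apply: le_lt_trans (fM x y) _.
have M0 : 0 < `|M| + 1 by rewrite ltr_wpDl.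
apply: (@le_lt_trans _ _ ((`|M| + 1) * `|x - y|)).
  by rewrite ler_wpM2r// (le_trans (ler_norm _))// lerDl.
rewrite mulrC -ltr_pdivlMr//; near: y.
apply: (@cvgr_dist_lt _ _ _ _ _ id); first exact: cvg_id.
by rewrite divr_gt0.
Unshelve. all: by end_near. Qed.

(** The supremum of the lower endpoints works. Limits are obtained below as common points of nested
    intervals, which yields the rate of convergence at the same time. *)
Lemma nested_between (J : Type) (D : set J) (lo hi : J -> R) :
  (forall m n, D m -> D n -> lo m <= hi n) ->
  exists l, forall n, D n -> lo n <= l <= hi n.
Proof.
move=> lohi; have [[n0 Dn0]|D0] := pselect (D !=set0); last first.
  by exists 0 => n Dn; exfalso; apply: D0; exists n.
have ub n : D n -> ubound (lo @` D) (hi n).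
  by move=> Dn _ [m Dm <-]; exact: lohi.
exists (sup (lo @` D)) => n Dn; apply/andP; split.
  apply: ub_le_sup; last by exists n.
  by exists (hi n0); exact: ub.
by apply: ge_sup; [exists (lo n0), n0|exact: ub].
Qed.

Lemma le_geometric_eps (a b c : R) :
  (forall n : nat, a <= b + c * 2^-1 ^+ n) -> a <= b.
Proof.
move=> H; have -> : b = b + c * 0 by rewrite mulr0 addr0.
have cv : (b + c * 2^-1 ^+ n) @[n --> \oo] --> b + c * 0.
  apply: cvgD; first exact: cvg_cst.
  apply: cvgM; first exact: cvg_cst.
  by apply: cvg_expr; rewrite ger0_norm ?invr_ge0// invf_lt1// ltr1n.
rewrite -(cvg_lim _ cv)//; apply: limr_ge; first by apply/cvg_ex; exists (b + c * 0).
by near=> n; exact: H.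
Unshelve. all: by end_near. Qed.

(** The fundamental theorem differentiates the integral from [a] only at points to the right of [a].
    Normalising by the value at [0] makes the antiderivatives for different negative base points
    agree, so the base point may move with [x]. *)
Lemma antiderivative_exists f : continuous f ->
  exists F, forall x, is_derive x 1 F (f x).
Proof.
move=> cf.
pose G a x : R := (\int[lebesgue_measure]_(t in `[a, x]) f t)%R
                  - (\int[lebesgue_measure]_(t in `[a, 0%R]) f t)%R.
have dG a x : a < x -> is_derive x 1 (G a) (f x).
  move=> ax.
  have [||||d e] := @continuous_FTC1 R f (BLeft a) x (x + 1).
  - by rewrite ltrDl.
  - apply: continuous_compact_integrable; first exact: segment_compact.
    exact: continuous_subspaceT.
  - by [].
  - exact: cf.
  have -> : G a = (fun y => (\int[lebesgue_measure]_(t in `[a, y]) f t)%R)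
      - cst (\int[lebesgue_measure]_(t in `[a, 0%R]) f t)%R by [].
  rewrite -[f x]subr0; apply: is_deriveB.
  by have := derivableP d; rewrite -derive1E e.
have G0 a : G a 0 = 0 by rewrite /G subrr.
have GE a b x : a < 0 -> b < 0 -> a < x -> b < x -> G a x = G b x.
  move=> a0 b0 ax bx.
  have d y : a < y -> b < y -> is_derive y 1 (G a - G b) 0.
    by move=> ay yb; rewrite -(subrr (f y)); apply: is_deriveB; exact: dG.
  suff : (G a - G b) x = (G a - G b) 0.
    by rewrite !fctE !G0 subrr => /eqP; rewrite subr_eq0 => /eqP.
  have [x0|x0] := leP x 0.
    by apply: is_derive0_eq => // y /andP[xy _]; apply: d; apply: lt_le_trans xy.
  apply/esym/is_derive0_eq; first exact: ltW.
  by move=> y /andP[y0 _]; apply: d; [exact: lt_le_trans a0 _|exact: lt_le_trans b0 _].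
exists (fun x => G (- `|x| - 1) x) => x.
apply: (@is_derive_near_eq (G (- `|x| - 2))); last first.
  apply: dG; have := ler_norm (- x); rewrite normrN; lra.
near=> y; have xy : `|x - y| < 1.
  near: y; apply: (@cvgr_dist_lt _ _ _ _ _ id); first exact: cvg_id.
  exact: ltr01.
have h1 := normr_ge0 x; have h2 := normr_ge0 y.
have := ler_norm (- x); rewrite normrN => h3.
have := ler_norm (- y); rewrite normrN => h4.
have := ler_normB x (x - y); rewrite opprB addrCA subrr addr0 => h5.
have h6 := ler_norm (x - y).
apply: GE; lra.
Unshelve. all: by end_near. Qed.

(** The function [C / a * expR (a * |t - t0|)] is compared with [h] and [- h] through the sign of a
    derivative. In [dE], [s] is the sign given to [h] and [k] the side of [t0]. Integration gains
    the factor [1 / a], the source of the contraction in Picard's iteration. *)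
Lemma le_expR_integral h dh t0 (C a : R) : 0 < a -> h t0 = 0 ->
  (forall t, is_derive t 1 h (dh t)) ->
  (forall t, `|dh t| <= C * expR (a * `|t - t0|)) ->
  forall t, `|h t| <= C / a * expR (a * `|t - t0|).
Proof.
move=> a0 h0 hd hC t.
have dE (s k u : R) : is_derive u 1 (fun t => s * h t + C / a * expR (k * a * (t - t0)))
    (s * dh u + C * k * expR (k * a * (u - t0))).
  have hu := hd u.
  have e1 : is_derive u 1 (fun t => expR (k * a * (t - t0)))
      (expR (k * a * (u - t0)) * (k * a)).
    apply: is_derive1_comp.
    by apply: is_derive_eq; rewrite subr0 /GRing.scale/= mulr1.
  apply: is_derive_eq; rewrite /GRing.scale/=.
  by congr (_ + _); field; rewrite gt_eqF.
have C0 : 0 <= C.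
  have := le_trans (normr_ge0 _) (hC t0).
  by rewrite subrr normr0 mulr0 expR0 mulr1.
have CA : 0 <= C / a by rewrite divr_ge0// ltW.
have key (s : R) : s = 1 \/ s = -1 -> 0 <= s * h t + C / a * expR (a * `|t - t0|).
  move=> s1; have [tt0|/ltW tt0] := leP t0 t.
    rewrite ger0_norm ?subr_ge0//.
    have := @is_derive_ge0_le _ _ t0 t tt0 (fun u _ => dE s 1 u).
    rewrite /= h0 mulr0 add0r subrr mulr0 expR0 mulr1 !mul1r; move=> H.
    apply: le_trans CA _; rewrite -[X in X <= _]mulr1; apply: H => u /andP[u0 _].
    have := hC u; rewrite [`|u - t0|]ger0_norm ?subr_ge0// ler_norml => /andP[? ?].
    by case: s1 => ->; lra.
  rewrite ler0_norm ?subr_le0// mulrN.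
  have := @is_derive_le0_ge _ _ t t0 tt0 (fun u _ => dE s (-1) u).
  rewrite /= h0 mulr0 add0r subrr mulr0 expR0 mulr1 !mulN1r !mulNr; move=> H.
  apply: le_trans CA _; apply: H => u /andP[_ u0].
  have := hC u; rewrite [`|u - t0|]ler0_norm ?subr_le0// mulrN ler_norml => /andP[? ?].
  by rewrite mulrN1 !mulNr; case: s1 => ->; lra.
have := key 1 (or_introl erefl); have := key (-1) (or_intror erefl).
by rewrite ler_norml => k1 k2; apply/andP; split; lra.
Qed.

End Calculus.

(** * Ordinary differential equations *)

Section Picard.
Context {R : realType} (d : nat) (F : R -> ('I_d -> R) -> 'I_d -> R) (M L : R).
Hypotheses (L0 : 0 < L) (M0 : 0 <= M).
Hypothesis F_bound : forall t x i, `|F t x i| <= M.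
Hypothesis F_lipschitz : forall t (x y : 'I_d -> R) (e : R), (forall i, `|x i - y i| <= e) ->
  forall i, `|F t x i - F t y i| <= L * e.
Hypothesis F_continuous : forall x : R -> 'I_d -> R,
  (forall i, continuous (fun s => x s i)) -> forall i, continuous (fun t => F t (x t) i).

(* The Picard iterates satisfy [|x_(n+1) - x_n| <= B 2^-n exp (2 L |t - t0|)], so that
   they converge on all of [R] at once. *)
Theorem picard_lindelof t0 (x0 : 'I_d -> R) : exists x : R -> 'I_d -> R,
  x t0 = x0 /\ forall (t : R) i, is_derive t 1 (fun s => x s i) (F t (x t) i).
Proof.
(* [A f] is the integral of [f] from [t0]; the value for a discontinuous [f] is arbitrary. *)
have [A AP] : exists A : (R -> R) -> R -> R, forall f, continuous f ->
    A f t0 = 0 /\ forall t : R, is_derive t 1 (A f) (f t).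
  have /choice[A AP] : forall f : R -> R, exists G : R -> R, continuous f ->
      G t0 = 0 /\ forall t : R, is_derive t 1 G (f t).
    move=> f; have [cf|ncf] := pselect (continuous f); last by exists (cst 0).
    have [G dG] := antiderivative_exists cf.
    exists (G - cst (G t0)) => _; split; first by rewrite !fctE subrr.
    by move=> t; rewrite -[f t]subr0; have := dG t => ?; apply: is_deriveB.
  by exists A.
pose step (x : R -> 'I_d -> R) t i := x0 i + A (fun s => F s (x s) i) t.
have step_derive x : (forall i, continuous (fun s => x s i)) ->
    forall (t : R) i, is_derive t 1 (fun s => step x s i) (F t (x t) i).
  move=> cx t i; have [_ /(_ t) dA] := AP _ (@F_continuous x cx i).
  rewrite -[F t (x t) i]add0r.
  by apply: is_deriveD.
have step0 x : (forall i, continuous (fun s => x s i)) -> step x t0 = x0.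
  move=> cx; apply/funext => i; have [A0 _] := AP _ (@F_continuous x cx i).
  by rewrite /step A0 addr0.
pose X n := iter n step (fun _ => x0).
have step_lip x : (forall i, continuous (fun s => x s i)) ->
    forall i s t, `|step x s i - step x t i| <= M * `|s - t|.
  move=> cx i s t; wlog st : s t / s <= t.
    move=> H; have [/H//|/ltW/H] := leP s t.
    by rewrite distrC [X in _ * X]distrC.
  have [c _ e] := is_derive_mvt st (fun u _ => step_derive x cx u i).
  by rewrite distrC e normrM distrC ler_wpM2r.
have Xlip n i (s t : R) : `|X n s i - X n t i| <= M * `|s - t|.
  elim: n i s t => [|n IH] i s t.
    by rewrite /X/= subrr normr0 mulr_ge0// M0.
  by apply: step_lip => j; apply: lipschitz_continuous (IH j).
have Xcont n i : continuous (fun s => X n s i).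
  by apply: lipschitz_continuous (Xlip n i).
pose E t := expR (2 * L * `|t - t0|).
pose B := M / (2 * L).
have L20 : 0 < 2 * L by rewrite mulr_gt0.
have Xstep n i (t : R) : `|X n.+1 t i - X n t i| <= B * 2^-1 ^+ n * E t.
  elim: n i t => [|n IH] i t.
    rewrite expr0 mulr1 /X/= /B /E.
    apply: (@le_expR_integral _ (fun t => step (fun=> x0) t i - x0 i)
      (fun t => F t x0 i)) => //.
    - by rewrite step0 ?subrr//; exact: (Xcont 0%N).
    - move=> s; have ds := step_derive (fun=> x0) (Xcont 0%N) s i.
      by rewrite -[F s x0 i]subr0; apply: is_deriveB.
    move=> s; apply: (le_trans (@F_bound _ _ _)).
    rewrite ler_peMr ?M0// (le_trans _ (expR_ge1Dx _))// lerDl mulr_ge0//.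
    exact: ltW.
  (* The exponent of the weight [E] is twice the Lipschitz constant, so each iteration gains
     [L / (2 * L) = 1 / 2]. *)
  have -> : B * 2^-1 ^+ n.+1 = L * (B * 2^-1 ^+ n) / (2 * L).
    by rewrite exprS; field; rewrite gt_eqF.
  apply: (@le_expR_integral _ (fun t => X n.+2 t i - X n.+1 t i)
    (fun t => F t (X n.+1 t) i - F t (X n t) i)) => //.
  - by rewrite /X !iterS !step0 ?subrr// => j; [exact: (Xcont n)|exact: (Xcont n.+1)].
  - by move=> s; exact: is_deriveB (step_derive _ (Xcont n.+1) s i) (step_derive _ (Xcont n) s i).
  by move=> s; rewrite -mulrA; apply: F_lipschitz => j; exact: IH.
have [x xP] : exists x : R -> 'I_d -> R, forall n t i,
    `|x t i - X n t i| <= 2 * B * E t * 2^-1 ^+ n.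
  have H (t : R) : exists y : 'I_d -> R, forall i n, `|y i - X n t i| <= 2 * B * E t * 2^-1 ^+ n.
    suff /choice[y yP] : forall i, exists y : R, forall n,
        `|y - X n t i| <= 2 * B * E t * 2^-1 ^+ n by exists y.
    move=> i.
    (* [D n] is the tail of the geometric series of step sizes. As [D n - D n.+1] bounds the step
       from [X n] to [X n.+1], the intervals of radius [D n] around [X n t i] are nested. *)
    pose D n := 2 * B * E t * 2^-1 ^+ n.
    have dS n : B * 2^-1 ^+ n * E t = D n - D n.+1 by rewrite /D exprS; field.
    have d0 n : 0 <= D n.
      by rewrite /D !mulr_ge0// ?expR_ge0// ?exprn_ge0// ?invr_ge0 ?M0// ltW.
    have lo m k : X m t i - D m <= X (m + k)%N t i - D (m + k)%N.
      elim: k => [|k IH]; first by rewrite addn0.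
      apply: le_trans IH _; rewrite addnS.
      by have := Xstep (m + k)%N i t; rewrite dS ler_norml => /andP[? ?]; lra.
    have hi m k : X (m + k)%N t i + D (m + k)%N <= X m t i + D m.
      elim: k => [|k IH]; first by rewrite addn0.
      apply: le_trans _ IH; rewrite addnS.
      by have := Xstep (m + k)%N i t; rewrite dS ler_norml => /andP[? ?]; lra.
    have [|l lP] := @nested_between R nat setT (fun n => X n t i - D n)
        (fun n => X n t i + D n).
      move=> m n _ _; apply: le_trans (lo m n) _.
      rewrite addnC; apply: le_trans _ (hi n m).
      by have := d0 (n + m)%N; lra.
    by exists l => n; have /andP[? ?] := lP n I; rewrite -/(D n) ler_norml; apply/andP; split; lra.
  have [x xP] := choice H.
  by exists x => n t i; exact: xP.
(* The iterates share the Lipschitz constant [M], which survives pointwise limits. *)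
have xcont i : continuous (fun s => x s i).
  apply: (@lipschitz_continuous _ _ M) => s t.
  apply: (@le_geometric_eps _ _ _ (2 * B * E s + 2 * B * E t)) => n.
  have := xP n s i; have := xP n t i; have := Xlip n i s t.
  rewrite !ler_norml => /andP[? ?] /andP[? ?] /andP[? ?].
  by apply/andP; split; lra.
(* Both [x] and [step x] are within a multiple of [2^-n] of [X n.+1], for every [n]. *)
have xE : x = step x.
  apply/funext => t; apply/funext => i; apply/eqP; rewrite -subr_eq0 -normr_le0.
  apply: (@le_geometric_eps _ _ _ (2 * B * E t)) => n; rewrite add0r.
  have h1 : `|step x t i - X n.+1 t i| <= L * (2 * B * 2^-1 ^+ n) / (2 * L) * E t.
    apply: (@le_expR_integral _ (fun t => step x t i - X n.+1 t i)
      (fun t => F t (x t) i - F t (X n t) i)) => //.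
    - by rewrite /X iterS !step0 ?subrr//; exact: (Xcont n).
    - by move=> s; exact: is_deriveB (step_derive _ xcont s i) (step_derive _ (Xcont n) s i).
    move=> s; rewrite -mulrA; apply: F_lipschitz => j.
    by rewrite mulrAC; exact: xP.
  have := xP n.+1 t i; move: h1.
  have -> : L * (2 * B * 2^-1 ^+ n) / (2 * L) * E t = B * E t * 2^-1 ^+ n.
    by field; rewrite gt_eqF.
  have -> : 2 * B * E t * 2^-1 ^+ n.+1 = B * E t * 2^-1 ^+ n by rewrite exprS; field.
  have -> : 2 * B * E t * 2^-1 ^+ n = 2 * (B * E t * 2^-1 ^+ n) by ring.
  rewrite !ler_norml => /andP[? ?] /andP[? ?].
  by apply/andP; split; lra.
exists x; split; first by rewrite xE step0.
by move=> t i; rewrite {1}xE; exact: step_derive.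
Qed.

End Picard.

(** * The flow on phase space *)

Section Flow.
Context {R : realType} (V : R -> R).
Implicit Types (p q : phase V) (g : R -> phase V) (a b s t u : R).

Lemma phase_constraint p :
  0 < K_ p /\ K_ p ^+ 2 = 3 * V (phi_ p) + 3 / 2 * phidot_ p ^+ 2.
Proof. exact: (set_mem (valP p)). Qed.

Lemma phase_ext p q : phi_ p = phi_ q -> phidot_ p = phidot_ q ->
  K_ p = K_ q -> p = q.
Proof.
move=> e1 e2 e3; apply: val_inj; move: e1 e2 e3; rewrite /phi_ /phidot_ /K_ set_valE.
by case: (\val p) => -[? ?] ?; case: (\val q) => -[? ?] ? /= -> -> ->.
Qed.

Lemma phase_point (x y z : R) : 0 < z ->
  z ^+ 2 = 3 * V x + 3 / 2 * y ^+ 2 ->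
  exists p, [/\ phi_ p = x, phidot_ p = y & K_ p = z].
Proof.
move=> z0 e; have H : (x, y, z) \in phase_set V by rewrite inE.
by exists (exist (fun w => w \in phase_set V) (x, y, z) H); rewrite /phi_ /phidot_ /K_ set_valE.
Qed.

(** The condition of [is_solution] at a single time. It is local in [t] and can therefore be checked
    piecewise on glued curves. *)
Definition solves_at g t :=
  [/\ is_derive t 1 (@phi_ R V \o g) (phidot_ (g t)),
      is_derive t 1 (@phidot_ R V \o g)
        (- K_ (g t) * phidot_ (g t) - derive1 V (phi_ (g t))) &
      is_derive t 1 (@K_ R V \o g) (- (3 / 2) * phidot_ (g t) ^+ 2)].

Lemma solves_at_near g h t : (\near t, g t = h t) -> solves_at g t -> solves_at h t.
Proof.
move=> gh; have e := nbhs_singleton gh; rewrite /solves_at e => -[d1 d2 d3].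
split; [move: d1|move: d2|move: d3]; apply: is_derive_near_eq; near=> u => /=;
by rewrite (near gh u).
Unshelve. all: by end_near. Qed.

Lemma is_derive_comp_shift (f : R -> R) t k d :
  is_derive (t + k) 1 f d -> is_derive t 1 (fun u => f (u + k)) d.
Proof.
move=> fd; have -> : (fun u => f (u + k)) = f \o (shift k) by [].
rewrite -[d]mulr1; apply: is_derive1_comp; exact: is_derive_shift.
Qed.

Lemma solves_at_shift g t k : solves_at g (t + k) -> solves_at (fun u => g (u + k)) t.
Proof.
move=> [d1 d2 d3].
by split; [exact: (@is_derive_comp_shift (@phi_ R V \o g))
          |exact: (@is_derive_comp_shift (@phidot_ R V \o g))
          |exact: (@is_derive_comp_shift (@K_ R V \o g))].
Qed.

(** The squared Euclidean distance: unlike the distance, it is differentiable along pairs of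
    solutions that may meet. *)
Definition dist2 p q :=
  (phi_ p - phi_ q) ^+ 2 + (phidot_ p - phidot_ q) ^+ 2 + (K_ p - K_ q) ^+ 2.

Lemma dist2_ge0 p q : 0 <= dist2 p q.
Proof. by rewrite /dist2 !addr_ge0 ?sqr_ge0. Qed.

Lemma dist2_eq0 p q : dist2 p q <= 0 -> p = q.
Proof.
rewrite /dist2 => h; have h1 := sqr_ge0 (phi_ p - phi_ q).
have h2 := sqr_ge0 (phidot_ p - phidot_ q); have h3 := sqr_ge0 (K_ p - K_ q).
by apply: phase_ext; apply/eqP; rewrite -subr_eq0 -sqrf_eq0; apply/eqP; lra.
Qed.

Definition in_box (M : R) p := [/\ `|phi_ p| <= M, `|phidot_ p| <= M & `|K_ p| <= M].

Lemma norm_mul3_le (M m x y : R) : `|m| <= M ->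
  `|m * x * y| <= M * (x ^+ 2 + y ^+ 2) / 2.
Proof.
move=> mM; rewrite !normrM -mulrA.
apply: (@le_trans _ _ (M * (`|x| * `|y|))).
  by apply: ler_wpM2r => //; rewrite mulr_ge0.
rewrite -mulrA; apply: ler_wpM2l; first exact: le_trans mM.
rewrite -(real_normK (num_real x)) -(real_normK (num_real y)).
by have := sqr_ge0 (`|x| - `|y|); lra.
Qed.

(** [D] times [expR (- C * (u - a))] is nonincreasing and [D] times [expR (C * (u - a))]
    nondecreasing. Both directions are needed, since solutions are compared forwards and backwards
    in time. *)
Lemma exponential_growth (D dD : R -> R) C a b : a <= b ->
  (forall u, a <= u <= b -> is_derive u 1 D (dD u)) ->
  (forall u, a <= u <= b -> `|dD u| <= C * D u) ->
  D b <= D a * expR (C * (b - a)) /\ D a <= D b * expR (C * (b - a)).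
Proof.
move=> ab dD1 dD2.
have dE (k u : R) : a <= u <= b -> is_derive u 1 (fun t => D t * expR (k * (t - a)))
    ((dD u + k * D u) * expR (k * (u - a))).
  move=> uab; have hu := dD1 u uab.
  have e1 : is_derive u 1 (fun t => expR (k * (t - a))) (expR (k * (u - a)) * k).
    apply: is_derive1_comp.
    by apply: is_derive_eq; rewrite subr0 /GRing.scale/= mulr1.
  by apply: is_derive_eq; rewrite /GRing.scale/=; ring.
split.
  have := @is_derive_le0_ge _ _ _ a b ab (dE (- C)).
  rewrite /= subrr mulr0 expR0 mulr1 => H.
  rewrite -ler_pdivrMr ?expR_gt0// -expRN -mulNr; apply: H => u uab.
  apply: mulr_le0_ge0; last exact: expR_ge0.
  by have := dD2 u uab; rewrite ler_norml => /andP[? ?]; lra.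
have := @is_derive_ge0_le _ _ _ a b ab (dE C).
rewrite /= subrr mulr0 expR0 mulr1; apply => u uab.
apply: mulr_ge0; last exact: expR_ge0.
by have := dD2 u uab; rewrite ler_norml => /andP[? ?]; lra.
Qed.

Hypothesis V_C2 : class_C 2 V.

Lemma potential_derive (x : R) : is_derive x 1 V (derive1 V x).
Proof. by have := derivableP (V_C2.1 0%N isT x); rewrite derive1E. Qed.

Lemma potential_derive2 (x : R) : is_derive x 1 (derive1 V) (derive1n 2 V x).
Proof. by have := derivableP (V_C2.1 1%N isT x); rewrite -derive1E. Qed.

Lemma continuous_bounded_on (f : R -> R) a b : {within `[a, b], continuous f} ->
  exists B, forall u, a <= u <= b -> `|f u| <= B.
Proof.
move=> cf; have [ab|ba] := leP a b; last first.
  by exists 0 => u /andP[? ?]; lra.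
have [c _ cP] := EVT_max ab cf; have [d _ dP] := EVT_min ab cf.
exists (`|f c| + `|f d|) => u uab.
have h : u \in `[a, b] by rewrite in_itv.
have := cP u h; have := dP u h; have := ler_norm (f c).
have := ler_norm (- f d); rewrite normrN.
have := normr_ge0 (f c); have := normr_ge0 (f d) => ? ? ? ? ? ?.
by rewrite ler_norml; apply/andP; split; lra.
Qed.

Lemma dpotential_bounded (M : R) : exists B, 0 <= B /\
  forall x, `|x| <= M -> `|derive1 V x| <= B.
Proof.
have [|B BP] := @continuous_bounded_on (derive1 V) (- M) M.
  exact: is_derive_within_continuous (fun x _ => potential_derive2 x).
exists `|B|; split => // x; rewrite ler_norml => /BP h.
exact: le_trans h (ler_norm _).
Qed.

Lemma dpotential_lipschitz (M : R) : exists L, 0 <= L /\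
  forall x y, `|x| <= M -> `|y| <= M ->
    `|derive1 V x - derive1 V y| <= L * `|x - y|.
Proof.
have [|B BP] := @continuous_bounded_on (derive1n 2 V) (- M) M.
  by apply: continuous_subspaceT; exact: V_C2.2.
exists `|B|; split => // x y; wlog xy : x y / x <= y.
  move=> H xM yM; have [/H|/ltW/H] := leP x y; first exact.
  by rewrite distrC [X in _ * X]distrC; apply.
rewrite (ler_norml x) (ler_norml y) => /andP[x1 x2] /andP[y1 y2].
have [c /andP[c1 c2] e] := is_derive_mvt xy (fun u _ => potential_derive2 u).
rewrite distrC e normrM distrC; apply: ler_wpM2r => //.
by apply: le_trans (ler_norm B); apply: BP; apply/andP; split; lra.
Qed.

Lemma gronwall_solutions (M : R) : exists C, forall g1 g2 s t, s <= t ->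
  (forall u, s <= u <= t -> [/\ solves_at g1 u, solves_at g2 u,
     in_box M (g1 u) & in_box M (g2 u)]) ->
  dist2 (g1 t) (g2 t) <= dist2 (g1 s) (g2 s) * expR (C * (t - s)) /\
  dist2 (g1 s) (g2 s) <= dist2 (g1 t) (g2 t) * expR (C * (t - s)).
Proof.
have [L [L0 LP]] := dpotential_lipschitz M.
(* The coupling of [phi] and [phidot] costs [1], the difference of the values of [V'] costs [L], and
   the quadratic terms cost at most [6 * M]. *)
exists (1 + L + 8 * M) => g1 g2 s t st H.
pose e (p q : phase V) := derive1 V (phi_ p) - derive1 V (phi_ q).
apply: (@exponential_growth (fun u => dist2 (g1 u) (g2 u))
  (fun u => 2 * ((phi_ (g1 u) - phi_ (g2 u)) * (phidot_ (g1 u) - phidot_ (g2 u)))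
   + 2 * (phidot_ (g1 u) - phidot_ (g2 u)) *
     ((- K_ (g1 u) * phidot_ (g1 u) - derive1 V (phi_ (g1 u)))
     - (- K_ (g2 u) * phidot_ (g2 u) - derive1 V (phi_ (g2 u))))
   + 2 * (K_ (g1 u) - K_ (g2 u)) *
     ((- (3 / 2) * phidot_ (g1 u) ^+ 2) - (- (3 / 2) * phidot_ (g2 u) ^+ 2)))) => //.
  move=> u /H[[d1 d2 d3] [e1 e2 e3] _ _].
  have -> : (fun u => dist2 (g1 u) (g2 u)) =
    ((@phi_ R V \o g1) - (@phi_ R V \o g2)) ^+ 2 + ((@phidot_ R V \o g1) - (@phidot_ R V \o g2)) ^+ 2
    + ((@K_ R V \o g1) - (@K_ R V \o g2)) ^+ 2 by apply/funext => r.
  apply: is_derive_eq; rewrite /GRing.scale/= !fctE/=; ring.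
move=> u /H[_ _ [x1 x2 x3] [y1 y2 y3]].
rewrite /dist2.
move: (phi_ (g1 u)) (phi_ (g2 u)) (LP _ _ x1 y1) => a1 a2 LP1.
move: (phidot_ (g1 u)) (phidot_ (g2 u)) (K_ (g1 u)) (K_ (g2 u)) x2 x3 y2 y3 =>
  b1 b2 k1 k2 B1 K1 B2 K2.
move: LP1; set A := derive1 V a1; set B := derive1 V a2 => LP1.
have h1 : `|1 * (a1 - a2) * (b1 - b2)| <= 1 * ((a1 - a2) ^+ 2 + (b1 - b2) ^+ 2) / 2.
  by apply: norm_mul3_le; rewrite normr1.
have h2 := norm_mul3_le (b1 - b2) (b1 - b2) K1.
have h3 := norm_mul3_le (k1 - k2) (b1 - b2) B2.
have h4 := norm_mul3_le (k1 - k2) (b1 - b2) B1.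
have h5 : `|(A - B) * (b1 - b2)| <= L * ((a1 - a2) ^+ 2 + (b1 - b2) ^+ 2) / 2.
  have Ln : `|L| <= L by rewrite ger0_norm.
  have h := norm_mul3_le (`|a1 - a2|) (`|b1 - b2|) Ln.
  rewrite !real_normK ?num_real// in h.
  apply: le_trans h.
  by rewrite !normrM !normr_id (ger0_norm L0) ler_wpM2r.
have s1 := sqr_ge0 (a1 - a2); have s2 := sqr_ge0 (b1 - b2).
have s3 := sqr_ge0 (k1 - k2).
have Mge0 : 0 <= M by apply: le_trans B1.
have m1 : 0 <= M * (a1 - a2) ^+ 2 by rewrite mulr_ge0.
have m2 : 0 <= M * (b1 - b2) ^+ 2 by rewrite mulr_ge0.
have m3 : 0 <= M * (k1 - k2) ^+ 2 by rewrite mulr_ge0.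
have m4 : 0 <= L * (k1 - k2) ^+ 2 by rewrite mulr_ge0.
(* The quadratic terms are split so that each summand is a coordinate bounded by [M] times two
   differences. *)
have -> : 2 * ((a1 - a2) * (b1 - b2)) + 2 * (b1 - b2) *
    (- k1 * b1 - A - (- k2 * b2 - B)) +
    2 * (k1 - k2) * (- (3 / 2) * b1 ^+ 2 - - (3 / 2) * b2 ^+ 2) =
  2 * (1 * (a1 - a2) * (b1 - b2)) - 2 * (k1 * (b1 - b2) * (b1 - b2))
  - 2 * (b2 * (k1 - k2) * (b1 - b2)) - 2 * ((A - B) * (b1 - b2))
  - 3 * (b1 * (k1 - k2) * (b1 - b2)) - 3 * (b2 * (k1 - k2) * (b1 - b2)) by field.
move: h1 h2 h3 h4 h5; rewrite !ler_norml.
move: (1 * (a1 - a2) * (b1 - b2)) (k1 * (b1 - b2) * (b1 - b2))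
  (b2 * (k1 - k2) * (b1 - b2)) (b1 * (k1 - k2) * (b1 - b2))
  ((A - B) * (b1 - b2)) => z1 z2 z3 z4 z5.
move=> /andP[? ?] /andP[? ?] /andP[? ?] /andP[? ?] /andP[? ?].
by apply/andP; split; lra.
Qed.

Lemma solution_bounded g s t : (forall u, s <= u <= t -> solves_at g u) ->
  exists M, forall u, s <= u <= t -> in_box M (g u).
Proof.
move=> H.
have [|B1 H1] := @continuous_bounded_on (@phi_ R V \o g) s t.
  by apply: is_derive_within_continuous => u /H[d _ _]; exact: d.
have [|B2 H2] := @continuous_bounded_on (@phidot_ R V \o g) s t.
  by apply: is_derive_within_continuous => u /H[_ d _]; exact: d.
have [|B3 H3] := @continuous_bounded_on (@K_ R V \o g) s t.
  by apply: is_derive_within_continuous => u /H[_ _ d]; exact: d.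
exists (`|B1| + `|B2| + `|B3|) => u uab.
have := H1 u uab; have := H2 u uab; have := H3 u uab => /=.
have := ler_norm B1; have := ler_norm B2; have := ler_norm B3.
have := normr_ge0 B1; have := normr_ge0 B2; have := normr_ge0 B3.
by move=> *; split; lra.
Qed.

Lemma in_box_le M M' p : M <= M' -> in_box M p -> in_box M' p.
Proof. by move=> MM [? ? ?]; split; exact: le_trans MM. Qed.

(** Between [s] and [t] both solutions stay in a bounded box, where Gronwall's inequality keeps the
    distance at zero. *)
Lemma solution_unique g1 g2 a b s t : is_solution a b g1 -> is_solution a b g2 ->
  a < s < b -> a < t < b -> g1 s = g2 s -> g1 t = g2 t.
Proof.
move=> h1 h2 sab tab e.
pose m := Num.min s t; pose M := Num.max s t.
have ms : m <= s <= M by rewrite /m /M; case: (leP s t) => ?; apply/andP; split; lra.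
have mt : m <= t <= M by rewrite /m /M; case: (leP s t) => ?; apply/andP; split; lra.
have sub u : m <= u <= M -> a < u < b.
  by move: sab tab; rewrite /m /M; case: (leP s t) => ? /andP[? ?] /andP[? ?] /andP[? ?]; apply/andP; split; lra.
have [M1 B1] := @solution_bounded g1 m M (fun u um => h1 u (sub u um)).
have [M2 B2] := @solution_bounded g2 m M (fun u um => h2 u (sub u um)).
have [C CP] := gronwall_solutions (`|M1| + `|M2|).
have box u : m <= u <= M -> [/\ solves_at g1 u, solves_at g2 u,
     in_box (`|M1| + `|M2|) (g1 u) & in_box (`|M1| + `|M2|) (g2 u)].
  move=> um; split; [exact: h1 (sub u um)|exact: h2 (sub u um)| |].
    by apply: in_box_le (B1 u um); rewrite (le_trans (ler_norm _))// lerDl.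
  by apply: in_box_le (B2 u um); rewrite (le_trans (ler_norm _))// lerDr.
apply: dist2_eq0; have d0 : dist2 (g1 s) (g2 s) = 0 by rewrite e /dist2 !subrr expr0n/= !addr0.
have [st|/ltW ts] := leP s t.
  have [|+ _] := CP g1 g2 s t st.
    by move=> u /andP[? ?]; apply: box; apply/andP; split; rewrite /m /M; case: (leP s t) st => ? ?; lra.
  by rewrite d0 mul0r.
have [|_] := CP g1 g2 t s ts.
  by move=> u /andP[? ?]; apply: box; apply/andP; split; rewrite /m /M; case: (leP s t) ts => ? ?; lra.
by rewrite d0 mul0r.
Qed.

Lemma flow_orbit_sym p q : flow_orbit p q -> flow_orbit q p.
Proof. by move=> [a [b [g [s [t [? ? ? ? ?]]]]]]; exists a, b, g, t, s. Qed.

(** The second solution is shifted in time so that both pass through [q] at time [t]. By uniqueness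
    they agree on the overlap of their intervals, and near each time the glued curve coincides with
    one of them. *)
Lemma flow_orbit_trans p q r : flow_orbit p q -> flow_orbit q r -> flow_orbit p r.
Proof.
move=> [a [b [g [s [t [sg sab tab gs gt]]]]]].
move=> [c' [d' [h' [s' [t' [sh' scd' tcd' hs' ht']]]]]].
pose k := s' - t; pose h u := h' (u + k); pose c := c' - k; pose d := d' - k.
have sh : is_solution c d h.
  rewrite /c /d => u /andP[? ?]; apply: solves_at_shift; apply: sh'.
  by apply/andP; split; lra.
have htq : h t = q by rewrite /h /k addrCA subrr addr0.
have tcd : c < t < d.
  by move: scd' => /andP[? ?]; rewrite /c /d /k; apply/andP; split; lra.
pose m := Num.max a c; pose M := Num.min b d.
have agree u : a < u < b -> c < u < d -> g u = h u.
  move=> uab ucd; apply: (@solution_unique g h m M t u).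
  - move=> v /andP[mv vM]; apply: sg; move: mv vM; rewrite /m /M.
    by rewrite gt_max lt_min => /andP[-> _] /andP[-> _].
  - move=> v /andP[mv vM]; apply: sh; move: mv vM; rewrite /m /M.
    by rewrite gt_max lt_min => /andP[_ ->] /andP[_ ->].
  - rewrite /m /M gt_max lt_min; move: tab tcd => /andP[-> ->] /andP[-> ->] //.
  - rewrite /m /M gt_max lt_min; move: uab ucd => /andP[-> ->] /andP[-> ->] //.
  by rewrite gt htq.
pose f u := if a < u < b then g u else h u.
exists (Num.min a c), (Num.max b d), f, s, (t' - k).
have fh u : c < u < d -> f u = h u.
  by rewrite /f; case: ifPn => // + ucd => uab; exact: agree.
have inopen x y u : x < u < y -> \near u, x < u < y.
  move=> xuy; near=> v; apply/andP; split; near: v.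
    by apply: lt_nbhsr; case/andP: xuy.
  by apply: lt_nbhsl; case/andP: xuy.
split.
- move=> u; rewrite gt_min lt_max => uacbd.
  have [uab|uab] := boolP (a < u < b).
    apply: (@solves_at_near g); last exact: sg.
    have := inopen _ _ _ uab; apply: filterS => v vab.
    by rewrite /f vab.
  have ucd : c < u < d.
    move: uacbd uab tab tcd => /andP[U1 U2].
    rewrite negb_and -!leNgt => /orP[ua|bu] /andP[? ?] /andP[? ?]; apply/andP.
      by case/orP: U1 => ?; split; lra.
    by case/orP: U2 => ?; split; lra.
  apply: (@solves_at_near h); last exact: sh.
  by have := inopen _ _ _ ucd; apply: filterS => v /fh.
- by move: sab => /andP[? ?]; rewrite gt_min lt_max; apply/andP; split; apply/orP; left.
- move: tcd' => /andP[? ?]; rewrite gt_min lt_max.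
  by apply/andP; split; apply/orP; right; rewrite /c /d; lra.
- by rewrite /f sab.
rewrite fh; first by rewrite /h subrK.
by move: tcd' => /andP[? ?]; rewrite /c /d; apply/andP; split; lra.
Unshelve. all: by end_near. Qed.

Lemma orbit_of_eq p q : orbit_of p = orbit_of q <-> flow_orbit p = flow_orbit q.
Proof.
split; first by move=> /eqmodP/asboolP.
by move=> e; apply/eqmodP/asboolP.
Qed.

Lemma flow_orbit_eq p q : flow_orbit p q -> orbit_of p = orbit_of q.
Proof.
move=> pq; apply/orbit_of_eq; apply/seteqP; split => r.
  exact: flow_orbit_trans (flow_orbit_sym pq).
exact: flow_orbit_trans pq.
Qed.

Lemma solution_orbit a b g s t : is_solution a b g -> a < s < b -> a < t < b ->
  orbit_of (g s) = orbit_of (g t).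
Proof. by move=> *; apply: flow_orbit_eq; exists a, b, g, s, t. Qed.

End Flow.

(** * Local flow, and its use for open saturated sets of phase space *)

Section LocalFlow.
Context {R : realType}.

Lemma is_derive_lipschitz (f df : R -> R) (M : R) :
  (forall u : R, is_derive u 1 f (df u)) -> (forall u, `|df u| <= M) ->
  forall s t, `|f s - f t| <= M * `|s - t|.
Proof.
move=> fd dM s t; wlog st : s t / s <= t.
  move=> H; have [/H//|/ltW/H] := leP s t.
  by rewrite distrC [X in _ * X]distrC.
have [c _ e] := is_derive_mvt st (fun u _ => fd u).
by rewrite distrC e normrM distrC ler_wpM2r.
Qed.

Lemma sqr_lt_norm_le (x e : R) : 0 <= e -> x ^+ 2 < e ^+ 2 -> `|x| <= e.
Proof.
move=> e0 h; rewrite leNgt; apply/negP => ex.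
have : e ^+ 2 < `|x| ^+ 2 by rewrite ltr_pXn2r ?nnegrE.
by rewrite real_normK ?num_real// => h'; lra.
Qed.

Lemma sqr_sub_near (T : topologicalType) (f : T -> R) (t : T) (r : R) :
  {for t, continuous f} -> 0 < r -> \forall u \near t, (f u - f t) ^+ 2 < r.
Proof.
move=> cf r0; have m0 : 0 < Num.min 1 r by rewrite lt_min ltr01.
have /cvgrPdist_lt/(_ _ m0) := cf; apply: filterS => u; rewrite distrC lt_min => /andP[u1 ur].
rewrite -real_normK ?num_real//; apply: le_lt_trans ur.
by rewrite expr2 ler_piMr// ltW.
Qed.

Definition clamp (M x : R) : R := Num.max (- M) (Num.min M x).

Lemma clamp_id (M x : R) : `|x| <= M -> clamp M x = x.
Proof.
rewrite ler_norml /clamp => /andP[? ?].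
by case: (leP M x) => ?; case: (leP (- M)) => ?; lra.
Qed.

Lemma clamp_bound (M x : R) : 0 <= M -> `|clamp M x| <= M.
Proof.
by move=> M0; rewrite ler_norml /clamp le_max lexx ge_max ge_min lexx /= andbT; lra.
Qed.

Lemma clamp_lipschitz (M x y : R) : `|clamp M x - clamp M y| <= `|x - y|.
Proof.
wlog xy : x y / x <= y.
  by move=> H; have [/H//|/ltW/H] := leP x y; rewrite distrC [X in _ <= X]distrC.
rewrite [X in _ <= X]distrC [X in _ <= X]ger0_norm ?subr_ge0// ler_norml /clamp.
case: (leP M x) => ?; case: (leP M y) => ?;
 case: (leP (- M) M) => ?; rewrite ?(@ltNge _ _ (- M) x);
 case: (leP (- M) x) => ?; case: (leP (- M) y) => ?; apply/andP; split; lra.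
Qed.

Lemma clamp_continuous (M : R) : continuous (clamp M).
Proof.
by apply: (@lipschitz_continuous _ _ 1) => s t; rewrite mul1r clamp_lipschitz.
Qed.

Context (V : R -> R).
Hypothesis V_C2 : class_C 2 V.
Implicit Types (p q : phase V) (g : R -> phase V) (a b s t u : R).

Lemma ltr_itv_near a b t : a < t < b -> \near t, a < t < b.
Proof.
move=> /andP[? ?]; near=> v; apply/andP; split; near: v.
  exact: lt_nbhsr.
exact: lt_nbhsl.
Unshelve. all: by end_near. Qed.

(* Clamping all three variables turns the locally Lipschitz vector field into a
   bounded, globally Lipschitz one, with the same solutions inside the box. *)
Lemma clamped_flow (M : R) : 0 <= M -> exists M' : R, 0 <= M' /\
  forall a0 a1 a2 : R, exists x0 x1 x2 : R -> R,
  [/\ x0 0 = a0, x1 0 = a1 & x2 0 = a2] /\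
  forall t, [/\ `|x0 t - a0| <= M' * `|t|, `|x1 t - a1| <= M' * `|t|,
    `|x2 t - a2| <= M' * `|t| &
    `|x0 t| <= M -> `|x1 t| <= M -> `|x2 t| <= M ->
    [/\ is_derive t 1 x0 (x1 t),
       is_derive t 1 x1 (- x2 t * x1 t - derive1 V (x0 t)) &
       is_derive t 1 x2 (- (3 / 2) * x1 t ^+ 2)]].
Proof.
move=> M0.
have [B [B0 BP]] := dpotential_bounded V_C2 M.
have [L [L0 LP]] := dpotential_lipschitz V_C2 M.
pose i0 := @Ordinal 3 0 isT; pose i1 := @Ordinal 3 1 isT; pose i2 := @Ordinal 3 2 isT.
pose F (_ : R) (x : 'I_3 -> R) (i : 'I_3) : R :=
  match nat_of_ord i with
  | 0%N => clamp M (x i1)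
  | 1%N => - clamp M (x i2) * clamp M (x i1) - derive1 V (clamp M (x i0))
  | _ => - (3 / 2) * clamp M (x i1) ^+ 2
  end.
have MM : 0 <= M * M by rewrite mulr_ge0.
pose M' := M + 2 * (M * M) + B.
have M'0 : 0 <= M' by rewrite /M'; lra.
have F_bound (t : R) x i : `|F t x i| <= M'.
  have c1 := clamp_bound (x i1) M0; have c2 := clamp_bound (x i2) M0.
  have c0 := BP _ (clamp_bound (x i0) M0).
  rewrite /F; case: i => [[|[|[|//]]] ?] /=.
  - by rewrite /M'; lra.
  - apply: le_trans (ler_normB _ _) _; rewrite normrM normrN.
    have : `|clamp M (x i2)| * `|clamp M (x i1)| <= M * M by apply: ler_pM.
    by rewrite /M'; lra.
  rewrite normrM normrN normrX [`|3 / 2|]ger0_norm; last by lra.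
  have : `|clamp M (x i1)| ^+ 2 <= M * M by rewrite expr2; apply: ler_pM.
  by rewrite /M'; lra.
pose L' := 1 + L + 5 * M.
have L'0 : 0 < L' by rewrite /L'; lra.
have F_lip (t : R) (x y : 'I_3 -> R) (e : R) : (forall i, `|x i - y i| <= e) ->
    forall i, `|F t x i - F t y i| <= L' * e.
  move=> xy; have e0 : 0 <= e by apply: le_trans (xy i0).
  have Le : 0 <= L * e by rewrite mulr_ge0.
  have Me : 0 <= M * e by rewrite mulr_ge0.
  have h i : `|clamp M (x i) - clamp M (y i)| <= e.
    exact: le_trans (clamp_lipschitz _ _ _) (xy i).
  case=> [[|[|[|//]]] ?]; rewrite /F /=.
  - by apply: le_trans (h i1) _; rewrite /L'; lra.
  - have := LP _ _ (clamp_bound (x i0) M0) (clamp_bound (y i0) M0).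
    have : L * `|clamp M (x i0) - clamp M (y i0)| <= L * e by apply: ler_wpM2l.
    move: (h i1) (h i2) (clamp_bound (x i2) M0) (clamp_bound (y i1) M0).
    move: (clamp M (x i1)) (clamp M (y i1)) (clamp M (x i2)) (clamp M (y i2)).
    move=> a1 b1 a2 b2 h1 h2 H1 H2 H3 H4.
    have -> : - a2 * a1 - derive1 V (clamp M (x i0)) -
       (- b2 * b1 - derive1 V (clamp M (y i0))) = - (a2 * (a1 - b1)) - b1 * (a2 - b2)
       - (derive1 V (clamp M (x i0)) - derive1 V (clamp M (y i0))) by ring.
    apply: le_trans (ler_normB _ _) _.
    have : `|- (a2 * (a1 - b1)) - b1 * (a2 - b2)| <= M * e + M * e.
      apply: le_trans (ler_normB _ _) _; rewrite normrN !normrM.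
      by apply: lerD; apply: ler_pM.
    by rewrite /L'; lra.
  move: (h i1) (clamp_bound (x i1) M0) (clamp_bound (y i1) M0).
  move: (clamp M (x i1)) (clamp M (y i1)) => a1 b1 h1 H1 H2.
  have -> : - (3 / 2) * a1 ^+ 2 - - (3 / 2) * b1 ^+ 2 =
    - (3 / 2 * (a1 * (a1 - b1) + b1 * (a1 - b1))) by ring.
  rewrite normrN normrM [`|3 / 2|]ger0_norm; last by lra.
  have : `|a1 * (a1 - b1) + b1 * (a1 - b1)| <= M * e + M * e.
    apply: le_trans (ler_normD _ _) _; rewrite !normrM.
    by apply: lerD; apply: ler_pM.
  by rewrite /L'; lra.
have F_cont (x : R -> 'I_3 -> R) : (forall i, continuous (fun s => x s i)) ->
    forall i, continuous (fun t => F t (x t) i).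
  move=> cx; have cc i : continuous (fun s => clamp M (x s i)).
    by move=> s; apply: continuous_comp; [exact: cx|exact: clamp_continuous].
  have cV : continuous (fun s => derive1 V (clamp M (x s i0))).
    move=> s; apply: (@continuous_comp _ _ _ (fun s => clamp M (x s i0)) (derive1 V)).
      exact: cc.
    exact: is_derive_continuous (potential_derive2 V_C2 _).
  case=> [[|[|[|//]]] ?]; rewrite /F /=.
  - exact: cc.
  - move=> s; apply: (@continuousB _ _ _ (fun s => - clamp M (x s i2) * clamp M (x s i1))
      (fun s => derive1 V (clamp M (x s i0)))); last exact: cV.
    apply: (@continuousM _ _ (fun s => - clamp M (x s i2)) (fun s => clamp M (x s i1))).
      by apply: continuousN; exact: cc.
    exact: cc.
  move=> s; apply: (@continuousM _ _ (cst (- (3 / 2))) (fun s => clamp M (x s i1) ^+ 2)).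
    exact: cst_continuous.
  apply: (@continuousM _ _ (fun s => clamp M (x s i1)) (fun s => clamp M (x s i1)));
  exact: cc.
exists M'; split => // a0 a1 a2.
pose a (i : 'I_3) : R := match nat_of_ord i with
  | 0%N => a0 | 1%N => a1 | _ => a2 end.
have [x [x00 dx]] := @picard_lindelof R 3 F M' L' L'0 M'0 F_bound F_lip F_cont 0 a.
have xlip i (t : R) : `|x t i - a i| <= M' * `|t|.
  have := @is_derive_lipschitz (fun s => x s i) _ M' (fun u => dx u i)
    (fun u => F_bound u (x u) i) t 0.
  by rewrite subr0 x00.
exists (fun t => x t i0), (fun t => x t i1), (fun t => x t i2); rewrite x00.
split=> // t; split; [exact: xlip i0 t|exact: xlip i1 t|exact: xlip i2 t|].
move=> b0 b1 b2; split.
- by have := dx t i0; rewrite {1}/F/= clamp_id.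
- by have := dx t i1; rewrite {1}/F/= !clamp_id.
by have := dx t i2; rewrite {1}/F/= !clamp_id.
Qed.

(** [K^2 - 3 V - 3/2 phidot^2] is a first integral of the three equations. Hence a solution in [R^3]
    that starts in the phase space remains in it as long as [K > 0]. *)
Lemma constraint_preserved (x0 x1 x2 : R -> R) (a b s t : R) : a < s < b -> a < t < b ->
  (forall u, a < u < b -> [/\ is_derive u 1 x0 (x1 u),
     is_derive u 1 x1 (- x2 u * x1 u - derive1 V (x0 u)) &
     is_derive u 1 x2 (- (3 / 2) * x1 u ^+ 2)]) ->
  x2 s ^+ 2 = 3 * V (x0 s) + 3 / 2 * x1 s ^+ 2 ->
  x2 t ^+ 2 = 3 * V (x0 t) + 3 / 2 * x1 t ^+ 2.
Proof.
move=> sab tab H cs.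
pose E (u : R) := x2 u ^+ 2 - 3 * V (x0 u) - 3 / 2 * x1 u ^+ 2.
have dE (u : R) : a < u < b -> is_derive u 1 E 0.
  move=> /H[D1 D2 D3].
  have DV : is_derive u 1 (V \o x0) (derive1 V (x0 u) * x1 u).
    by apply: is_derive1_comp; exact: potential_derive.
  have -> : E = x2 ^+ 2 - 3 *: (V \o x0) - (3 / 2) *: x1 ^+ 2 by apply/funext => r.
  by apply: is_derive_eq; rewrite /GRing.scale/=; field.
suff : E t = E s by rewrite /E => {dE H} h; lra.
move: sab tab => /andP[as_ sb] /andP[at_ tb]; have [st|/ltW ts] := leP s t.
  apply/esym/(is_derive0_eq st) => u /andP[su ut].
  by apply: (dE u); rewrite (lt_le_trans as_ su) (le_lt_trans ut tb).
apply: (is_derive0_eq ts) => u /andP[tu us].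
by apply: (dE u); rewrite (lt_le_trans at_ tu) (le_lt_trans us sb).
Qed.

Lemma ler_dist3 (y y' z w e : R) : e <= 1 ->
  `|y - y'| <= e -> `|y' - z| <= e -> `|z| <= w -> `|y| <= w + 2.
Proof.
by move=> ?; rewrite !ler_norml => /andP[? ?] /andP[? ?] /andP[? ?]; apply/andP; split; lra.
Qed.

(** The existence time [d] and the box [M] are the same for all starting points near [p], so that
    Gronwall's inequality applies to all of them with one constant. *)
Lemma local_existence p : exists d r M : R, [/\ 0 < d, 0 < r &
  forall p', dist2 p' p < r -> exists g, [/\ is_solution (- d) d g, g 0 = p' &
    forall t, - d < t < d -> in_box M (g t)]].
Proof.
have [Kp _] := phase_constraint p.
(* The margin [2] allows for two displacements of size at most [1]: from [p] to the starting point
   [p'], and along the solution. *)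
have [M [Mphi Mphidot MK M0]] : exists M, [/\ `|phi_ p| + 2 <= M,
    `|phidot_ p| + 2 <= M, `|K_ p| + 2 <= M & 0 <= M].
  exists (`|phi_ p| + `|phidot_ p| + `|K_ p| + 2).
  have n1 := normr_ge0 (phi_ p); have n2 := normr_ge0 (phidot_ p).
  by have n3 := normr_ge0 (K_ p); split; lra.
have [M' [M'0 flow]] := clamped_flow M0.
(* With two displacements of at most [K_ p / 4] each, [K] remains positive. *)
have [e [e0 e1 e2]] : exists e, [/\ 0 < e, e <= 1 & e <= K_ p / 4].
  exists (Num.min 1 (K_ p / 4)); rewrite lt_min ltr01 divr_gt0//.
  by rewrite !ge_min !lexx orbT.
have M'1 : 0 < M' + 1 by rewrite ltr_wpDl.
have [d [d0 dM']] : exists d, 0 < d /\ M' * d <= e.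
  exists (e / (M' + 1)); rewrite divr_gt0//; split => //.
  rewrite mulrA ler_pdivrMr// mulrC; apply: ler_wpM2l; first exact: ltW.
  by rewrite lerDl.
exists d, (e ^+ 2), M; split => //; first exact: exprn_gt0.
move=> p' pp'.
have [q1 q2 q3] : [/\ `|phi_ p' - phi_ p| <= e, `|phidot_ p' - phidot_ p| <= e &
    `|K_ p' - K_ p| <= e].
  move: pp'; rewrite /dist2 => pp'; clear - pp' e0.
  have s1 := sqr_ge0 (phi_ p' - phi_ p); have s2 := sqr_ge0 (phidot_ p' - phidot_ p).
  have s3 := sqr_ge0 (K_ p' - K_ p).
  by split; (apply: sqr_lt_norm_le; [exact: ltW|]); move: s1 s2 s3 pp';
    move: (_ ^+ 2) (_ ^+ 2) (_ ^+ 2) (_ ^+ 2) => *; lra.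
have [K'p cp'] := phase_constraint p'.
have [x0 [x1 [x2 [[x00 x10 x20] xP]]]] := flow (phi_ p') (phidot_ p') (K_ p').
have box (t : R) : - d < t < d -> [/\ `|x0 t| <= M, `|x1 t| <= M, `|x2 t| <= M & 0 < x2 t].
  move=> td; have [h0 h1 h2 _] := xP t.
  have {}td : M' * `|t| <= e.
    apply: le_trans dM'; apply: ler_wpM2l => //; rewrite ler_norml.
    by move: td => /andP[/ltW -> /ltW ->].
  have {}h0 := le_trans h0 td; have {}h1 := le_trans h1 td; have {}h2 := le_trans h2 td.
  split.
  - exact: le_trans (ler_dist3 e1 h0 q1 (lexx _)) Mphi.
  - exact: le_trans (ler_dist3 e1 h1 q2 (lexx _)) Mphidot.
  - exact: le_trans (ler_dist3 e1 h2 q3 (lexx _)) MK.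
  clear - h2 q3 e2 Kp.
  by move: h2 q3; rewrite !ler_norml => /andP[? ?] /andP[? ?]; lra.
have dx (t : R) : - d < t < d -> [/\ is_derive t 1 x0 (x1 t),
     is_derive t 1 x1 (- x2 t * x1 t - derive1 V (x0 t)) &
     is_derive t 1 x2 (- (3 / 2) * x1 t ^+ 2)].
  by move=> td; have [b0 b1 b2 _] := box t td; have [_ _ _] := xP t; apply.
have d00 : - d < 0 < d by rewrite oppr_lt0 d0.
have constr (t : R) : - d < t < d -> x2 t ^+ 2 = 3 * V (x0 t) + 3 / 2 * x1 t ^+ 2.
  move=> td; apply: (constraint_preserved d00 td dx).
  by rewrite x00 x10 x20.
have /choice[g gP] : forall t : R, exists q, - d < t < d ->
    [/\ phi_ q = x0 t, phidot_ q = x1 t & K_ q = x2 t].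
  move=> t; have [td|ntd] := boolP (- d < t < d); last by exists p.
  have [_ _ _ k0] := box t td.
  by have [q qP] := phase_point k0 (constr t td); exists q.
exists g; split.
- move=> t td; have [g1 g2 g3] := gP t td; have [d1 d2 d3] := dx t td.
  have nt := ltr_itv_near td.
  split; rewrite ?g1 ?g2 ?g3.
  + by apply: is_derive_near_eq d1; apply: filterS nt => u /gP[+ _ _] /= => ->.
  + by apply: is_derive_near_eq d2; apply: filterS nt => u /gP[_ + _] /= => ->.
  + by apply: is_derive_near_eq d3; apply: filterS nt => u /gP[_ _ +] /= => ->.
- have [g1 g2 g3] := gP 0 d00.
  by apply: phase_ext; rewrite ?g1 ?g2 ?g3.
move=> t td; have [g1 g2 g3] := gP t td; have [b0 b1 b2 _] := box t td.
by split; rewrite ?g1 ?g2 ?g3.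
Qed.

(** Lipschitz dependence on the initial point, uniform in time. The absolute value of Gronwall's
    constant is used because its sign is unknown. *)
Lemma local_flow p : exists d r C : R, exists g0, [/\ 0 < d, 0 < r,
    is_solution (- d) d g0 /\ g0 0 = p &
  forall p', dist2 p' p < r -> exists g, [/\ is_solution (- d) d g, g 0 = p' &
    forall t, - d < t < d -> dist2 (g t) (g0 t) <= dist2 p' p * C]].
Proof.
have [d [r [M [d0 r0 H]]]] := local_existence p.
have [|g0 [s0 e0 b0]] := H p; first by rewrite /dist2 !subrr expr0n/= !addr0.
have [C CP] := @gronwall_solutions R V V_C2 M.
exists d, r, (expR (`|C| * d)), g0; split => // p' pp'.
have [g [sg eg bg]] := H p' pp'; exists g; split => // t /andP[td1 td2].
have ok (u : R) : - d < u < d -> [/\ solves_at g u, solves_at g0 u,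
    in_box M (g u) & in_box M (g0 u)].
  by move=> ud; split; [exact: sg|exact: s0|exact: bg|exact: b0].
have le (s : R) : 0 <= s -> s <= d -> dist2 p' p * expR (C * s) <= dist2 p' p * expR (`|C| * d).
  move=> s0' sd; apply: ler_wpM2l; first exact: dist2_ge0.
  by rewrite ler_expR; apply: (le_trans (ler_wpM2r s0' (ler_norm C))); apply: ler_wpM2l.
have [t0|/ltW t0] := leP 0 t.
  have [|+ _] := CP g g0 0 t t0.
    by move=> u /andP[? ?]; apply: ok; apply/andP; split; lra.
  by rewrite eg e0 subr0 => h; apply: le_trans h _; apply: le => //; exact: ltW.
have [|_] := CP g g0 t 0 t0.
  by move=> u /andP[? ?]; apply: ok; apply/andP; split; lra.
by rewrite eg e0 sub0r => h; apply: le_trans h _; apply: le => //; lra.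
Qed.

Lemma phi_continuous : continuous (@phi_ R V).
Proof.
move=> p; rewrite /phi_; apply: (@continuous_comp _ _ _ set_val (fun w : R * R * R => w.1.1)).
  exact: initial_continuous.
by apply: continuous_comp; [exact: cvg_fst|exact: cvg_fst].
Qed.

Lemma phidot_continuous : continuous (@phidot_ R V).
Proof.
move=> p; rewrite /phidot_; apply: (@continuous_comp _ _ _ set_val (fun w : R * R * R => w.1.2)).
  exact: initial_continuous.
by apply: continuous_comp; [exact: cvg_fst|exact: cvg_snd].
Qed.

Lemma K_continuous : continuous (@K_ R V).
Proof.
move=> p; rewrite /K_; apply: (@continuous_comp _ _ _ set_val (fun w : R * R * R => w.2)).
  exact: initial_continuous.
exact: cvg_snd.
Qed.

(** Reduces the topology of the phase space to the quantity that Gronwall's inequality controls. *)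
Lemma nbhs_phaseP p (U : set (phase V)) :
  nbhs p U <-> exists2 r, 0 < r & forall q, dist2 q p < r -> U q.
Proof.
split.
  move=> [_ [[W oW <-] Wp sU]].
  have : nbhs (set_val p) W by exact: open_nbhs_nbhs.
  move=> /nbhs_ballP[e /= e0 eW]; exists (e ^+ 2); first exact: exprn_gt0.
  move=> q qp; apply: sU; apply: eW; move: qp; rewrite /dist2 /phi_ /phidot_ /K_.
  move: (set_val q) (set_val p) => [[x1 x2] x3] [[y1 y2] y3] /= h.
  have s1 := sqr_ge0 (x1 - y1); have s2 := sqr_ge0 (x2 - y2); have s3 := sqr_ge0 (x3 - y3).
  have lt (x y : R) : (x - y) ^+ 2 < e ^+ 2 -> `|y - x| < e.
    by rewrite -[(x - y) ^+ 2](real_normK (num_real _)) ltr_pXn2r ?nnegrE// ?ltW// distrC.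
  by split; [split|]; apply: lt => /=; lra.
move=> [r r0 rU]; have r30 : 0 < r / 3 by lra.
have h1 := sqr_sub_near (@phi_continuous p) r30; have h2 := sqr_sub_near (@phidot_continuous p) r30.
have h3 := sqr_sub_near (@K_continuous p) r30.
by apply: filterS3 h1 h2 h3 => q ? ? ?; apply: rU; rewrite /dist2; lra.
Qed.

Lemma solution_continuous g t : solves_at g t -> {for t, continuous g}.
Proof.
move=> [d1 d2 d3] U /nbhs_phaseP[r r0 rU].
have r30 : 0 < r / 3 by lra.
have h1 := sqr_sub_near (is_derive_continuous d1) r30; have h2 := sqr_sub_near (is_derive_continuous d2) r30.
have h3 := sqr_sub_near (is_derive_continuous d3) r30.
apply: filterS3 h1 h2 h3 => u /= h1 h2 h3; apply: rU; rewrite /dist2; lra.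
Qed.

(* The indicator function of [P] has derivative [0]. *)
Lemma locally_constant_prop (P : R -> Prop) a b : a <= b ->
  (forall u, a <= u <= b -> \forall v \near u, P v <-> P u) -> P a <-> P b.
Proof.
move=> ab H; pose f u : R := if pselect (P u) then 1 else 0.
have fP u v : f u = f v <-> (P u <-> P v).
  rewrite /f; case: pselect => pu; case: pselect => pv; split => //=; try tauto.
  - by move=> /eqP; rewrite oner_eq0.
  - by move=> /eqP; rewrite eq_sym oner_eq0.
apply/fP/is_derive0_eq => // u uab.
have c : is_derive u 1 (cst (f u) : R -> R) 0 by exact: is_derive_cst.
apply: is_derive_near_eq c.
by apply: filterS (H u uab) => v uv; apply/esym/fP.
Qed.

(** Being interior to [S] is a locally constant property of the time. It persists because interiors
    are open. Conversely, if [g v] is interior for some [v] close to [u], the flow during time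
    [v - u] takes points near [g u] to points near [g v], hence into [S], and saturation brings them
    back. *)
Lemma interior_saturated (S : set (phase V)) a b g s t :
  (forall p q, orbit_of p = orbit_of q -> S p -> S q) ->
  is_solution a b g -> a < s < b -> a < t < b -> S^° (g s) -> S^° (g t).
Proof.
move=> Ssat sg.
have loc u : a < u < b -> \forall v \near u, S^° (g v) <-> S^° (g u).
  move=> uab; have [d [r [C [g0 [d0 r0 [sg0 g00] H]]]]] := local_flow (g u).
  have [Su|nSu] := pselect (S^° (g u)).
    have : \forall v \near u, S^° (g v).
      by apply: (solution_continuous (sg u uab)); apply: open_nbhs_nbhs; split => //; exact: open_interior.
    by apply: filterS => v Sv; split.
  have du : - d < 0 < d by apply/andP; split; lra.
  have nd : \forall v \near u, u - d < v < u + d by apply: ltr_itv_near; apply/andP; split; lra.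
  near=> v; split => // Sv; exfalso; apply: nSu.
  have vab : a < v < b by near: v; exact: ltr_itv_near.
  have vd : u - d < v < u + d by near: v.
  have gv : g0 (v - u) = g v.
    move: (uab) (vab) (vd) => /andP[? ?] /andP[? ?] /andP[? ?].
    have e : (fun w => g (w + u)) (v - u) = g v by rewrite subrK.
    rewrite -e; apply: (@solution_unique _ _ V_C2 g0 (fun w => g (w + u)) (Num.max (- d) (a - u)) (Num.min d (b - u)) 0).
    - by move=> w; rewrite gt_max lt_min => /andP[/andP[? ?] /andP[? ?]]; apply: sg0; apply/andP.
    - move=> w; rewrite gt_max lt_min => /andP[/andP[? ?] /andP[? ?]].
      by apply: solves_at_shift; apply: sg; apply/andP; split; lra.
    - by rewrite gt_max lt_min; apply/andP; split; apply/andP; split; lra.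
    - by rewrite gt_max lt_min; apply/andP; split; apply/andP; split; lra.
    by rewrite g00 add0r.
  have vd' : - d < v - u < d by move: (vd) => /andP[? ?]; apply/andP; split; lra.
  have [e e0 eS] := (nbhs_phaseP _ _).1 Sv.
  (* Within [r] the local flow exists; the second bound keeps the transported point within [e] of
     [g v]. *)
  apply/nbhs_phaseP; exists (Num.min r (e / (`|C| + 1))).
    by rewrite lt_min r0 divr_gt0// ltr_wpDl.
  move=> q; rewrite lt_min => /andP[qr qe].
  have [h [sh h0 hd]] := H q qr.
  apply: (Ssat (h (v - u))); first by rewrite -h0; exact: solution_orbit sh vd' du.
  apply: eS; rewrite -gv; apply: le_lt_trans (hd _ vd') _.
  move: qe; rewrite ltr_pdivlMr ?ltr_wpDl//; apply: le_lt_trans.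
  by apply: ler_wpM2l; [exact: dist2_ge0|rewrite (le_trans (ler_norm _))// lerDl].
move=> sab tab; move: (sab) (tab) => /andP[? ?] /andP[? ?].
have [st|/ltW ts] := leP s t.
  apply: (@locally_constant_prop (fun u => S^° (g u)) s t st _).1.
  by move=> u /andP[? ?]; apply: loc; apply/andP; split; lra.
apply: (@locally_constant_prop (fun u => S^° (g u)) t s ts _).2.
by move=> u /andP[? ?]; apply: loc; apply/andP; split; lra.
Unshelve. all: by end_near. Qed.

End LocalFlow.

(** * The scalar equation for [w] as a function of [phi] *)

Section Decay.
Context {R : realType} (m dm : R -> R) (a d : R).
Hypotheses (d0 : 0 < d) (m0 : forall s, a <= s -> 0 <= m s).
Hypothesis m_derive : forall s : R, a <= s -> is_derive s 1 m (dm s).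
Hypothesis m_decay : forall s, a <= s -> dm s <= - d * m s.

Lemma decay_nonincreasing s t : a <= s -> s <= t -> m t <= m s.
Proof.
move=> as_ st; apply: (is_derive_le0_ge st) => u /andP[su _].
  by apply: m_derive; exact: le_trans su.
have au := le_trans as_ su; apply: le_trans (m_decay au) _.
by rewrite mulNr oppr_le0 mulr_ge0// ?m0// ltW.
Qed.

(** [m s * expR (d * (s - a))] is nonincreasing, and the exponential is at least [1 + d * (s - a)];
    solving the resulting inequality for [s] gives the threshold. *)
Lemma decay_vanishes e : 0 < e -> exists2 t, a <= t & forall s, t <= s -> m s <= e.
Proof.
move=> e0; have ma := m0 (lexx a).
have me0 : 0 <= m a / (e * d) by rewrite divr_ge0// mulr_ge0// ltW.
exists (a + m a / (e * d)); first by rewrite lerDl.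
move=> s ts; have as_ : a <= s by apply: le_trans ts; rewrite lerDl.
have h : m s * expR (d * (s - a)) <= m a.
  have dE (u : R) : a <= u <= s -> is_derive u 1 (fun t => m t * expR (d * (t - a)))
      ((dm u + d * m u) * expR (d * (u - a))).
    move=> /andP[au _]; have hu := m_derive au.
    have e1 : is_derive u 1 (fun t => expR (d * (t - a))) (expR (d * (u - a)) * d).
      apply: is_derive1_comp.
      by apply: is_derive_eq; rewrite subr0 /GRing.scale/= mulr1.
    by apply: is_derive_eq; rewrite /GRing.scale/=; ring.
  have := @is_derive_le0_ge _ _ _ a s as_ dE.
  rewrite /= subrr mulr0 expR0 mulr1; apply => u /andP[au _].
  apply: mulr_le0_ge0; last exact: expR_ge0.
  by have := m_decay au; lra.
rewrite leNgt; apply/negP => ems; move: h; apply/negP; rewrite -ltNge.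
have ex : 1 + d * (s - a) <= expR (d * (s - a)) := expR_ge1Dx _.
have ds : m a / e <= d * (s - a).
  have -> : m a / e = d * (m a / (e * d)) by field; rewrite !gt_eqF.
  by apply: ler_wpM2l; [exact: ltW|lra].
have ds1 : m a <= e * (d * (s - a)) by rewrite mulrC -ler_pdivrMr.
apply: (@lt_le_trans _ _ (e * (1 + d * (s - a)))); first by rewrite mulrDr mulr1; lra.
have ds0 : 0 <= d * (s - a) by rewrite mulr_ge0 ?subr_ge0// ltW.
by apply: ler_pM => //; [exact: ltW|exact: addr_ge0|exact: ltW].
Qed.

(* [h + C/d m] is nonincreasing and [h - C/d m] nondecreasing *)
Lemma tail_limit (h dh : R -> R) (C : R) :
  (forall s : R, a <= s -> is_derive s 1 h (dh s)) ->
  (forall s, a <= s -> `|dh s| <= C * m s) -> 0 <= C ->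
  exists l, forall s, a <= s -> `|h s - l| <= C / d * m s.
Proof.
move=> hd hC C0.
have dE (k u : R) : a <= u -> is_derive u 1 (fun t => h t + k * m t) (dh u + k * dm u).
  by move=> au; have := hd u au; have := m_derive au => ? ?; apply: is_derive_eq.
have Cd0 : 0 <= C / d by rewrite divr_ge0// ltW.
have bd u : a <= u -> C / d * dm u <= - (C * m u).
  move=> au; have -> : - (C * m u) = C / d * (- d * m u) by field; rewrite gt_eqF.
  by apply: ler_wpM2l => //; exact: m_decay.
have up s t : a <= s -> s <= t -> h t + C / d * m t <= h s + C / d * m s.
  move=> as_ st; apply: (is_derive_le0_ge st (fun u su => dE (C / d) u _)).
    by move=> u /andP[su _]; exact: le_trans su.
  move=> u /andP[su _]; have au := le_trans as_ su.
  by have := hC u au; have := bd u au; rewrite ler_norml => ? /andP[? ?]; lra.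
have lo s t : a <= s -> s <= t -> h s + - (C / d) * m s <= h t + - (C / d) * m t.
  move=> as_ st; apply: (is_derive_ge0_le st (fun u su => dE (- (C / d)) u _)).
    by move=> u /andP[su _]; exact: le_trans su.
  move=> u /andP[su _]; have au := le_trans as_ su.
  by have := hC u au; have := bd u au; rewrite ler_norml mulNr => ? /andP[? ?]; lra.
have [|l lP] := @nested_between R R [set s | a <= s]
    (fun s => h s + - (C / d) * m s) (fun s => h s + C / d * m s).
  move=> s t /= as_ at_.
  have Mst : s <= Num.max s t /\ t <= Num.max s t by rewrite !le_max !lexx orbT.
  apply: le_trans (lo _ _ as_ Mst.1) _; apply: le_trans _ (up _ _ at_ Mst.2).
  rewrite lerD2l mulNr; have aM := le_trans as_ Mst.1.
  by have := mulr_ge0 Cd0 (m0 aM); lra.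
exists l => s as_; have := lP s as_; rewrite mulNr => /andP[? ?].
by rewrite ler_norml; apply/andP; split; lra.
Qed.

End Decay.

Section ScalarEquation.
Context {R : realType} (V : R -> R) (kappa delta theta Phi : R).
Hypotheses (kappa0 : 0 < kappa) (delta0 : 0 < delta).
Hypotheses (theta0 : 0 < theta) (theta1 : theta < 1).
Hypothesis V_derive : forall x : R, is_derive x 1 V (derive1 V x).
Hypothesis V_pos : forall x, Phi <= x -> 0 < V x.
Hypothesis V_growth : forall x, Phi <= x ->
  derive1 V x <= (2 * kappa * theta - delta) * V x.

(* With K = expR (w + kappa * x), this is 3 V / K^2 = 1 - y^2. *)
Definition rho (x w : R) : R := 3 * V x * expR (- 2 * (w + kappa * x)).

(* [- y], truncated from below at [theta] and frozen for [x < Phi], so that the scalar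
   equation is globally Lipschitz; the truncation is inactive where [Phi <= x] and
   [rho <= 1 - theta^2]. *)
Definition speed (x w : R) : R :=
  Num.sqrt (Num.max (theta ^+ 2) (1 - rho (Num.max x Phi) w)).

Lemma rho_gt0 x w : Phi <= x -> 0 < rho x w.
Proof. by move=> h; rewrite /rho !mulr_gt0 ?expR_gt0 ?V_pos. Qed.

Lemma rho_shift x w w' : rho x w' = rho x w * expR (- 2 * (w' - w)).
Proof. by rewrite /rho -[RHS]mulrA -expRD; congr (_ * expR _); ring. Qed.

Lemma rhoE x w : rho x w = 3 * V x * expR (- (w + kappa * x)) ^+ 2.
Proof. by rewrite /rho expr2 -expRD; congr (_ * expR _); ring. Qed.

Lemma Phi_le_max x : Phi <= Num.max x Phi.
Proof. by rewrite le_max lexx orbT. Qed.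

Lemma theta2_lt1 : theta ^+ 2 < 1.
Proof. by rewrite expr_lt1 ?ltW. Qed.

Lemma speed_sqr x w : speed x w ^+ 2 = Num.max (theta ^+ 2) (1 - rho (Num.max x Phi) w).
Proof. by rewrite /speed sqr_sqrtr// le_max sqr_ge0. Qed.

Lemma speed_ge x w : theta <= speed x w.
Proof.
have h : theta = Num.sqrt (theta ^+ 2) by rewrite sqrtr_sqr gtr0_norm.
rewrite /speed {1}h; apply: ler_wsqrtr.
by rewrite le_max lexx.
Qed.

Lemma speed_le1 x w : speed x w <= 1.
Proof.
rewrite -[X in _ <= X]sqrtr1; apply: ler_wsqrtr; rewrite ge_max.
rewrite (ltW theta2_lt1)/= gerBl ltW//; exact/rho_gt0/Phi_le_max.
Qed.

(** For a speed in []0, 1]] one has [1 - speed <= 1 - speed^2]. The right-hand side of the scalar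
    equation is thus of order [rho] and integrable up to infinity. *)
Lemma speed_defect x w : 1 - speed x w <= rho (Num.max x Phi) w.
Proof.
have h : 1 - rho (Num.max x Phi) w <= speed x w ^+ 2 by rewrite speed_sqr le_max lexx orbT.
have := speed_ge x w; have := speed_le1 x w => h1 h2.
have : speed x w ^+ 2 <= speed x w by rewrite expr2 ler_piMr// (le_trans (ltW theta0) h2).
lra.
Qed.

Lemma speed_sqrE x w : Phi <= x -> rho x w <= 1 - theta ^+ 2 ->
  speed x w ^+ 2 = 1 - rho x w.
Proof.
by move=> h1 h2; rewrite speed_sqr (max_idPl h1); apply/max_idPr; lra.
Qed.

(** [rho] decreases in [w]. The squares of the speeds are compared by [expR u >= 1 + u] and the
    result divided by the sum of the speeds, which is at least [2 * theta]. The bound with [rho]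
    limits the total growth of distances up to infinity; the one without it is the global Lipschitz
    condition for Picard's theorem. *)
Lemma speed_mono x w w' : w <= w' -> 0 <= speed x w' - speed x w /\
  speed x w' - speed x w <= (w' - w) * rho (Num.max x Phi) w / theta /\
  speed x w' - speed x w <= (w' - w) / theta.
Proof.
move=> ww'; set D := w' - w; have D0 : 0 <= D by rewrite /D subr_ge0.
set r := rho (Num.max x Phi) w; have r0 : 0 < r by exact/rho_gt0/Phi_le_max.
set r' := rho (Num.max x Phi) w'.
have rr : r' = r * expR (- 2 * D) by exact: rho_shift.
have r'1 : r' <= r.
  rewrite rr; apply: ler_piMr; first exact: ltW.
  by rewrite -[X in _ <= X]expR0 ler_expR mulNr oppr_le0 mulr_ge0.
have r'2 : r - 2 * D * r <= r'.
  have -> : r - 2 * D * r = r * (1 + - 2 * D) by ring.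
  by rewrite rr; apply: ler_wpM2l; [exact: ltW|exact: expR_ge1Dx].
have r'0 : 0 < r' by exact/rho_gt0/Phi_le_max.
have sq := speed_sqr x w; have sq' := speed_sqr x w'.
have h1 := speed_ge x w; have h2 := speed_ge x w'.
have t2 := theta2_lt1; have t20 := sqr_ge0 theta.
have [q0 [q1 q2]] : 0 <= speed x w' ^+ 2 - speed x w ^+ 2 /\
   speed x w' ^+ 2 - speed x w ^+ 2 <= 2 * D * r /\
   speed x w' ^+ 2 - speed x w ^+ 2 <= 2 * D.
  rewrite sq sq' -/r -/r'; move: (theta ^+ 2) t2 t20 => c t2 t20.
  have Dr : 0 <= D * r by rewrite mulr_ge0// ltW.
  have D1 : r <= 1 -> D * r <= D by move=> ?; rewrite ler_piMr.
  case: (leP c (1 - r')) => ?; case: (leP c (1 - r)) => ?; (split; [|split]); try lra.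
  (* The case left over is the last bound with the truncation active at [w] but not at [w']. *)
  have [Dh|Dh] := leP 1 (2 * D); first lra.
  have : (1 - c) * (1 - 2 * D) <= r * (1 - 2 * D) by apply: ler_wpM2r; lra.
  have : c * D >= 0 by rewrite mulr_ge0.
  by lra.
have fac : speed x w' ^+ 2 - speed x w ^+ 2 =
  (speed x w' - speed x w) * (speed x w' + speed x w) by ring.
have sp : 2 * theta <= speed x w' + speed x w by lra.
have t0 := theta0.
have s0 : 0 <= speed x w' - speed x w.
  by move: q0; rewrite fac pmulr_lge0//; lra.
have up : (speed x w' - speed x w) * (2 * theta) <= speed x w' ^+ 2 - speed x w ^+ 2.
  by rewrite fac; apply: ler_wpM2l.
by split => //; split; rewrite ler_pdivlMr//; lra.
Qed.

Definition scalar_solution (x : R -> R) :=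
  forall s : R, is_derive s 1 x (kappa * (speed s (x s) - 1)).

Lemma scalar_solution_continuous x : scalar_solution x -> continuous x.
Proof. by move=> sx s; exact: is_derive_continuous (sx s). Qed.

Lemma V_continuous : continuous V.
Proof. by move=> s; exact: is_derive_continuous (V_derive s). Qed.

Lemma max_continuous (c : R) : continuous (fun s : R => Num.max s c).
Proof.
apply: (@lipschitz_continuous _ _ 1) => s t; rewrite mul1r.
wlog st : s t / s <= t.
  by move=> H; have [/H//|/ltW/H] := leP s t; rewrite distrC [X in _ <= X]distrC.
rewrite [X in _ <= X]distrC [X in _ <= X]ger0_norm ?subr_ge0// ler_norml.
by case: (leP s c) => ?; case: (leP t c) => ?; apply/andP; split; lra.
Qed.

Lemma rho_continuous_comp (T : topologicalType) (f w : T -> R) (t : T) :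
  {for t, continuous f} -> {for t, continuous w} ->
  {for t, continuous (fun u => rho (f u) (w u))}.
Proof.
move=> cf cw; rewrite /rho.
apply: (@continuousM _ _ (fun u => 3 * V (f u)) (fun u => expR (- 2 * (w u + kappa * f u)))).
  apply: (@continuousM _ _ (cst 3) (V \o f)); first exact: cst_continuous.
  by apply: continuous_comp => //; exact: V_continuous.
apply: (@continuous_comp _ _ _ (fun u => - 2 * (w u + kappa * f u)) expR); last exact: continuous_expR.
apply: (@continuousM _ _ (cst (- 2)) (fun u => w u + kappa * f u)); first exact: cst_continuous.
apply: (@continuousD _ _ _ w (fun u => kappa * f u)) => //.
by apply: (@continuousM _ _ (cst kappa) f) => //; exact: cst_continuous.
Qed.

Lemma speed_continuous_comp (x : R -> R) : continuous x ->
  continuous (fun s => speed s (x s)).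
Proof.
move=> cx s.
apply: (@continuous_comp _ _ _ (fun s => Num.max (theta ^+ 2) (1 - rho (Num.max s Phi) (x s))) Num.sqrt);
  last exact: sqrt_continuous.
have -> : (fun s => Num.max (theta ^+ 2) (1 - rho (Num.max s Phi) (x s))) =
  (fun s => Num.max s (theta ^+ 2)) \o (fun s => 1 - rho (Num.max s Phi) (x s)).
  by apply/funext => u /=; rewrite maxC.
apply: continuous_comp; last exact: max_continuous.
apply: (@continuousB _ _ _ (cst (1 : R)) (fun s => rho (Num.max s Phi) (x s))).
  exact: cst_continuous.
by apply: rho_continuous_comp; [exact: max_continuous|exact: cx].
Qed.

Lemma scalar_solution_exists s0 w0 : exists x, scalar_solution x /\ x s0 = w0.
Proof.
pose F (s : R) (x : 'I_1 -> R) (i : 'I_1) := kappa * (speed s (x ord0) - 1).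
have F_bound (t : R) x i : `|F t x i| <= kappa.
  rewrite /F normrM gtr0_norm//; apply: ler_piMr; first exact: ltW.
  by have := speed_ge t (x ord0); have := speed_le1 t (x ord0); have := theta0 => ? ? ?; rewrite ler_norml; apply/andP; split; lra.
have L0 : 0 < kappa / theta by rewrite divr_gt0.
have F_lip (t : R) (x y : 'I_1 -> R) (e : R) : (forall i, `|x i - y i| <= e) ->
    forall i, `|F t x i - F t y i| <= kappa / theta * e.
  move=> xy i; rewrite /F; have {}xy := xy ord0; move: xy.
  move: (x ord0) (y ord0) => u v; wlog uv : u v / u <= v.
    by move=> H; have [/H//|/ltW/H] := leP u v; rewrite distrC [X in _ -> X <= _]distrC.
  rewrite distrC ger0_norm ?subr_ge0// => uve.
  have [h0 [_ h1]] := speed_mono t uv.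
  have -> : kappa * (speed t u - 1) - kappa * (speed t v - 1) =
    - (kappa * (speed t v - speed t u)) by ring.
  rewrite normrN ger0_norm; last by rewrite mulr_ge0// ltW.
  rewrite -mulrA; apply: ler_wpM2l; first exact: ltW.
  apply: le_trans h1 _; rewrite mulrC; apply: ler_wpM2l => //.
  by rewrite invr_ge0 ltW.
have F_cont (x : R -> 'I_1 -> R) : (forall i, continuous (fun s => x s i)) ->
    forall i, continuous (fun t => F t (x t) i).
  move=> cx i s; apply: (@continuousM _ _ (cst kappa) (fun s => speed s (x s ord0) - 1)).
    exact: cst_continuous.
  apply: (@continuousB _ _ _ (fun s => speed s (x s ord0)) (cst 1)); last exact: cst_continuous.
  exact: (@speed_continuous_comp (fun s => x s ord0)).
have [x [x0 dx]] := @picard_lindelof R 1 F kappa _ L0 (ltW kappa0) F_bound F_lip F_cont s0 (fun _ => w0).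
exists (fun s => x s ord0); split; last by rewrite x0.
by move=> s; exact: dx s ord0.
Qed.

(** The slope [d] is left free, to cover solutions of the scalar equation as well as constant
    [w]. *)
Lemma rho_derive (x : R -> R) (s d : R) : is_derive s 1 x d ->
  is_derive s 1 (fun s => rho s (x s))
    (3 * derive1 V s * expR (- 2 * (x s + kappa * s)) - 2 * (d + kappa) * rho s (x s)).
Proof.
move=> dx; have dV := V_derive s.
have e1 : is_derive s 1 (fun s => expR (- 2 * (x s + kappa * s)))
    (expR (- 2 * (x s + kappa * s)) * (- 2 * (d + kappa))).
  apply: is_derive1_comp.
  by apply: is_derive_eq; rewrite /GRing.scale/=; ring.
rewrite /rho; apply: is_derive_eq; rewrite /GRing.scale/=; ring.
Qed.

(** [V] grows at a rate of at most [2 * kappa * theta - delta], while the exponential factor of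
    [rho] decays at the rate [2 * (d + kappa) >= 2 * kappa * theta]. *)
Lemma rho_decay_rate s d w : Phi <= s -> kappa * (theta - 1) <= d ->
  3 * derive1 V s * expR (- 2 * (w + kappa * s)) - 2 * (d + kappa) * rho s w
  <= - delta * rho s w.
Proof.
move=> Ps hd; have r0 := rho_gt0 w Ps; have E0 := expR_gt0 (- 2 * (w + kappa * s)).
have h1 : 3 * derive1 V s * expR (- 2 * (w + kappa * s)) <=
    (2 * kappa * theta - delta) * rho s w.
  have -> : (2 * kappa * theta - delta) * rho s w =
    3 * ((2 * kappa * theta - delta) * V s) * expR (- 2 * (w + kappa * s)).
    by rewrite /rho; ring.
  apply: ler_wpM2r; first exact: ltW.
  by apply: ler_wpM2l => //; exact: V_growth.
have h2 : kappa * theta * rho s w <= (d + kappa) * rho s w.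
  by apply: ler_wpM2r; [exact: ltW|lra].
by lra.
Qed.

Definition drho (x : R -> R) s := 3 * derive1 V s * expR (- 2 * (x s + kappa * s))
  - 2 * (kappa * (speed s (x s) - 1) + kappa) * rho s (x s).

Lemma scalar_solution_rho x (s : R) : scalar_solution x ->
  is_derive s 1 (fun s => rho s (x s)) (drho x s).
Proof. by move=> sx; exact: rho_derive (sx s). Qed.

Lemma drho_decay x s : Phi <= s -> drho x s <= - delta * rho s (x s).
Proof.
move=> Ps; apply: rho_decay_rate => //; apply: ler_wpM2l; first exact: ltW.
by rewrite lerD2r speed_ge.
Qed.

(** Convergence to [l] stated with its rate; the bound tends to zero by [rho_vanishes]. *)
Definition has_limit (x : R -> R) l :=
  forall s, Phi <= s -> `|x s - l| <= kappa / delta * rho s (x s).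

Lemma scalar_solution_limit x : scalar_solution x -> exists l, has_limit x l.
Proof.
move=> sx.
apply: (@tail_limit _ (fun s => rho s (x s)) (drho x) Phi delta delta0 _ _ _ x
  (fun s => kappa * (speed s (x s) - 1)) kappa).
- by move=> s Ps; apply/ltW/rho_gt0.
- by move=> s _; exact: scalar_solution_rho.
- by move=> s; exact: drho_decay.
- by move=> s _; exact: sx.
- move=> s Ps; rewrite normrM gtr0_norm//; apply: ler_wpM2l; first exact: ltW.
  have := speed_le1 s (x s); have := speed_defect s (x s).
  by rewrite (max_idPl Ps) => ? ?; rewrite ler_norml; apply/andP; split; have := rho_gt0 (x s) Ps; lra.
exact: ltW.
Qed.

Lemma rho_nonincreasing x s t : scalar_solution x -> Phi <= s -> s <= t ->
  rho t (x t) <= rho s (x s).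
Proof.
move=> sx; apply: (@decay_nonincreasing _ (fun s => rho s (x s)) (drho x) Phi delta delta0).
- by move=> u Pu; apply/ltW/rho_gt0.
- by move=> u _; exact: scalar_solution_rho.
- by move=> u; exact: drho_decay.
Qed.

Lemma rho_vanishes x e : scalar_solution x -> 0 < e ->
  exists2 t, Phi <= t & forall s, t <= s -> rho s (x s) <= e.
Proof.
move=> sx; apply: (@decay_vanishes _ (fun s => rho s (x s)) (drho x) Phi delta delta0).
- by move=> u Pu; apply/ltW/rho_gt0.
- by move=> u _; exact: scalar_solution_rho.
- by move=> u; exact: drho_decay.
Qed.

(** Gives a threshold in [phi] that depends on no particular solution. It serves for a whole range
    of initial values in [lim_surjective], and for the massless solution in [eps_V_vanishes]. *)
Lemma rho_cst_vanishes w e : 0 < e ->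
  exists2 t, Phi <= t & forall s, t <= s -> rho s w <= e.
Proof.
apply: (@decay_vanishes _ (fun s => rho s w) (fun s => 3 * derive1 V s *
  expR (- 2 * (w + kappa * s)) - 2 * (0 + kappa) * rho s w) Phi delta delta0).
- by move=> u Pu; apply/ltW/rho_gt0.
- by move=> u _; apply: (@rho_derive (cst w)).
- move=> u Pu; apply: rho_decay_rate => //.
  by rewrite mulr_ge0_le0 ?ltW// subr_lt0.
Qed.

(* [(x - y)^2] is nondecreasing and [(x - y)^2 exp (A (rho_x + rho_y))], with
   [A = 2 kappa / (theta delta)], is nonincreasing. *)
Lemma scalar_solution_compare x y l m s : scalar_solution x -> scalar_solution y ->
  has_limit x l -> has_limit y m -> Phi <= s ->
  `|x s - y s| <= `|l - m| /\
  `|l - m| <= `|x s - y s| * expR (kappa / (theta * delta) * (rho s (x s) + rho s (y s))).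
Proof.
move=> sx sy lx ly Ps.
pose r u := rho u (x u) + rho u (y u).
have r0 u : Phi <= u -> 0 < r u by move=> Pu; rewrite addr_gt0// rho_gt0.
pose D u := (x u - y u) ^+ 2.
pose dD u := 2 * kappa * ((x u - y u) * (speed u (x u) - speed u (y u))).
have D_derive (u : R) : is_derive u 1 D (dD u).
  have := sx u; have := sy u => dy dx.
  have -> : D = (x - y) ^+ 2 by apply/funext.
  by apply: is_derive_eq; rewrite /GRing.scale/= !fctE /dD; ring.
have dD_bound u : Phi <= u -> 0 <= dD u /\ dD u <= 2 * kappa / theta * (r u * D u).
  move=> Pu.
  (* Stated for ordered values only; the other order follows by exchanging the two solutions. *)
  have H a b : Phi <= u -> a <= b -> 0 <= (a - b) * (speed u a - speed u b) /\
      (a - b) * (speed u a - speed u b) <= (rho u a + rho u b) * (a - b) ^+ 2 / theta.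
    move=> _ ab; have [h0 [h1 _]] := speed_mono u ab.
    rewrite (max_idPl Pu) in h1.
    have -> : (a - b) * (speed u a - speed u b) = (b - a) * (speed u b - speed u a) by ring.
    have ba : 0 <= b - a by rewrite subr_ge0.
    split; first exact: mulr_ge0.
    apply: (le_trans (ler_wpM2l ba h1)).
    have -> : (b - a) * ((b - a) * rho u a / theta) = rho u a * (a - b) ^+ 2 / theta by ring.
    apply: ler_wpM2r; first by rewrite invr_ge0 ltW.
    by apply: ler_wpM2r; rewrite ?sqr_ge0// lerDl ltW// rho_gt0.
  have {H}[h0 h1] : 0 <= (x u - y u) * (speed u (x u) - speed u (y u)) /\
      (x u - y u) * (speed u (x u) - speed u (y u)) <= r u * D u / theta.
    have [xy|/ltW yx] := leP (x u) (y u); first exact: H.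
    have [h0 h1] := H _ _ Pu yx.
    have -> : (x u - y u) * (speed u (x u) - speed u (y u)) =
      (y u - x u) * (speed u (y u) - speed u (x u)) by ring.
    split => //; apply: le_trans h1 _; rewrite /r /D addrC.
    have -> // : (y u - x u) ^+ 2 = (x u - y u) ^+ 2 by ring.
  have k20 : 0 <= 2 * kappa by rewrite mulr_ge0// ltW.
  split; first by rewrite mulr_ge0.
  have -> : 2 * kappa / theta * (r u * D u) = 2 * kappa * (r u * D u / theta) by ring.
  exact: ler_wpM2l.
have grow t : s <= t -> D s <= D t.
  move=> st; apply: (is_derive_ge0_le st (fun u _ => D_derive u)) => u /andP[su _].
  by have [] := dD_bound u (le_trans Ps su).
pose A := 2 * kappa / (theta * delta).
have A0 : 0 <= A by rewrite divr_ge0 ?mulr_ge0 ?ltW.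
have bound t : s <= t -> D t <= D s * expR (A * r s).
  move=> st.
  have dE (u : R) : s <= u <= t -> is_derive u 1 (fun v => D v * expR (A * r v))
      ((dD u + A * (D u * (drho x u + drho y u))) * expR (A * r u)).
    move=> _; have d1 := scalar_solution_rho u sx; have d2 := scalar_solution_rho u sy.
    have dr : is_derive u 1 r (drho x u + drho y u) by exact: is_deriveD d1 d2.
    have e1 : is_derive u 1 (fun v => expR (A * r v)) (expR (A * r u) * (A * (drho x u + drho y u))).
      by apply: is_derive1_comp.
    have Du := D_derive u.
    by apply: is_derive_eq; rewrite /GRing.scale/=; ring.
  apply: (@le_trans _ _ (D t * expR (A * r t))).
    apply: ler_peMr; first exact: sqr_ge0.
    rewrite -[X in X <= _]expR0 ler_expR mulr_ge0// ltW// r0//.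
    exact: le_trans st.
  apply: (is_derive_le0_ge st dE) => u /andP[su _]; have Pu := le_trans Ps su.
  apply: mulr_le0_ge0; last exact: expR_ge0.
  have [_ h1] := dD_bound u Pu.
  have h2 : drho x u + drho y u <= - delta * r u.
    by rewrite /r mulrDr; apply: lerD; exact: drho_decay.
  have h3 : D u * (drho x u + drho y u) <= D u * (- delta * r u).
    by apply: ler_wpM2l => //; exact: sqr_ge0.
  have h4 := ler_wpM2l A0 h3.
  have e : A * (D u * (- delta * r u)) = - (2 * kappa / theta * (r u * D u)).
    by rewrite /A; field; rewrite !gt_eqF.
  by rewrite e in h4; lra.
have kd : 0 < kappa / delta by rewrite divr_gt0.
(* [x - y] tends to [l - m], so bounds on [D] at arbitrarily late points become bounds on
   [l - m]. *)
have close e : 0 < e -> exists2 t, s <= t & `|(x t - y t) - (l - m)| <= e.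
  move=> e0; have e'0 : 0 < e / (2 * (kappa / delta)) by rewrite divr_gt0// mulr_gt0.
  have [t1 Pt1 ht1] := rho_vanishes sx e'0; have [t2 Pt2 ht2] := rho_vanishes sy e'0.
  pose t := Num.max s (Num.max t1 t2); exists t; first by rewrite /t le_max lexx.
  have [k1 k2] : t1 <= t /\ t2 <= t by rewrite /t !le_max !lexx !orbT.
  have Pt := le_trans Pt1 k1.
  have a1 := lx t Pt; have a2 := ly t Pt.
  have b1 := ler_wpM2l (ltW kd) (ht1 t k1); have b2 := ler_wpM2l (ltW kd) (ht2 t k2).
  have ee : kappa / delta * (e / (2 * (kappa / delta))) = e / 2.
    by field; rewrite !gt_eqF.
  rewrite ee in b1 b2; have c1 := le_trans a1 b1; have c2 := le_trans a2 b2.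
  move: c1 c2; rewrite !ler_norml => /andP[? ?] /andP[? ?]; apply/andP; split; lra.
(* Returning from squares halves the exponent [A] to [kappa / (theta * delta)]. *)
have sqrt_le (a b c : R) : 0 <= c -> a ^+ 2 <= b ^+ 2 * c ^+ 2 -> `|a| <= `|b| * c.
  move=> c0 h; rewrite -(ger0_norm c0) -normrM -[X in X <= _]sqrtr_sqr -[X in _ <= X]sqrtr_sqr.
  by apply: ler_wsqrtr; rewrite exprMn.
split.
  apply/ler_addgt0Pr => e e0; have [t st ht] := close e e0.
  have : `|x s - y s| <= `|x t - y t| * 1 by apply: sqrt_le => //; rewrite expr1n mulr1; exact: grow.
  rewrite mulr1 => h; apply: le_trans h _.
  have := ler_normD (x t - y t - (l - m)) (l - m); rewrite subrK => h; lra.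
apply/ler_addgt0Pr => e e0; have [t st ht] := close e e0.
have : `|x t - y t| <= `|x s - y s| * expR (kappa / (theta * delta) * r s).
  apply: sqrt_le; first exact: expR_ge0.
  rewrite [X in _ * X]expr2 -expRD.
  have -> : kappa / (theta * delta) * r s + kappa / (theta * delta) * r s = A * r s.
    by rewrite /A; field; rewrite !gt_eqF.
  exact: bound.
have {}ht : `|l - m - (x t - y t)| <= e by rewrite distrC.
have := ler_normD (l - m - (x t - y t)) (x t - y t); rewrite subrK -/(r s); lra.
Qed.

(** The limit as a function of the initial condition. It is defined by choice, but for [Phi <= s]
    the comparison of solutions shows that it does not depend on the chosen solution. *)
Lemma limit_function_exists : exists lim : R -> R -> R, forall s w,
  exists x, [/\ scalar_solution x, x s = w & has_limit x (lim s w)].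
Proof.
have /choice[lim limP] : forall sw : R * R, exists l, exists x,
    [/\ scalar_solution x, x sw.1 = sw.2 & has_limit x l].
  move=> [s w]; have [x [sx xs]] := scalar_solution_exists s w.
  by have [l lx] := scalar_solution_limit sx; exists l, x.
by exists (fun s w => lim (s, w)) => s w; exact: limP (s, w).
Qed.

Variable lim : R -> R -> R.
Hypothesis limP : forall s w,
  exists x, [/\ scalar_solution x, x s = w & has_limit x (lim s w)].

(** Joint continuity of [lim]. The solution through [(f u, w u)] is compared at [f u] with one fixed
    solution [x] through [(f t, w t)]; the Gronwall bound [B] depends only on [x] and vanishes at
    [t]. *)
Lemma lim_continuous_comp (T : topologicalType) (f w : T -> R) (t : T) :
  {for t, continuous f} -> {for t, continuous w} -> Phi < f t ->
  {for t, continuous (fun u => lim (f u) (w u))}.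
Proof.
move=> cf cw Pt; have [x [sx xt lx]] := limP (f t) (w t).
pose B u := `|w u - x (f u)| *
  expR (kappa / (theta * delta) * (rho (f u) (w u) + rho (f u) (x (f u)))).
have cxf : {for t, continuous (fun u => x (f u))}.
  by apply: (@continuous_comp _ _ _ f x) => //; exact: scalar_solution_continuous.
have cB : {for t, continuous B}.
  apply: (@continuousM _ _ (fun u => `|w u - x (f u)|)).
    apply: (@continuous_comp _ _ _ (fun u => w u - x (f u)) (@Num.norm R R)); last exact: norm_continuous.
    exact: (@continuousB _ _ _ w (fun u => x (f u))).
  apply: (@continuous_comp _ _ _ (fun u => kappa / (theta * delta) *
    (rho (f u) (w u) + rho (f u) (x (f u)))) expR); last exact: continuous_expR.
  apply: (@continuousM _ _ (cst (kappa / (theta * delta)))); first exact: cst_continuous.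
  by apply: (@continuousD _ _ _ (fun u => rho (f u) (w u))); exact: rho_continuous_comp.
have Bt : B t = 0 by rewrite /B xt subrr normr0 mul0r.
have fP : \forall u \near t, Phi < f u by exact: (cvgr_gt _ cf).
apply/cvgrPdist_lt => e e0.
have : \forall u \near t, B u < e by apply: (cvgr_lt _ cB); rewrite Bt.
apply: filterS2 fP => u Pu Bu; apply: le_lt_trans Bu.
have [y [sy yu ly]] := limP (f u) (w u).
have [_] := scalar_solution_compare sy sx ly lx (ltW Pu).
by rewrite yu distrC.
Qed.

(** For large [s], [lim s w] differs from [w] by at most [1 / 2] whenever [l - 1 <= w], so the
    intermediate value theorem on [[l - 1, l + 1]] reaches every such [l']. A single [s] for all
    [l'] is what makes the orbits depend continuously on [c]. *)
Lemma lim_surjective l : exists2 s, Phi < s & forall l', `|l' - l| <= 1 / 2 ->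
  exists2 w, lim s w = l' & rho s w < 1 - theta ^+ 2.
Proof.
have t2 := theta2_lt1; have kd : 0 < kappa / delta by rewrite divr_gt0.
(* The first bound makes the distance to the limit at most [1 / 2], the second keeps the truncation
   inactive. *)
pose e := Num.min (1 / (2 * (kappa / delta))) ((1 - theta ^+ 2) / 2).
have e0 : 0 < e 
  by rewrite lt_min; apply/andP; split; [rewrite divr_gt0// mulr_gt0//|rewrite divr_gt0// subr_gt0].
have [e1 e2] : e <= 1 / (2 * (kappa / delta)) /\ e <= (1 - theta ^+ 2) / 2.
  by rewrite /e !ge_min !lexx orbT.
have [t Pt tP] := rho_cst_vanishes (l - 1) e0.
pose s := t + 1; have ts : t <= s by rewrite /s; lra.
exists s; first by rewrite /s; lra.
have Ps : Phi <= s by rewrite /s; lra.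
move=> l'; rewrite ler_norml => /andP[l1 l2].
have small w : l - 1 <= w -> rho s w <= e.
  move=> lw; apply: le_trans (tP s ts); rewrite (rho_shift _ (l - 1) w).
  apply: ler_piMr; first exact/ltW/rho_gt0.
  by rewrite -[X in _ <= X]expR0 ler_expR mulNr oppr_le0 mulr_ge0// subr_ge0.
have near_ w : l - 1 <= w -> `|w - lim s w| <= 1 / 2.
  move=> lw; have [x [_ xs /(_ s Ps)]] := limP s w; rewrite xs => h; apply: le_trans h _.
  apply: (le_trans (ler_wpM2l (ltW kd) (le_trans (small w lw) e1))).
  by rewrite le_eqVlt; apply/orP; left; apply/eqP; field; rewrite !gt_eqF.
have [|||w + <-] := @IVT R (lim s) (l - 1) (l + 1) l'.
- lra.
- apply: continuous_subspaceT => w.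
  apply: (@lim_continuous_comp _ (cst s) id w); [exact: cst_continuous|by []|].
  by rewrite /s /=; lra.
- have h1 := near_ (l - 1) (lexx _); have h2 : `|l + 1 - lim s (l + 1)| <= 1 / 2 by apply: near_; lra.
  move: h1 h2; rewrite !ler_norml => /andP[? ?] /andP[? ?].
  by rewrite ge_min le_max; apply/andP; split; apply/orP; [left|right]; lra.
rewrite in_itv/= => /andP[lw _]; exists w => //.
by have := small w lw; lra.
Qed.

End ScalarEquation.

(** * Proper time along a solution of the scalar equation *)

Section AtRight.
Context {R : realType}.

Lemma near_at_right0P (P : R -> Prop) :
  (\forall t \near 0^'+, P t) <-> exists2 e : R, 0 < e & forall t, 0 < t < e -> P t.
Proof.
split.
  move=> [e /= e0 eP]; exists e => // t /andP[t0 te]; apply: eP => //=.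
  by rewrite sub0r normrN gtr0_norm.
move=> [e e0 eP]; near=> t; apply: eP; apply/andP; split; near: t.
  exact: nbhs_right_gt.
exact: nbhs_right_lt.
Unshelve. all: by end_near. Qed.

Lemma eqO_at_right0P (f e : R -> R) : f =O_ (0^'+) e <->
  exists k r : R, [/\ 0 < k, 0 < r & forall t, 0 < t < r -> `|f t| <= k * `|e t|].
Proof.
split=> [/eqO_exP[k k0 /near_at_right0P[r r0 H]]|[k [r [k0 r0 H]]]].
  by exists k, r; split.
by apply/eqO_exP; exists k => //; apply/near_at_right0P; exists r.
Qed.

(** [ln (1 + v) <= v] for [u] and for [u^-1], with [u^-1 <= 2]. *)
Lemma ln_bound (u : R) : `|u - 1| <= 1 / 2 -> `|ln u| <= 2 * `|u - 1|.
Proof.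
rewrite ler_norml => /andP[u1 u2]; have u0 : 0 < u by lra.
have h1 : ln u <= u - 1.
  by have := @le_ln1Dx R (u - 1); rewrite addrCA subrr addr0; apply; lra.
have h2 : - ln u <= u^-1 - 1.
  have v0 : 0 < u^-1 by rewrite invr_gt0.
  by have := @le_ln1Dx R (u^-1 - 1); rewrite addrCA subrr addr0 lnV ?posrE//; apply; lra.
have h3 : u^-1 - 1 <= 2 * `|u - 1|.
  have -> : u^-1 - 1 = (1 - u) * u^-1 by field; rewrite gt_eqF.
  have ui : u^-1 <= 2 by rewrite invf_ple ?posrE//; lra.
  rewrite mulrC distrC; apply: (@le_trans _ _ (u^-1 * `|1 - u|)).
    by apply: ler_wpM2l; [rewrite invr_ge0 ltW|exact: ler_norm].
  exact: ler_wpM2r.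
have := ler_norm (u - 1); have := normr_ge0 (u - 1) => ? ?.
by rewrite ler_norml; apply/andP; split; lra.
Qed.

Lemma is_derive_lt0_gt (f df : R -> R) (a b : R) : a < b ->
  (forall x : R, a <= x <= b -> is_derive x 1 f (df x)) ->
  (forall x, a <= x <= b -> df x < 0) -> f b < f a.
Proof.
move=> ab fd d0; have [c cab e] := is_derive_mvt (ltW ab) fd.
by rewrite -subr_lt0 e nmulr_rlt0 ?d0// subr_gt0.
Qed.

End AtRight.

Section Arc.
Context {R : realType} (V : R -> R) (kappa delta theta Phi MV : R).
Hypotheses (kappa0 : 0 < kappa) (kappa2 : kappa ^+ 2 = 3 / 2).
Hypothesis kappaV : Num.sqrt (2 / 3) = kappa^-1.
Hypotheses (delta0 : 0 < delta) (theta0 : 0 < theta) (theta1 : theta < 1).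
Hypothesis V_derive : forall x : R, is_derive x 1 V (derive1 V x).
Hypothesis V_pos : forall x, Phi <= x -> 0 < V x.
Hypothesis V_growth : forall x, Phi <= x ->
  derive1 V x <= (2 * kappa * theta - delta) * V x.
Hypothesis V_log_lipschitz : forall x, Phi <= x -> `|derive1 V x| <= MV * V x.

Local Notation rho := (rho V kappa).
Local Notation speed := (speed V kappa theta Phi).
Local Notation scalar_solution := (scalar_solution V kappa theta Phi).
Local Notation has_limit := (has_limit V kappa delta Phi).

(** [ln V] has the Lipschitz constant [MV]. This permits replacing [phi] by [- kappa^-1 * ln t]
    inside [V]. *)
Lemma V_le_shift a b : Phi <= a -> Phi <= b -> V a <= V b * expR (MV * `|a - b|).
Proof.
move=> Pa Pb.
have H u v : Phi <= u -> u <= v -> V v <= V u * expR (MV * (v - u)) /\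
    V u <= V v * expR (MV * (v - u)).
  move=> Pu uv; apply: (exponential_growth uv (fun w _ => V_derive w)).
  by move=> w /andP[uw _]; apply: V_log_lipschitz; exact: le_trans uw.
have [ab|/ltW ba] := leP a b.
  by rewrite distrC ger0_norm ?subr_ge0//; exact: (H _ _ Pa ab).2.
by rewrite ger0_norm ?subr_ge0//; exact: (H _ _ Pb ba).1.
Qed.

Section OneSolution.
Variables (x : R -> R) (l : R).
Hypotheses (sx : scalar_solution x) (lx : has_limit x l).

Local Notation E s := (expR (- (x s + kappa * s))).
Local Notation S s := (speed s (x s)).

Lemma speed_pos s : 0 < S s.
Proof. exact: lt_le_trans theta0 (speed_ge V kappa Phi theta0 s (x s)). Qed.

Lemma invK_derive (s : R) : is_derive s 1 (fun s => E s) (- (kappa * S s) * E s).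
Proof.
have dx := sx s.
have e1 : is_derive s 1 (fun s => - (x s + kappa * s)) (- (kappa * S s)).
  by apply: is_derive_eq; rewrite /GRing.scale/=; ring.
by have := @is_derive1_comp _ expR _ s _ _ (is_derive_expR _) e1; rewrite mulrC.
Qed.

(* [E] is [1 / K]. [tau] is the antiderivative of [dt/dphi = 1 / phidot] that vanishes
   at infinity: [tau0 - E] has a limit [l0] by [tail_limit]. *)
Lemma time_exists : exists tau : R -> R,
  (forall s : R, is_derive s 1 tau (- (kappa * (E s / S s)))) /\
  forall s, Phi <= s -> `|tau s - E s| <= kappa / (theta * delta) * (rho s (x s) * E s).
Proof.
have cx := scalar_solution_continuous sx.
have [|tau0 dtau] := @antiderivative_exists _ (fun s => - (kappa * (E s / S s))).
  move=> s; apply: (@continuousN _ _ _ (fun s => kappa * (E s / S s))).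
  apply: (@continuousM _ _ (cst kappa) (fun s => E s / S s)); first exact: cst_continuous.
  apply: (@continuousM _ _ (fun s => E s) (fun s => (S s)^-1)).
    exact: is_derive_continuous (invK_derive s).
  apply: continuousV; first by rewrite gt_eqF// speed_pos.
  exact: (speed_continuous_comp V_derive cx).
have kt0 : 0 <= kappa / theta by rewrite divr_ge0// ltW.
suff [l0 l0P] : exists l0, forall s, Phi <= s ->
    `|tau0 s - E s - l0| <= kappa / theta / delta * (rho s (x s) * E s).
  exists (fun s => tau0 s - l0); split.
    by move=> s; have d := dtau s; rewrite -[- (kappa * _)]subr0; apply: is_deriveB.
  move=> s Ps; have := l0P s Ps.
  have -> : kappa / theta / delta = kappa / (theta * delta) by field; rewrite !gt_eqF.
  by have -> : tau0 s - l0 - E s = tau0 s - E s - l0 by ring.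
apply: (@tail_limit _ (fun s => rho s (x s) * E s)
  (fun s => drho V kappa theta Phi x s * E s + rho s (x s) * (- (kappa * S s) * E s)) Phi delta delta0 _ _ _
  (fun s => tau0 s - E s)
  (fun s => - (kappa * (E s / S s)) - - (kappa * S s) * E s) (kappa / theta)).
- by move=> s Ps; have r0 := rho_gt0 kappa V_pos (x s) Ps; rewrite mulr_ge0 ?expR_ge0// ltW.
- move=> s Ps; have d1 := scalar_solution_rho V_derive s sx; have d2 := invK_derive s.
  by apply: is_derive_eq; rewrite /GRing.scale/=; ring.
- move=> s Ps; have h1 := ler_wpM2r (expR_ge0 (- (x s + kappa * s)))
    (drho_decay kappa0 theta0 V_pos V_growth x Ps).
  have h2 : 0 <= rho s (x s) * (kappa * S s * E s).
    have r0 := rho_gt0 kappa V_pos (x s) Ps; have S0 := speed_pos s.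
    by rewrite ltW// mulr_gt0// mulr_gt0 ?expR_gt0// mulr_gt0.
  by lra.
- move=> s Ps; have d1 := dtau s; have d2 := invK_derive s; exact: is_deriveB.
- move=> s Ps; have S0 := speed_pos s.
  (* The derivative of [tau0 - E] contains the factor [1 - S^2 <= rho], which makes it of order
     [rho * E]. *)
  have -> : - (kappa * (E s / S s)) - - (kappa * S s) * E s =
    - ((kappa * (E s / S s)) * (1 - S s ^+ 2)) by field; rewrite gt_eqF.
  rewrite normrN normrM ger0_norm; last by rewrite mulr_ge0 ?divr_ge0 ?expR_ge0 ?ltW.
  have S1 : S s <= 1 by apply: (speed_le1 kappa theta0 theta1 V_pos).
  have h1 : `|1 - S s ^+ 2| <= rho s (x s).
    have : S s ^+ 2 <= 1 by rewrite expr_le1// ltW.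
    have : 1 - rho s (x s) <= S s ^+ 2.
      by rewrite (speed_sqr V kappa theta Phi) (max_idPl Ps) le_max lexx orbT.
    move: (S s ^+ 2) (rho s (x s)) => a b ? ?.
    by rewrite ler_norml; apply/andP; split; lra.
  have -> : kappa / theta * (rho s (x s) * E s) = kappa * (E s / theta) * rho s (x s) by ring.
  apply: ler_pM => //; first by rewrite mulr_ge0 ?divr_ge0 ?expR_ge0 ?ltW.
  apply: ler_wpM2l; first exact: ltW.
  apply: ler_wpM2l; first exact: expR_ge0.
  by rewrite lef_pV2 ?posrE// (speed_ge V kappa Phi theta0 s (x s)).
- by [].
Qed.

Lemma invK_vanishes e : 0 < e -> exists2 t, Phi <= t & forall s, t <= s -> E s <= e.
Proof.
apply: (@decay_vanishes _ (fun s => E s) (fun s => - (kappa * S s) * E s) Phi (kappa * theta)).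
- exact: mulr_gt0.
- by move=> s _; exact: expR_ge0.
- by move=> s _; exact: invK_derive.
- move=> s _; apply: ler_wpM2r; first exact: expR_ge0.
  rewrite lerN2; apply: ler_wpM2l; first exact: ltW.
  exact: speed_ge.
Qed.

Variable tau : R -> R.
Hypothesis tau_derive : forall s : R, is_derive s 1 tau (- (kappa * (E s / S s))).
Hypothesis tau_E : forall s, Phi <= s ->
  `|tau s - E s| <= kappa / (theta * delta) * (rho s (x s) * E s).

Lemma tau_decreasing s t : s < t -> tau t < tau s.
Proof.
move=> st; apply: (is_derive_lt0_gt st (fun u _ => tau_derive u)) => u _.
by rewrite oppr_lt0 mulr_gt0// divr_gt0 ?expR_gt0 ?speed_pos.
Qed.

Lemma tau_vanishes e : 0 < e -> exists2 t, Phi <= t & forall s, t <= s -> `|tau s| <= e.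
Proof.
move=> e0; pose C := kappa / (theta * delta).
have C0 : 0 < C by rewrite divr_gt0// mulr_gt0.
have e20 : 0 < e / (C + 1) by rewrite divr_gt0// addr_gt0.
have [t Pt tP] := invK_vanishes e20.
have [t' Pt' t'P] := rho_vanishes kappa0 delta0 theta0 V_derive V_pos V_growth sx ltr01.
exists (Num.max t t'); first by rewrite le_max Pt.
move=> s; rewrite ge_max => /andP[ts t's]; have Ps := le_trans Pt ts.
have h1 := tau_E Ps; have h2 := tP s ts; have h3 := t'P s t's.
have E0 := expR_ge0 (- (x s + kappa * s)).
have h4 : rho s (x s) * E s <= E s by rewrite ler_piMl.
have h5 : C * (rho s (x s) * E s) <= C * E s by apply: ler_wpM2l => //; exact: ltW.
have h6 : (C + 1) * E s <= e by rewrite mulrC -ler_pdivlMr// addr_gt0.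
have h7 : 0 <= C * E s by rewrite mulr_ge0// ltW.
move: h1; rewrite -/C !ler_norml => /andP[? ?]; apply/andP; split; lra.
Qed.

(** [tau] is strictly decreasing with limit zero; a value at most zero at [s + 1] would keep all
    later values away from zero. *)
Lemma tau_gt0 s : 0 < tau s.
Proof.
apply: le_lt_trans _ (tau_decreasing (_ : s < s + 1)); last by rewrite ltrDl.
rewrite leNgt; apply/negP => h; pose e := - tau (s + 1) / 2.
have e0 : 0 < e by rewrite /e; lra.
have [t _ tP] := tau_vanishes e0.
have := tP (Num.max t (s + 2)); rewrite le_max lexx => /(_ isT).
have m : s + 1 < Num.max t (s + 2) by rewrite lt_max; apply/orP; right; lra.
have := tau_decreasing m; rewrite ler_norml /e => ? /andP[? ?]; lra.
Qed.

Lemma tau_inverse s0 : exists psi : R -> R,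
  (forall t, 0 < t < tau s0 -> s0 < psi t /\ tau (psi t) = t) /\
  (forall s, s0 < s -> psi (tau s) = s).
Proof.
have /choice[psi psiP] : forall t, exists s, 0 < t < tau s0 -> s0 < s /\ tau s = t.
  move=> t; have [/andP[t0 ts]|?] := boolP (0 < t < tau s0); last by exists 0.
  have [s _ sP] := tau_vanishes t0.
  pose s1 := Num.max s0 s; have [k1 k2] : s0 <= s1 /\ s <= s1.
    by rewrite /s1 !le_max !lexx orbT.
  have [||u] := @IVT R tau s0 s1 t k1.
  - by apply: continuous_subspaceT => u; exact: is_derive_continuous (tau_derive u).
  - rewrite ge_min le_max (ltW ts) /= ; apply/andP; split => //; apply/orP; right.
    exact: le_trans (ler_norm _) (sP _ k2).
  rewrite in_itv/= => /andP[su _] e; exists u => _; split => //.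
  rewrite lt_neqAle su andbT; apply/eqP => s0u.
  by move: ts; rewrite -e s0u ltxx.
exists psi; split => // s ss; have [|p1 p2] := psiP (tau s).
  by rewrite tau_gt0 tau_decreasing.
have [h|h|//] := ltgtP (psi (tau s)) s; have := tau_decreasing h;
  by rewrite p2 ltxx.
Qed.

(** [speed] contains maxima. Where they are inactive it equals this square root, which can be
    differentiated and supplies the acceleration of [phi]. *)
Lemma sqrt_defect_derive (s : R) : Phi < s -> rho s (x s) < 1 - theta ^+ 2 ->
  is_derive s 1 (fun s => Num.sqrt (1 - rho s (x s)))
   ((2 * S s)^-1 * - drho V kappa theta Phi x s).
Proof.
move=> Ps rs; have t2 := sqr_ge0 theta.
have SE : S s = Num.sqrt (1 - rho s (x s)).
  rewrite -(speed_sqrE (ltW Ps) (ltW rs)) sqrtr_sqr ger0_norm//.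
  exact: ltW (speed_pos s).
have r1 : 0 < 1 - rho s (x s) by lra.
rewrite SE; apply: is_derive1_comp; first exact: is_derive1_sqrt.
have d := scalar_solution_rho V_derive s sx.
by rewrite -[- drho V _ _ _ x s]add0r; apply: is_deriveB.
Qed.

(** Reparametrisation by proper time: [phi] becomes the inverse [psi] of [tau], and [K] and [phidot]
    are read off from [E] and [S]. Since [rho] does not increase, the truncation is inactive on the
    whole arc. The point [p0] is a default value outside []0, tau s0[]. *)
Lemma arc_solution s0 (p0 : phase V) : Phi < s0 -> rho s0 (x s0) < 1 - theta ^+ 2 ->
  exists g : R -> phase V, is_solution 0 (tau s0) g /\
  forall s, s0 < s -> [/\ phi_ (g (tau s)) = s,
    phidot_ (g (tau s)) = - (S s / (kappa * E s)) & K_ (g (tau s)) = (E s)^-1].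
Proof.
move=> Ps0 rs0.
have small s : s0 <= s -> rho s (x s) < 1 - theta ^+ 2.
  move=> ss; apply: le_lt_trans rs0.
  exact: (rho_nonincreasing kappa0 delta0 theta0 V_derive V_pos V_growth sx (ltW Ps0)).
have SE s : s0 <= s -> S s = Num.sqrt (1 - rho s (x s)).
  move=> ss; have Ps := lt_le_trans Ps0 ss.
  rewrite -(speed_sqrE (ltW Ps) (ltW (small s ss))) sqrtr_sqr ger0_norm//.
  exact: ltW (speed_pos s).
have [psi [psiP psiK]] := tau_inverse s0.
have psi_derive (t : R) : 0 < t < tau s0 ->
    is_derive t 1 psi (- (S (psi t) / (kappa * E (psi t)))).
  move=> t0; have [p1 p2] := psiP t t0.
  have -> : - (S (psi t) / (kappa * E (psi t))) = (- (kappa * (E (psi t) / S (psi t))))^-1.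
    by field; rewrite !gt_eqF ?expR_gt0 ?speed_pos.
  rewrite -{1}p2; apply: (@is_derive_inverse _ tau psi).
  - near=> s; apply: psiK; near: s; exact: lt_nbhsr.
  - by near=> s; exact: is_derive_continuous (tau_derive s).
  by rewrite oppr_eq0 mulf_neq0 ?gt_eqF ?divr_gt0 ?expR_gt0 ?speed_pos.
have constr s : s0 < s -> (E s)^-1 ^+ 2 = 3 * V s + 3 / 2 * (- (S s / (kappa * E s))) ^+ 2.
  move=> ss; have Ps := lt_trans Ps0 ss.
  have h := speed_sqrE (ltW Ps) (ltW (small s (ltW ss))).
  have rE : rho s (x s) = 3 * V s * E s ^+ 2.
    exact: rhoE.
  have E0 := expR_gt0 (- (x s + kappa * s)).
  have -> : (- (S s / (kappa * E s))) ^+ 2 = S s ^+ 2 / (kappa ^+ 2 * E s ^+ 2).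
    by field; rewrite !gt_eqF.
  by rewrite h rE kappa2; field; rewrite gt_eqF.
have /choice[g gP] : forall t : R, exists p : phase V, 0 < t < tau s0 ->
   [/\ phi_ p = psi t, phidot_ p = - (S (psi t) / (kappa * E (psi t))) &
     K_ p = (E (psi t))^-1].
  move=> t; have [t0|?] := boolP (0 < t < tau s0); last by exists p0.
  have [ps _] := psiP t t0.
  have [|p pP] := @phase_point R V _ _ (E (psi t))^-1 _ (constr _ ps).
    by rewrite invr_gt0 expR_gt0.
  by exists p.
exists g; split; last first.
  move=> s ss; have [|g1 g2 g3] := gP (tau s).
    by rewrite tau_gt0 tau_decreasing.
  by rewrite g1 g2 g3 psiK.
move=> t t0; have [g1 g2 g3] := gP t t0; have [p1 p2] := psiP t t0.
have dpsi := psi_derive t t0; have nt := ltr_itv_near t0.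
set s := psi t in g1 g2 g3 p1 p2 dpsi *; have Ps := lt_trans Ps0 p1.
have E0 := expR_gt0 (- (x s + kappa * s)); have S0 := speed_pos s.
have K_derive : is_derive s 1 (fun s => (E s)^-1) (kappa * S s / E s).
  have d := invK_derive s; have E1 : E s != 0 by rewrite gt_eqF.
  refine (is_derive_eq (@is_deriveV _ (fun s => E s) s _ 1 E1 d) _); rewrite /GRing.scale/=.
  by field.
have dsq := sqrt_defect_derive Ps (small s (ltW p1)).
rewrite /solves_at g1 g2 g3; split.
- by apply: is_derive_near_eq dpsi; apply: filterS nt => u /gP[+ _ _] /= => ->.
- apply: (@is_derive_near_eq _ ((fun s => - kappa^-1 * ((E s)^-1 * Num.sqrt (1 - rho s (x s)))) \o psi)).
    apply: filterS nt => u ut; have [_ + _] := gP u ut; rewrite /= => ->.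
    have [pu _] := psiP u ut; rewrite -(SE _ (ltW pu)).
    by field; rewrite !gt_eqF ?expR_gt0.
  have dv : is_derive s 1 (fun s => - kappa^-1 * ((E s)^-1 * Num.sqrt (1 - rho s (x s))))
     (- kappa^-1 * ((E s)^-1 * ((2 * S s)^-1 * - drho V kappa theta Phi x s) +
       S s * (kappa * S s / E s))).
    by apply: is_derive_eq; rewrite /GRing.scale/= -(SE _ (ltW p1)).
  refine (is_derive_eq (is_derive1_comp dv dpsi) _).
  rewrite /drho.
  have -> : expR (-2 * (x s + kappa * s)) = E s ^+ 2.
    by rewrite expr2 -expRD; congr expR; ring.
  have h : rho s (x s) = 1 - S s ^+ 2.
    by rewrite (speed_sqrE (ltW Ps) (ltW (small s (ltW p1)))); ring.
  rewrite h.
  have -> : - kappa^-1 * ((E s)^-1 * ((2 * S s)^-1 * - (3 * derive1 V s * E s ^+ 2 -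
      2 * (kappa * (S s - 1) + kappa) * (1 - S s ^+ 2))) + S s * (kappa * S s / E s)) *
      - (S s / (kappa * E s)) =
      S s / (kappa * E s ^+ 2) - 3 / 2 / kappa ^+ 2 * derive1 V s.
    by field; rewrite !gt_eqF.
  by rewrite kappa2; field; rewrite !gt_eqF.
apply: (@is_derive_near_eq _ ((fun s => (E s)^-1) \o psi)).
  by apply: filterS nt => u /gP[_ _ +] /= => ->.
refine (is_derive_eq (is_derive1_comp K_derive dpsi) _).
have -> : - (3 / 2) * (- (S s / (kappa * E s))) ^+ 2 =
  - (3 / 2 / kappa ^+ 2 * (S s ^+ 2 / E s ^+ 2)) by field; rewrite !gt_eqF.
by rewrite kappa2; field; rewrite !gt_eqF.
Unshelve. all: by end_near. Qed.

(** Up to the factor [kappa^-1] the left-hand side is [ln (tau / E) - (x - l)]. The first term is of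
    order [rho] because [tau / E] is close to [1], the second because [x] converges to [l] at that
    rate. *)
Lemma limit_phi_error s : Phi <= s -> kappa / (theta * delta) * rho s (x s) <= 1 / 2 ->
  `|s + kappa^-1 * (ln (tau s) + l)| <=
  kappa^-1 * (2 * (kappa / (theta * delta)) + kappa / delta) * rho s (x s).
Proof.
move=> Ps small; set C := kappa / (theta * delta) in small *.
have E0 := expR_gt0 (- (x s + kappa * s)).
have u1 : `|tau s / E s - 1| <= C * rho s (x s).
  have -> : tau s / E s - 1 = (tau s - E s) / E s by field; rewrite gt_eqF.
  rewrite normrM normfV (gtr0_norm E0) ler_pdivrMr// -mulrA.
  exact: tau_E.
have u2 := ln_bound (le_trans u1 small).
have lnE : ln (tau s / E s) = ln (tau s) + (x s + kappa * s).
  by rewrite ln_div ?posrE ?tau_gt0// expRK opprK.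
have -> : s + kappa^-1 * (ln (tau s) + l) = kappa^-1 * (ln (tau s / E s) - (x s - l)).
  by rewrite lnE; field; rewrite gt_eqF.
rewrite normrM gtr0_norm ?invr_gt0// -mulrA; apply: ler_wpM2l.
  by rewrite invr_ge0 ltW.
apply: (le_trans (ler_normB _ _)); rewrite mulrDl; apply: lerD; last exact: lx.
by apply: (le_trans u2); rewrite -mulrA; apply: ler_wpM2l.
Qed.

(** All errors are of order [rho] in [phi], and [rho / t] in [K] and [phidot]. It remains to bound
    [rho = 3 V E^2] by a multiple of [t * eps_V t]. *)
Lemma arc_asymptotics : exists C r : R, [/\ 0 < C, 0 < r & forall s, Phi <= s -> tau s < r ->
  [/\ `|(E s)^-1 - (tau s)^-1| <= C * eps_V V (tau s),
     `|s + kappa^-1 * (ln (tau s) + l)| <= C * (tau s * eps_V V (tau s)) &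
     `|- (S s / (kappa * E s)) + kappa^-1 * (tau s)^-1| <= C * eps_V V (tau s)]].
Proof.
pose C1 := kappa / (theta * delta); pose C3 := kappa^-1 * (2 * C1 + kappa / delta).
have C10 : 0 < C1 by rewrite divr_gt0// mulr_gt0.
have C30 : 0 < C3.
  apply: mulr_gt0; first by rewrite invr_gt0.
  by apply: addr_gt0; [exact: mulr_gt0|exact: divr_gt0].
(* [D] bounds the distance from [s] to [- kappa^-1 * ln (tau s)]. In [C4], [12 = 3 * 2^2] comes from
   the [3] in [rho] and from [E <= 2 * tau]; the exponential pays for moving the argument of [V] by
   [D]. *)
pose D := C3 + kappa^-1 * `|l|.
pose C4 := 12 * expR (MV * D).
have C40 : 0 < C4 by rewrite mulr_gt0// expR_gt0.
have e0 : 0 < Num.min 1 (1 / (2 * C1)) by rewrite lt_min ltr01 divr_gt0// mulr_gt0.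
have [s2 Ps2 s2P] := rho_vanishes kappa0 delta0 theta0 V_derive V_pos V_growth sx e0.
pose K2 := kappa^-1 * (C1 + 2) + C1 + C3.
have K20 : 0 < K2 by rewrite addr_gt0// addr_gt0// mulr_gt0 ?invr_gt0// addr_gt0.
(* [tau s < tau s2] forces [s2 <= s], where [rho] is small; the other bound puts
   [- kappa^-1 * ln (tau s)] beyond [Phi]. *)
pose r := Num.min (tau s2) (expR (- (kappa * Phi))).
exists (K2 * C4), r; split; first exact: mulr_gt0.
  by rewrite lt_min tau_gt0 expR_gt0.
move=> s Ps; rewrite lt_min => /andP[tr1 tr2].
have ss : s2 <= s by rewrite leNgt; apply/negP => /tau_decreasing; lra.
have [r1 r2] : rho s (x s) <= 1 /\ C1 * rho s (x s) <= 1 / 2.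
  have := s2P s ss; rewrite le_min => /andP[? h]; split => //.
  rewrite mulrC -ler_pdivlMr//; apply: le_trans h _.
  by rewrite le_eqVlt; apply/orP; left; apply/eqP; field; rewrite gt_eqF.
have r0 := rho_gt0 kappa V_pos (x s) Ps.
have t0 := tau_gt0 s; have E0 := expR_gt0 (- (x s + kappa * s)).
have u1 : `|tau s / E s - 1| <= C1 * rho s (x s).
  have -> : tau s / E s - 1 = (tau s - E s) / E s by field; rewrite gt_eqF.
  rewrite normrM normfV (gtr0_norm E0) ler_pdivrMr// -mulrA.
  exact: tau_E.
have [q1 q2] : tau s <= 2 * E s /\ E s <= 2 * tau s.
  have := le_trans u1 r2; rewrite ler_norml => /andP[a1 a2].
  have b1 : tau s / E s <= 3 / 2 by lra.
  have b2 : 1 / 2 <= tau s / E s by lra.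
  by rewrite ler_pdivrMr// in b1; rewrite ler_pdivlMr// in b2; split; lra.
have rE : rho s (x s) = 3 * V s * E s ^+ 2.
  exact: rhoE.
pose s' := - kappa^-1 * ln (tau s).
have Ps' : Phi <= s'.
  have h : ln (tau s) <= - (kappa * Phi).
    by rewrite -[X in _ <= X]expRK; apply: ltW; rewrite ltr_ln ?posrE ?expR_gt0.
  rewrite /s' mulNr -mulrN mulrC ler_pdivlMr// mulrC; lra.
have phi_err := limit_phi_error Ps r2; rewrite -/C1 -/C3 in phi_err.
have ss' : `|s - s'| <= D.
  have -> : s - s' = (s + kappa^-1 * (ln (tau s) + l)) - kappa^-1 * l by rewrite /s'; ring.
  apply: (le_trans (ler_normB _ _)); apply: lerD.
    by apply: (le_trans phi_err); rewrite ler_piMr// ltW.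
  by rewrite normrM gtr0_norm// invr_gt0.
have V's := V_pos Ps'.
have MV0 : 0 <= MV.
  have := le_trans (normr_ge0 _) (V_log_lipschitz Ps'); rewrite pmulr_lge0//.
have Vle : V s <= V s' * expR (MV * D).
  apply: (le_trans (V_le_shift Ps Ps')); apply: ler_wpM2l; first exact: ltW.
  by rewrite ler_expR; apply: ler_wpM2l.
have eV : eps_V V (tau s) = tau s * V s' by rewrite /eps_V kappaV.
have rle : rho s (x s) <= C4 * (tau s * eps_V V (tau s)).
  rewrite rE eV; have E2 : E s ^+ 2 <= 4 * tau s ^+ 2.
    have -> : 4 * tau s ^+ 2 = (2 * tau s) ^+ 2 by ring.
    rewrite ler_pXn2r ?nnegrE ?expR_ge0//.
    by rewrite mulr_ge0// ltW.
  have -> : C4 * (tau s * (tau s * V s')) = 3 * (V s' * expR (MV * D)) * (4 * tau s ^+ 2).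
    by rewrite /C4; ring.
  apply: ler_pM; [by rewrite mulr_ge0// ltW// V_pos|exact: sqr_ge0| |exact: E2].
  exact: ler_wpM2l.
have eps0 : 0 < eps_V V (tau s) by rewrite eV mulr_gt0.
have rle' : rho s (x s) / tau s <= C4 * eps_V V (tau s).
  rewrite ler_pdivrMr//; apply: (le_trans rle).
  by rewrite le_eqVlt; apply/orP; left; apply/eqP; ring.
have X0 : 0 <= C4 * eps_V V (tau s) by rewrite ltW// mulr_gt0.
have kV0 : 0 < kappa^-1 by rewrite invr_gt0.
have kk : 0 <= kappa^-1 * (C1 + 2) by rewrite mulr_ge0 ?ltW// addr_gt0.
have err1 : `|(E s)^-1 - (tau s)^-1| <= C1 * (C4 * eps_V V (tau s)).
  have -> : (E s)^-1 - (tau s)^-1 = (tau s / E s - 1) / tau s.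
    by field; rewrite !gt_eqF.
  rewrite normrM normfV (gtr0_norm t0).
  apply: (@le_trans _ _ (C1 * rho s (x s) / tau s)).
    by apply: ler_wpM2r => //; rewrite invr_ge0 ltW.
  by rewrite -mulrA; apply: ler_wpM2l => //; exact: ltW.
have grow k : 0 <= k -> k <= K2 -> k * (C4 * eps_V V (tau s)) <= K2 * C4 * eps_V V (tau s).
  by move=> ? ?; rewrite -mulrA; apply: ler_wpM2r.
split.
- by apply: le_trans err1 _; apply: grow; rewrite /K2; lra.
- apply: (le_trans phi_err); apply: (@le_trans _ _ (C3 * (C4 * (tau s * eps_V V (tau s))))).
    by apply: ler_wpM2l => //; exact: ltW.
  rewrite -[X in _ <= X]mulrA; apply: ler_wpM2r; first exact: (ltW (mulr_gt0 C40 (mulr_gt0 t0 eps0))).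
  by rewrite /K2; lra.
(* The error of [phidot] splits into the defect [1 - S] and the error of [K] already bounded. *)
have -> : - (S s / (kappa * E s)) + kappa^-1 * (tau s)^-1 =
   kappa^-1 * ((1 - S s) / E s - ((E s)^-1 - (tau s)^-1)) by field; rewrite !gt_eqF.
rewrite normrM (gtr0_norm kV0).
apply: (@le_trans _ _ (kappa^-1 * (C1 + 2) * (C4 * eps_V V (tau s)))); last first.
  by apply: grow => //; rewrite /K2; lra.
rewrite -mulrA; apply: ler_wpM2l; first exact: ltW.
apply: (le_trans (ler_normB _ _)); rewrite [X in _ <= X]mulrDl [X in _ <= X]addrC; apply: lerD => //.
have S1 : S s <= 1 by apply: (speed_le1 kappa theta0 theta1 V_pos).
have Sr : 1 - S s <= rho s (x s).
  by have := speed_defect kappa theta0 theta1 V_pos s (x s); rewrite (max_idPl Ps).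
rewrite normrM normfV (gtr0_norm E0) ger0_norm ?subr_ge0//.
apply: (@le_trans _ _ (rho s (x s) * (2 / tau s))).
  apply: ler_pM; [by rewrite subr_ge0|by rewrite invr_ge0 ltW|exact: Sr|].
  by rewrite ler_pdivlMr// mulrC ler_pdivrMr.
have -> : rho s (x s) * (2 / tau s) = 2 * (rho s (x s) / tau s) by ring.
exact: ler_wpM2l.
Qed.

End OneSolution.

End Arc.

(** * Orbits near [p_-] *)

Section Orbits.
Context {R : realType} (V : R -> R) (kappa delta theta Phi MV : R).
Hypotheses (kappa0 : 0 < kappa) (kappa2 : kappa ^+ 2 = 3 / 2).
Hypotheses (kappaE : Num.sqrt (3 / 2) = kappa) (kappaV : Num.sqrt (2 / 3) = kappa^-1).
Hypotheses (delta0 : 0 < delta) (theta0 : 0 < theta) (theta1 : theta < 1).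
Hypothesis V_C2 : class_C 2 V.
Hypothesis V_pos : forall x, Phi <= x -> 0 < V x.
Hypothesis V_growth : forall x, Phi <= x ->
  derive1 V x <= (2 * kappa * theta - delta) * V x.
Hypothesis V_log_lipschitz : forall x, Phi <= x -> `|derive1 V x| <= MV * V x.
Implicit Types (p q : phase V) (g h : R -> phase V) (o : orbit_space V).

Let V_derive := potential_derive V_C2.
Local Notation rho := (rho V kappa).
Local Notation scalar_solution := (scalar_solution V kappa theta Phi).
Local Notation has_limit := (has_limit V kappa delta Phi).

(** Not a formality: it needs a solution through [p]. *)
Lemma flow_orbit_refl p : flow_orbit p p.
Proof.
have [d [r [M [d0 r0 H]]]] := local_existence V_C2 p.
have [|g [sg g0 _]] := H p; first by rewrite /dist2 !subrr expr0n/= !addr0.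
have dd : - d < 0 < d by rewrite oppr_lt0 d0.
by exists (- d), d, g, 0, 0.
Qed.

Lemma orbit_of_flow p q : orbit_of p = orbit_of q -> flow_orbit p q.
Proof. by move=> /orbit_of_eq ->; exact: flow_orbit_refl. Qed.

(** The property that singles out [0] as the origin of proper time on an orbit. *)
Definition blows_up g := forall M : R, \forall t \near 0^'+, M < K_ (g t).

(* Otherwise [g] would have the limit [f (s - t1)] at [0^'+], where [K] is finite. *)
Lemma blow_up_time g f T a b s t1 : is_solution 0 T g -> blows_up g ->
  is_solution a b f -> a < s < b -> 0 < t1 < T -> f s = g t1 -> s - t1 <= a.
Proof.
move=> sg bg sf sab t1T fg; rewrite leNgt; apply/negP => au.
(* [u] is the time of [f] that corresponds to the time [0] of [g]. *)
pose u := s - t1; move: (sab) (t1T) => /andP[as_ sb] /andP[t10 t1T'].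
have ub : u < b by rewrite /u; lra.
have /solution_continuous : solves_at f u by apply: sf; rewrite au ub.
move=> /(@continuous_comp _ _ _ f (@K_ R V)) /(_ (@K_continuous R V _)) ck.
have /cvgrPdist_lt/(_ _ ltr01) := ck.
move=> [d /= d0 dP].
have /near_at_right0P[e e0 eP] := bg (K_ (f u) + 1).
pose t := Num.min (d / 2) (Num.min (e / 2) (t1 / 2)).
have [td te tt1] : [/\ t <= d / 2, t <= e / 2 & t <= t1 / 2].
  by rewrite /t !ge_min !lexx !orbT.
have t0 : 0 < t by rewrite /t !lt_min !divr_gt0.
have gt : g t = f (t + u).
  apply: (@solution_unique _ _ V_C2 g (fun v => f (v + u)) 0 (Num.min T (b - u)) t1).
  - by move=> v; rewrite lt_min => /andP[v0 /andP[vT _]]; apply: sg; rewrite v0.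
  - move=> v; rewrite lt_min => /andP[v0 /andP[_ vb]].
    apply: solves_at_shift; apply: sf; apply/andP; split; first by rewrite /u in au *; lra.
    by lra.
  - by rewrite t10 lt_min t1T' /u; lra.
  - by rewrite t0 lt_min /u; apply/andP; split; [lra|apply/andP; split; lra].
  by rewrite /u addrC subrK.
have k1 : K_ (f u) + 1 < K_ (g t) by apply: eP; rewrite t0; lra.
have k2 : `|K_ (f u) - K_ (f (t + u))| < 1.
  apply: (dP (t + u)); rewrite /= opprD addrCA subrr addr0 normrN gtr0_norm//; lra.
by move: k2; rewrite -gt ltr_norml => /andP[? ?]; lra.
Qed.

(** Once the two curves have a common point [g u = h v], [blow_up_time] applied in both directions
    gives [u = v], and uniqueness of solutions does the rest. The common point is found on a
    solution [f] that joins [g t1] to [h t2]. *)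
Lemma blow_up_unique g h T T' t1 t2 t : is_solution 0 T g -> blows_up g ->
  is_solution 0 T' h -> blows_up h -> 0 < t1 < T -> 0 < t2 < T' ->
  orbit_of (g t1) = orbit_of (h t2) -> 0 < t -> t < T -> t < T' -> g t = h t.
Proof.
move=> sg bg sh bh t1T t2T e t0 tT tT'.
suff [u [uT uT' gu]] : exists u, [/\ 0 < u < T, 0 < u < T' & g u = h u].
  move: uT uT' => /andP[? ?] /andP[? ?].
  apply: (@solution_unique _ _ V_C2 g h 0 (Num.min T T') u).
  - by move=> v; rewrite lt_min => /andP[v0 /andP[vT _]]; apply: sg; rewrite v0.
  - by move=> v; rewrite lt_min => /andP[v0 /andP[_ vT]]; apply: sh; rewrite v0.
  - by rewrite lt_min; apply/andP; split => //; apply/andP.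
  - by rewrite lt_min t0 tT.
  - exact: gu.
suff [u [v [uT vT gu]]] : exists u v, [/\ 0 < u < T, 0 < v < T' & g u = h v].
  have h1 := blow_up_time sg bg sh vT uT (esym gu).
  have h2 := blow_up_time sh bh sg uT vT gu.
  have uv : u = v by apply/eqP; rewrite eq_le; apply/andP; split; lra.
  by exists u; split => //; rewrite ?{1}uv// -{1}uv.
have [a [b [f [s [r [sf sab rab fs fr]]]]]] := orbit_of_flow e.
move: (sab) (rab) (t1T) (t2T) => /andP[? ?] /andP[? ?] /andP[? ?] /andP[? ?].
have k1 := blow_up_time sg bg sf sab t1T fs.
have k2 := blow_up_time sh bh sf rab t2T fr.
(* By [k1] and [k2] both shifted curves reach back at least to the beginning [a] of [f], so the
   curve through the later of the two points also passes through the earlier one. *)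
have [sr|/ltW rs] := leP s r.
  have vT : 0 < s - (r - t2) < T' by apply/andP; split; lra.
  exists t1, (s - (r - t2)); split => //; rewrite -fs.
  have -> : h (s - (r - t2)) = (fun v => h (v + (t2 - r))) s by congr h; ring.
  apply: (@solution_unique _ _ V_C2 f (fun v => h (v + (t2 - r))) a (Num.min b (T' - (t2 - r))) r).
  - by move=> v; rewrite lt_min => /andP[av /andP[vb _]]; apply: sf; rewrite av.
  - move=> v; rewrite lt_min => /andP[av /andP[_ vT']].
    by apply: solves_at_shift; apply: sh; apply/andP; split; lra.
  - by rewrite lt_min; apply/andP; split; [lra|apply/andP; split; lra].
  - by rewrite lt_min; apply/andP; split; [lra|apply/andP; split; lra].
  by rewrite fr; congr h; ring.
have uT : 0 < r - (s - t1) < T by apply/andP; split; lra.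
exists (r - (s - t1)), t2; split => //; rewrite -fr.
have -> : g (r - (s - t1)) = (fun v => g (v + (t1 - s))) r by congr g; ring.
apply/esym/(@solution_unique _ _ V_C2 f (fun v => g (v + (t1 - s))) a (Num.min b (T - (t1 - s))) s).
- by move=> v; rewrite lt_min => /andP[av /andP[vb _]]; apply: sf; rewrite av.
- move=> v; rewrite lt_min => /andP[av /andP[_ vT']].
  by apply: solves_at_shift; apply: sg; apply/andP; split; lra.
- by rewrite lt_min; apply/andP; split; [lra|apply/andP; split; lra].
- by rewrite lt_min; apply/andP; split; [lra|apply/andP; split; lra].
by rewrite fs; congr g; ring.
Qed.

Lemma ln_small (M : R) : \forall t \near 0^'+, ln t < M.
Proof.
apply/near_at_right0P; exists (expR M); first exact: expR_gt0.
move=> t /andP[t0 tM]; rewrite -[M]expRK; rewrite ltr_ln ?posrE ?expR_gt0//.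
Qed.

(** [3 * t * eps_V t] is the value of [rho] on the massless solution with [w = 0], that is
    [K = 1 / t]. *)
Lemma eps_V_vanishes e : 0 < e -> \forall t \near 0^'+, 0 <= eps_V V t /\ t * eps_V V t <= e.
Proof.
move=> e0; have [s Ps sP] := rho_cst_vanishes kappa0 delta0 theta1 V_derive V_pos V_growth 0 e0.
near=> t.
have t0 : 0 < t by near: t; exact: nbhs_right_gt.
have lt : ln t < - (kappa * s) by near: t; exact: ln_small.
pose s' := - kappa^-1 * ln t.
have ss' : s <= s'.
  rewrite /s' mulNr -mulrN mulrC ler_pdivlMr// mulrC -lerN2 opprK.
  exact: ltW.
have -> : eps_V V t = t * V s' by rewrite /eps_V kappaV.
have Vs := V_pos (le_trans Ps ss').
split; first by rewrite mulr_ge0 ?ltW.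
have := sP s' ss'; rewrite rhoE add0r /s'.
have -> : - (kappa * (- kappa^-1 * ln t)) = ln t by field; rewrite gt_eqF.
rewrite lnK ?posrE// -/s' => h; apply: le_trans h.
have -> : 3 * V s' * t ^+ 2 = t * (t * V s') + 2 * (t * (t * V s')) by ring.
by rewrite lerDl mulr_ge0// mulr_ge0 ?ltW// mulr_gt0.
Unshelve. all: by end_near. Qed.

(** The consequences of the error bounds that are used later. As [t * eps_V t] tends to zero, the
    errors of [K] and [phidot] are small compared with [1 / t], so [K] and [phi] tend to infinity
    and [y] to [-1]. *)
Lemma asymptotic_approach c o : 0 < c -> asymptotic_to_massless c o -> exists T g,
  [/\ 0 < T, is_solution 0 T g & forall t, 0 < t < T -> orbit_of (g t) = o] /\
  [/\ blows_up g, (forall M, \forall t \near 0^'+, M < phi_ (g t)),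
     (forall e, 0 < e -> \forall t \near 0^'+, `|phi_ (g t) - massless_phi c t| < e) &
     (forall e, 0 < e -> \forall t \near 0^'+,
        `|Num.sqrt (3 / 2) * phidot_ (g t) / K_ (g t) + 1| < e)].
Proof.
move=> c0 [T [g [[T0 sg] og]]].
move=> /eqO_at_right0P[k1 [r1 [k10 r10 H1]]] /eqO_at_right0P[k2 [r2 [k20 r20 H2]]].
move=> /eqO_at_right0P[k3 [r3 [k30 r30 H3]]].
have nr1 : \forall t \near 0^'+, 0 < t < r1 by apply/near_at_right0P; exists r1.
have nr2 : \forall t \near 0^'+, 0 < t < r2 by apply/near_at_right0P; exists r2.
have nr3 : \forall t \near 0^'+, 0 < t < r3 by apply/near_at_right0P; exists r3.
have phi_close (e : R) : 0 < e -> \forall t \near 0^'+, `|phi_ (g t) - massless_phi c t| < e.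
  move=> e0; have e20 : 0 < e / (2 * k2) by rewrite divr_gt0// mulr_gt0.
  have ee : k2 * (e / (2 * k2)) = e / 2 by field; rewrite gt_eqF.
  apply: filterS2 nr2 (eps_V_vanishes e20) => t tr [v0 ve].
  move: (tr) => /andP[t0 _]; apply: (le_lt_trans (H2 t tr)).
  rewrite ger0_norm; last by rewrite mulr_ge0// ltW.
  by have := ler_wpM2l (ltW k20) ve; rewrite ee; lra.
have K_large : \forall t \near 0^'+, t^-1 / 2 <= K_ (g t).
  have e20 : 0 < 1 / (2 * k1) by rewrite divr_gt0// mulr_gt0.
  have ee : k1 * (1 / (2 * k1)) = 1 / 2 by field; rewrite gt_eqF.
  apply: filterS2 nr1 (eps_V_vanishes e20) => t tr [v0 ve].
  move: (tr) => /andP[t0 _]; have := H1 t tr; rewrite (ger0_norm v0) /massless_K.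
  have h : k1 * eps_V V t <= t^-1 / 2.
    rewrite -(ler_pM2l t0).
    have -> : t * (t^-1 / 2) = 1 / 2 by field; rewrite gt_eqF.
    by have := ler_wpM2l (ltW k10) ve; rewrite ee; lra.
  by rewrite ler_norml => /andP[? ?]; lra.
have inv_large (M : R) : \forall t \near 0^'+, M < t^-1 / 2.
  apply/near_at_right0P; exists (1 / (2 * (`|M| + 1))).
    by rewrite divr_gt0// mulr_gt0// ltr_wpDl.
  move=> t /andP[t0 tM]; apply: (@le_lt_trans _ _ `|M|); first exact: ler_norm.
  rewrite ltr_pdivlMr// -(ltr_pM2l t0) mulfV ?gt_eqF//.
  move: tM; rewrite ltr_pdivlMr ?mulr_gt0 ?ltr_wpDl//; lra.
exists T, g; split; first by split.
split => //.
- by move=> M; apply: filterS2 K_large (inv_large M) => t h1 h2; exact: lt_le_trans h1.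
(* Below this bound on [ln t] the massless field exceeds [M + 1]; the [1] allows for the error. *)
- move=> M; apply: filterS3 (phi_close 1 ltr01) nr1 (ln_small (ln c - kappa * (M + 1))).
  move=> t h1 /andP[t0 _] h2.
  have : M + 1 < massless_phi c t.
    rewrite /massless_phi kappaV ln_div ?posrE//.
    rewrite mulNr -mulrN mulrC ltr_pdivlMr// mulrC; lra.
  by move: h1; rewrite ltr_norml => /andP[? ?]; lra.
move=> e e0; pose C := 2 * (kappa * k3 + k1).
have C0 : 0 < C by rewrite mulr_gt0// addr_gt0// mulr_gt0.
have e20 : 0 < e / (2 * C) by rewrite divr_gt0// mulr_gt0.
have ee : C * (e / (2 * C)) = e / 2 by field; rewrite gt_eqF.
apply: filterS2 (filterI nr1 nr3) (filterI (eps_V_vanishes e20) K_large) => t [tr1 tr3] [[v0 ve] Kt].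
have [Kp _] := phase_constraint (g t); move: (tr1) => /andP[t0 _].
have h1 := H1 t tr1; have h3 := H3 t tr3.
rewrite (ger0_norm v0) /massless_K in h1.
rewrite (ger0_norm v0) /massless_phidot kappaV mulNr opprK in h3.
rewrite kappaE.
have -> : kappa * phidot_ (g t) / K_ (g t) + 1 =
  (kappa * (phidot_ (g t) + kappa^-1 * t^-1) + (K_ (g t) - t^-1)) / K_ (g t).
  by field; rewrite !gt_eqF.
rewrite normrM normfV (gtr0_norm Kp) ltr_pdivrMr//.
have a1 : `|kappa * (phidot_ (g t) + kappa^-1 * t^-1) + (K_ (g t) - t^-1)| <=
    (kappa * k3 + k1) * eps_V V t.
  apply: (le_trans (ler_normD _ _)); rewrite mulrDl; apply: lerD => //.
  by rewrite normrM gtr0_norm// -mulrA; apply: ler_wpM2l => //; exact: ltW.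
apply: (le_lt_trans a1); apply: (@lt_le_trans _ _ (e * (t^-1 / 2))); last first.
  by apply: ler_wpM2l => //; exact: ltW.
have := ler_wpM2l (ltW C0) ve; rewrite ee => ve'.
rewrite -(ltr_pM2l t0).
have -> : t * (e * (t^-1 / 2)) = e / 2 by field; rewrite gt_eqF.
have -> : t * ((kappa * k3 + k1) * eps_V V t) = C * (t * eps_V V t) / 2 by rewrite /C; field.
by lra.
Qed.

(** Both parametrisations blow up at time [0] and therefore coincide. The massless fields for [c]
    and [c'] differ by the constant [kappa^-1 * (ln c - ln c')], which must then be arbitrarily
    small. *)
Lemma asymptotic_constant_unique c c' o : 0 < c -> 0 < c' ->
  asymptotic_to_massless c o -> asymptotic_to_massless c' o -> c = c'.
Proof.
move=> c0 c0' /(asymptotic_approach c0)[T [g [[T0 sg og] [bg _ pg _]]]].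
move=> /(asymptotic_approach c0')[T' [h [[T0' sh oh] [bh _ ph _]]]].
have t1T : 0 < T / 2 < T by apply/andP; split; lra.
have t2T : 0 < T' / 2 < T' by apply/andP; split; lra.
have e : orbit_of (g (T / 2)) = orbit_of (h (T' / 2)) by rewrite og// oh.
suff : `|kappa^-1 * (ln c - ln c')| <= 0.
  rewrite normr_le0 mulf_eq0 invr_eq0 gt_eqF//= subr_eq0 => /eqP.
  by apply: ln_inj; rewrite posrE.
apply/ler_addgt0Pr => e' e0; rewrite add0r.
have e20 : 0 < e' / 2 by rewrite divr_gt0.
have nT : \forall t \near 0^'+, 0 < t < T by apply/near_at_right0P; exists T.
have nT' : \forall t \near 0^'+, 0 < t < T' by apply/near_at_right0P; exists T'.
have [t []] : exists t, [/\ 0 < t < T, 0 < t < T',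
    `|phi_ (g t) - massless_phi c t| < e' / 2 & `|phi_ (h t) - massless_phi c' t| < e' / 2].
  apply: (@filter_ex _ (0^'+)).
  by apply: filterS2 (filterI nT nT') (filterI (pg _ e20) (ph _ e20)) => t [? ?] [? ?]; split.
move=> /andP[t0 tT] /andP[_ tT'] h1 h2.
rewrite (blow_up_unique sg bg sh bh t1T t2T e t0 tT tT') in h1.
move: h1 h2; rewrite /massless_phi kappaV !ln_div ?posrE// !ltr_norml ler_norml.
by move=> /andP[? ?] /andP[? ?]; apply/andP; split; lra.
Qed.

(** The dependent variable [w] of the scalar equation, as a function on phase space. *)
Definition log_K p := ln (K_ p) - kappa * phi_ p.

Lemma K_log p : K_ p = (expR (- (log_K p + kappa * phi_ p)))^-1.
Proof.
have [K0 _] := phase_constraint p.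
by rewrite /log_K subrK expRN invrK lnK.
Qed.

Lemma rho_log p : rho (phi_ p) (log_K p) = 1 - (kappa * phidot_ p / K_ p) ^+ 2.
Proof.
have [K0 cp] := phase_constraint p.
have e : expR (- (log_K p + kappa * phi_ p)) = (K_ p)^-1 by rewrite [in RHS]K_log invrK.
rewrite rhoE e; have -> : 3 * V (phi_ p) = K_ p ^+ 2 - 3 / 2 * phidot_ p ^+ 2.
  by rewrite cp; ring.
rewrite -kappa2; field; by rewrite gt_eqF.
Qed.

(** The constraint determines [phidot] up to its sign. *)
Lemma contracting_eq p q : phidot_ p < 0 -> phidot_ q < 0 ->
  phi_ p = phi_ q -> K_ p = K_ q -> p = q.
Proof.
move=> p0 q0 ep eK; apply: phase_ext => //.
have [_ cp] := phase_constraint p; have [_ cq] := phase_constraint q.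
have : phidot_ p ^+ 2 = phidot_ q ^+ 2 by rewrite eK ep in cp; lra.
move/eqP; rewrite eqf_sqr => /orP[/eqP//|/eqP e].
by move: p0; rewrite e oppr_lt0 => h; have := lt_trans h q0; rewrite ltxx.
Qed.

(** The points where the truncated scalar equation describes the system: neither the freezing below
    [Phi] nor the truncation at [theta] is active. *)
Definition early p := [/\ Phi < phi_ p, phidot_ p < 0 &
  rho (phi_ p) (log_K p) < 1 - theta ^+ 2].

Lemma early_point s w : Phi < s -> rho s w < 1 - theta ^+ 2 ->
  exists p, [/\ early p, phi_ p = s, log_K p = w,
    K_ p = expR (w + kappa * s) &
    phidot_ p = - (kappa^-1 * Num.sqrt (expR (w + kappa * s) ^+ 2 - 3 * V s))].
Proof.
move=> Ps rs; have t2 : 0 < theta ^+ 2 by rewrite exprn_gt0.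
set K := expR (w + kappa * s); have K0 : 0 < K := expR_gt0 _.
have rE : rho s w = 3 * V s / K ^+ 2.
  by rewrite rhoE expRN -/K; field; rewrite gt_eqF.
have d0 : 0 < K ^+ 2 - 3 * V s.
  have : rho s w < 1 by lra.
  by rewrite rE ltr_pdivrMr ?exprn_gt0// mul1r subr_gt0.
have [|p [p1 p2 p3]] := @phase_point R V s (- (kappa^-1 * Num.sqrt (K ^+ 2 - 3 * V s))) K K0.
  by rewrite sqrrN exprMn exprVn kappa2 sqr_sqrtr ?ltW//; field.
have lK : log_K p = w by rewrite /log_K p3 p1 /K expRK addrK.
exists p; split => //; split; rewrite ?p1 ?lK//.
by rewrite p2 oppr_lt0 mulr_gt0 ?invr_gt0// sqrtr_gt0.
Qed.

(** [p] lies on the arc built from [x], and so does every later contracting point on the graph of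
    [x]. The constant is read off from [phi] being close to [- kappa^-1 * (ln t + l)]. *)
Lemma early_orbit p x l : early p -> scalar_solution x -> has_limit x l ->
  x (phi_ p) = log_K p -> asymptotic_to_massless (expR (- l)) (orbit_of p) /\
  forall q, phi_ p <= phi_ q -> phidot_ q < 0 -> log_K q = x (phi_ q) ->
    orbit_of q = orbit_of p.
Proof.
move=> [Pp p0 rp] sx lx xp.
(* The arc has to start strictly before [p], to contain [p] at an interior time. *)
have [s0 [Ps0 s0p rs0]] : exists s0, [/\ Phi < s0, s0 < phi_ p & rho s0 (x s0) < 1 - theta ^+ 2].
  have cr : {for phi_ p, continuous (fun s => rho s (x s))}.
    exact: is_derive_continuous (scalar_solution_rho V_derive (phi_ p) sx).
  have rp' : rho (phi_ p) (x (phi_ p)) < 1 - theta ^+ 2 by rewrite xp.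
  have /(cvgr_lt _ cr) [d /= d0 dP] := rp'.
  exists (phi_ p - Num.min (d / 2) ((phi_ p - Phi) / 2)); split.
  - have : Num.min (d / 2) ((phi_ p - Phi) / 2) <= (phi_ p - Phi) / 2 by rewrite ge_min lexx orbT.
    lra.
  - by rewrite gtrBl lt_min !divr_gt0// subr_gt0.
  apply: dP => /=; rewrite opprB addrCA subrr addr0 ger0_norm.
    by apply: (@le_lt_trans _ _ (d / 2)); [rewrite ge_min lexx|lra].
  by rewrite ltW// lt_min !divr_gt0// subr_gt0.
have [tau [dtau tauE]] := time_exists kappa0 delta0 theta0 theta1 V_derive V_pos V_growth sx.
have [g [sg gP]] := arc_solution kappa0 kappa2 delta0 theta0 V_derive V_pos V_growth sx dtau tauE p Ps0 rs0.
have tau0 := tau_gt0 kappa0 delta0 theta0 V_derive V_pos V_growth sx dtau tauE.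
have tdec := tau_decreasing kappa0 theta0 dtau.
have sp s : 0 < speed V kappa theta Phi s (x s).
  exact: lt_le_trans theta0 (speed_ge V kappa Phi theta0 s (x s)).
have on_arc q : s0 < phi_ q -> phidot_ q < 0 -> log_K q = x (phi_ q) -> q = g (tau (phi_ q)).
  move=> sq q0 lq; have [g1 g2 g3] := gP _ sq.
  apply: contracting_eq => //.
    by rewrite g2 oppr_lt0 divr_gt0// mulr_gt0// expR_gt0.
  by rewrite g3 -lq -K_log.
have pg := on_arc p s0p p0 (esym xp).
have tT s : s0 < s -> 0 < tau s < tau s0 by move=> ss; rewrite tau0 tdec.
have orb q : phi_ p <= phi_ q -> phidot_ q < 0 -> log_K q = x (phi_ q) ->
    orbit_of q = orbit_of p.
  move=> pq q0 lq; have sq := lt_le_trans s0p pq.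
  rewrite (on_arc q sq q0 lq) {1}pg.
  exact: solution_orbit sg (tT _ sq) (tT _ s0p).
split => //.
have [psi [psiP _]] := tau_inverse kappa0 delta0 theta0 V_derive V_pos V_growth sx dtau tauE s0.
have [C [r [C0 r0 H]]] := arc_asymptotics kappa0 kappaV delta0 theta0 theta1 V_derive
  V_pos V_growth V_log_lipschitz sx lx dtau tauE.
have bounds t : 0 < t < Num.min r (tau s0) ->
  [/\ `|K_ (g t) - massless_K t| <= C * `|eps_V V t|,
     `|phi_ (g t) - massless_phi (expR (- l)) t| <= C * `|t * eps_V V t| &
     `|phidot_ (g t) - massless_phidot t| <= C * `|eps_V V t|].
  rewrite lt_min => /andP[t0 /andP[tr ts]].
  have [|ss ts'] := psiP t; first by rewrite t0.
  have [g1 g2 g3] := gP _ ss; have Ps := ltW (lt_trans Ps0 ss).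
  have := H _ Ps; rewrite ts' => /(_ tr)[h1 h2 h3]; rewrite ts' in g1 g2 g3.
  rewrite g1 g2 g3 /massless_K /massless_phi /massless_phidot kappaV.
  have -> : ln (t / expR (- l)) = ln t + l by rewrite ln_div ?posrE ?expR_gt0// expRK opprK.
  split.
  - by apply: (le_trans h1); apply: ler_wpM2l; [exact: ltW|exact: ler_norm].
  - rewrite mulNr opprK; apply: (le_trans h2).
    by apply: ler_wpM2l; [exact: ltW|exact: ler_norm].
  rewrite mulNr opprK; apply: (le_trans h3).
  by apply: ler_wpM2l; [exact: ltW|exact: ler_norm].
have m0 : 0 < Num.min r (tau s0) by rewrite lt_min r0 tau0.
exists (tau s0), g; split.
- by split.
- by move=> t t0; rewrite pg; exact: solution_orbit sg t0 (tT _ s0p).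
- by apply/eqO_at_right0P; exists C, (Num.min r (tau s0)); split => // t /bounds[].
- by apply/eqO_at_right0P; exists C, (Num.min r (tau s0)); split => // t /bounds[].
- by apply/eqO_at_right0P; exists C, (Num.min r (tau s0)); split => // t /bounds[].
Qed.

Variable lim : R -> R -> R.
Hypothesis limP : forall s w,
  exists x, [/\ scalar_solution x, x s = w & has_limit x (lim s w)].

Lemma early_asymptotic p : early p ->
  asymptotic_to_massless (expR (- lim (phi_ p) (log_K p))) (orbit_of p).
Proof.
move=> ep; have [x [sx xs lx]] := limP (phi_ p) (log_K p).
exact: (early_orbit ep sx lx xs).1.
Qed.

(** The hypothesis says [y < - theta], which makes [phidot] negative and [rho = 1 - y^2] less than
    [1 - theta^2]. *)
Lemma early_of_direction p : Phi < phi_ p ->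
  `|Num.sqrt (3 / 2) * phidot_ p / K_ p + 1| < 1 - theta -> early p.
Proof.
have t0 := theta0; rewrite kappaE => Pp; rewrite ltr_norml => /andP[_ y1].
have [K0 _] := phase_constraint p.
have y0 : kappa * phidot_ p / K_ p < - theta by lra.
split => //.
  have : kappa * phidot_ p / K_ p < 0 by lra.
  by rewrite pmulr_llt0 ?invr_gt0// pmulr_rlt0.
rewrite rho_log ltrD2l ltrN2 -[X in _ < X]sqrrN.
by rewrite ltr_pXn2r ?nnegrE//; lra.
Qed.

Lemma early_exists c o M e : 0 < c -> asymptotic_to_massless c o -> 0 < e ->
  exists p, [/\ early p, orbit_of p = o, M < phi_ p &
    `|Num.sqrt (3 / 2) * phidot_ p / K_ p + 1| < e].
Proof.
move=> c0 /(asymptotic_approach c0)[T [g [[T0 sg og] [_ pM _ yP]]]] e0.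
have nT : \forall t \near 0^'+, 0 < t < T by apply/near_at_right0P; exists T.
have m0 : 0 < Num.min e (1 - theta) by rewrite lt_min e0 subr_gt0.
have [t [tT tM ty]] : exists t, [/\ 0 < t < T, Num.max M Phi < phi_ (g t) &
    `|Num.sqrt (3 / 2) * phidot_ (g t) / K_ (g t) + 1| < Num.min e (1 - theta)].
  apply: (@filter_ex _ (0^'+)).
  by apply: filterS3 nT (pM (Num.max M Phi)) (yP _ m0) => t ? ? ?; split.
move: tM ty; rewrite gt_max lt_min => /andP[tM tP] /andP[te tt].
by exists (g t); split => //; [exact: early_of_direction|exact: og].
Qed.

(** On early points [lim] is a coordinate on the set of orbits. *)
Lemma early_coordinate c p : 0 < c -> early p -> asymptotic_to_massless c (orbit_of p) ->
  lim (phi_ p) (log_K p) = - ln c.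
Proof.
move=> c0 ep ap.
have := asymptotic_constant_unique c0 (expR_gt0 _) ap (early_asymptotic ep).
by move=> ->; rewrite expRK opprK.
Qed.

Lemma lim_expanding s w w' : Phi <= s -> `|w - w'| <= `|lim s w - lim s w'|.
Proof.
move=> Ps; have [x [sx xs lx]] := limP s w; have [y [sy ys ly]] := limP s w'.
have [+ _] := scalar_solution_compare kappa0 delta0 theta0 theta1 V_derive V_pos V_growth
  sx sy lx ly Ps.
by rewrite xs ys.
Qed.

(** Both orbits give scalar solutions with the limit [- ln c]. Distances cannot decrease in [phi],
    so the two solutions agree at the larger of the two values of [phi], and the early point [r]
    there lies on both orbits. *)
Lemma asymptotic_orbit_unique c o o' : 0 < c ->
  asymptotic_to_massless c o -> asymptotic_to_massless c o' -> o = o'.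
Proof.
move=> c0 ao ao'.
have [p [ep po _ _]] := early_exists 0 c0 ao ltr01.
have [q [eq qo _ _]] := early_exists 0 c0 ao' ltr01.
rewrite -po in ao; rewrite -qo in ao'.
have lp := early_coordinate c0 ep ao; have lq := early_coordinate c0 eq ao'.
have [x [sx xs lx]] := limP (phi_ p) (log_K p); rewrite lp in lx.
have [y [sy ys ly]] := limP (phi_ q) (log_K q); rewrite lq in ly.
have [_ orbp] := early_orbit ep sx lx xs; have [_ orbq] := early_orbit eq sy ly ys.
have [Pp _ rp] := ep; have [Pq _ _] := eq.
pose s := Num.max (phi_ p) (phi_ q).
have [ps qs] : phi_ p <= s /\ phi_ q <= s by rewrite /s !le_max !lexx orbT.
have Ps : Phi < s by exact: lt_le_trans ps.
have xy : x s = y s.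
  have [+ _] := scalar_solution_compare kappa0 delta0 theta0 theta1 V_derive V_pos V_growth
    sx sy lx ly (ltW Ps).
  by rewrite subrr normr0 normr_le0 subr_eq0 => /eqP.
have rs : rho s (x s) < 1 - theta ^+ 2.
  apply: le_lt_trans rp; rewrite -xs.
  exact: (rho_nonincreasing kappa0 delta0 theta0 V_derive V_pos V_growth sx (ltW Pp) ps).
have [r [er rphi rw _ _]] := early_point Ps rs; have [_ r0 _] := er.
rewrite -po -qo -(orbp r) ?rphi//; first by apply: orbq; rewrite ?rphi// rw.
Qed.

(** A local section of the orbit map: for [c] near [c0], representatives on one hypersurface
    [phi = s]. *)
Lemma asymptotic_section c0 : 0 < c0 -> exists2 s, Phi < s & forall c, 0 < c ->
  `|ln c - ln c0| <= 1 / 2 -> exists p w,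
  [/\ phi_ p = s, asymptotic_to_massless c (orbit_of p), lim s w = - ln c,
    K_ p = expR (w + kappa * s) &
    phidot_ p = - (kappa^-1 * Num.sqrt (expR (w + kappa * s) ^+ 2 - 3 * V s))].
Proof.
move=> c00.
have [s Ps sP] := lim_surjective kappa0 delta0 theta0 theta1 V_derive V_pos V_growth limP (- ln c0).
exists s => // c cpos cc.
have [|w lw rw] := sP (- ln c); first by rewrite opprK addrC distrC.
have [p [ep p1 p2 p3 p4]] := early_point Ps rw; exists p, w; split => //.
have := early_asymptotic ep; rewrite p1 p2 lw opprK lnK//.
Qed.

Lemma asymptotic_orbit_exists c : 0 < c -> exists o, asymptotic_to_massless c o.
Proof.
move=> c0; have [s _ sP] := asymptotic_section c0.
have [|p [w [_ ap _ _ _]]] := sP c c0; last by exists (orbit_of p).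
by rewrite subrr normr0 divr_ge0.
Qed.

(** By [lim_expanding] the [w] of the section is [1]-Lipschitz in [ln c], and the other coordinates
    are continuous in [w]. Nearby constants thus have nearby representatives in the open preimage of
    [A]. *)
Lemma asymptotic_orbit_continuous c0 o0 (A : set (orbit_space V)) : 0 < c0 ->
  asymptotic_to_massless c0 o0 -> open A -> A o0 ->
  exists2 e, 0 < e & forall c o, 0 < c -> `|ln c - ln c0| < e ->
    asymptotic_to_massless c o -> A o.
Proof.
move=> c00 ao0 oA Ao0.
have [s Ps sP] := asymptotic_section c00.
have [|p0 [w0 [p01 p02 p03 p04 p05]]] := sP c0 c00; first by rewrite subrr normr0 divr_ge0.
have oP : open ((@orbit_of R V) @^-1` A).
  exact: oA.
have /nbhs_phaseP[r r0 rP] : nbhs p0 ((@orbit_of R V) @^-1` A).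
  apply: open_nbhs_nbhs; split => //=.
  by rewrite (asymptotic_orbit_unique c00 p02 ao0).
have r30 : 0 < r / 3 by lra.
pose Kw w := expR (w + kappa * s).
pose vw w := - (kappa^-1 * Num.sqrt (Kw w ^+ 2 - 3 * V s)).
have cK : {for w0, continuous Kw}.
  apply: (@continuous_comp _ _ _ (fun w => w + kappa * s) expR); last exact: continuous_expR.
  by apply: (@continuousD _ _ _ id (cst (kappa * s))) => //; exact: cst_continuous.
have cv : {for w0, continuous vw}.
  apply: (@continuousN _ _ _ (fun w => kappa^-1 * Num.sqrt (Kw w ^+ 2 - 3 * V s))).
  apply: (@continuousM _ _ (cst kappa^-1) (fun w => Num.sqrt (Kw w ^+ 2 - 3 * V s))).
    exact: cst_continuous.
  apply: (@continuous_comp _ _ _ (fun w => Kw w ^+ 2 - 3 * V s) Num.sqrt);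
    last exact: sqrt_continuous.
  apply: (@continuousB _ _ _ (fun w => Kw w ^+ 2) (cst (3 * V s))); last exact: cst_continuous.
  exact: (@continuousM _ _ Kw Kw).
have [d /= d0 dP] := filterI (sqr_sub_near cK r30) (sqr_sub_near cv r30).
exists (Num.min d (1 / 2)); first by rewrite lt_min d0 divr_gt0.
move=> c o cpos; rewrite lt_min => /andP[cd c2] ao.
have [p [w [p1 p2 p3 p4 p5]]] := sP c cpos (ltW c2).
rewrite -(asymptotic_orbit_unique cpos p2 ao); apply: rP.
have ww : `|w0 - w| < d.
  apply: le_lt_trans cd; have := lim_expanding w0 w (ltW Ps).
  by rewrite p03 p3 opprK [- ln c0 + _]addrC.
have [/= k1 k2] := dP w ww.
rewrite /dist2 p1 p01 p4 p04 p5 p05 -/(Kw w) -/(Kw w0) -/(vw w) -/(vw w0).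
by rewrite subrr expr0n/= add0r; lra.
Qed.

Lemma log_K_continuous : continuous log_K.
Proof.
move=> p; have [K0 _] := phase_constraint p.
apply: (@continuousB _ _ _ (fun p => ln (K_ p)) (fun p => kappa * phi_ p)).
  apply: (@continuous_comp _ _ _ (@K_ R V) (@ln R)); first exact: K_continuous.
  exact: continuous_ln.
apply: (@continuousM _ _ (cst kappa) (@phi_ R V)); first exact: cst_continuous.
exact: phi_continuous.
Qed.

(** The set is a union of orbits, and each of these contains an early point. There the constant is
    [expR (- lim)], continuous in the point, so the early point is interior; [interior_saturated]
    carries this to the rest of the orbit. *)
Lemma asymptotic_open (W : set R) : open W ->
  open [set p : phase V | exists c, [/\ W c, 0 < c & asymptotic_to_massless c (orbit_of p)]].
Proof.
move=> oW; set S := [set p | _]; rewrite openE => p [c [Wc c0 ap]].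
have [p1 [ep1 op1 _ _]] := early_exists 0 c0 ap ltr01.
have [a [b [g [s [t [sg sab tab gs gt]]]]]] := orbit_of_flow op1.
rewrite -gt; apply: (interior_saturated V_C2 _ sg sab tab).
  by move=> q q' e [c' [Wc' c0' aq]]; exists c'; split => //; rewrite -e.
rewrite gs; have [P1 v1 r1] := ep1.
have cphi := @phi_continuous R V p1; have cw := @log_K_continuous p1.
have clim := lim_continuous_comp kappa0 delta0 theta0 theta1 V_derive V_pos V_growth limP
  cphi cw P1.
have n1 : \forall q \near p1, Phi < phi_ q by exact: (cvgr_gt _ cphi).
have n2 : \forall q \near p1, phidot_ q < 0 by exact: (cvgr_lt _ (@phidot_continuous R V p1)).
have n3 : \forall q \near p1, rho (phi_ q) (log_K q) < 1 - theta ^+ 2.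
  exact: (cvgr_lt _ (rho_continuous_comp V_derive cphi cw)).
have n4 : \forall q \near p1, W (expR (- lim (phi_ q) (log_K q))).
  have ce : {for p1, continuous (fun q => expR (- lim (phi_ q) (log_K q)))}.
    apply: (@continuous_comp _ _ _ (fun q => - lim (phi_ q) (log_K q)) expR);
      last exact: continuous_expR.
    exact: (@continuousN _ _ _ (fun q => lim (phi_ q) (log_K q))).
  apply: ce; apply: open_nbhs_nbhs; split => //=.
  rewrite -op1 in ap; rewrite (early_coordinate c0 ep1 ap) opprK lnK//.
apply: filterS2 (filterI n1 n2) (filterI n3 n4) => q [q1 q2] [q3 q4].
exists (expR (- lim (phi_ q) (log_K q))); split => //; first exact: expR_gt0.
by apply: early_asymptotic; split.
Qed.

(** * Neighbourhoods of [p_-] and the homeomorphism *)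

Variables (f : R -> R) (phi0 eps : R).
Hypothesis f_vanishes : f phi @[phi --> +oo] --> (0 : R).
Hypothesis f_decreasing : forall x y, phi0 <= x -> x < y -> f y < f x.
Hypotheses (phi0_eps : phi0 <= eps^-1) (eps_Phi : eps^-1 <= Phi).

Definition early_directions : set (R * R) :=
  [set yz | `|yz.1 + 1| < 1 - theta /\ yz.2 < f Phi].

Lemma f_Phi_gt0 : 0 < f Phi.
Proof.
have P0 := le_trans phi0_eps eps_Phi; rewrite ltNge; apply/negP => fP.
have f1 : f (Phi + 1) < f Phi by apply: f_decreasing => //; rewrite ltrDl.
have e0 : 0 < - f (Phi + 1) by rewrite oppr_gt0; exact: lt_le_trans fP.
have /cvgrPdist_lt/(_ _ e0)[M [_ MP]] := f_vanishes.
pose s := Num.max M (Phi + 1) + 1.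
have [s1 s2] : M < s /\ Phi + 1 < s.
  by split; (apply: (@le_lt_trans _ _ (Num.max M (Phi + 1)));
    [rewrite le_max lexx ?orbT|rewrite /s ltrDl]).
have fs : f s < f (Phi + 1) by apply: f_decreasing => //; rewrite (le_trans P0)// lerDl.
have := MP s s1; rewrite sub0r normrN ltr_norml => /andP[? ?]; lra.
Qed.

Lemma early_directions_nbhs : nbhs p_minus early_directions.
Proof.
have t1 : 0 < 1 - theta by rewrite subr_gt0.
exists ([set y | `|y + 1| < 1 - theta], [set z | z < f Phi]) => /=; last by move=> [y z] [].
split.
  exists (1 - theta) => // y /=; have -> : -1 - y = - (y + 1) by ring.
  by rewrite normrN.
by apply: lt_nbhsl; exact: f_Phi_gt0.
Qed.

Lemma early_directions_early p : eps^-1 < phi_ p -> early_directions (yz f p) -> early p.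
Proof.
move=> ep [y1 /= fp]; apply: early_of_direction => //.
rewrite ltNge; apply/negP; rewrite le_eqVlt => /orP[/eqP pP|pP].
  by move: fp; rewrite pP ltxx.
have := f_decreasing (le_trans phi0_eps (ltW ep)) pP => h.
by have := lt_trans h fp; rewrite ltxx.
Qed.

(** The right-hand side does not mention [Nb]: all small neighbourhoods meet the same orbits. Points
    of [Nb] are early, and conversely an asymptotically massless orbit enters every neighbourhood of
    [p_-]. *)
Lemma orbits_meetingE (Nb : set (R * R)) : nbhs p_minus Nb -> Nb `<=` early_directions ->
  forall o, orbits_meeting V f eps Nb o <-> exists2 c, 0 < c & asymptotic_to_massless c o.
Proof.
move=> nNb sNb o; split.
  move=> [p [<- ep /sNb dp]]; have ep' := early_directions_early ep dp.
  exists (expR (- lim (phi_ p) (log_K p))); first exact: expR_gt0.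
  exact: early_asymptotic.
move=> [c c0 ao]; case: nNb => -[A B] /= [[d /= d0 dA] [d' /= d0' dB]] AB.
have /cvgrPdist_lt/(_ _ d0')[M [_ MP]] := f_vanishes.
have [p [ep po pM py]] := early_exists (Num.max M eps^-1) c0 ao d0.
move: pM; rewrite gt_max => /andP[pM pe]; exists p; split => //.
apply: AB; split => /=; first by apply: dA; rewrite /= -opprB normrN opprK.
by apply: dB; exact: MP.
Qed.

(** Both maps are chosen from existence statements; uniqueness of the orbit and of the constant
    makes them mutually inverse. Since both sides carry subspace topologies, continuity is checked
    after [set_val]. *)
Lemma orbits_meeting_homeomorphic (Nb : set (R * R)) :
  nbhs p_minus Nb -> Nb `<=` early_directions ->
  exists h : set_type (`]0, +oo[%classic : set R) ->
             set_type (orbits_meeting V f eps Nb),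
    homeomorphism h /\
    forall c : set_type (`]0, +oo[%classic : set R),
      asymptotic_to_massless (set_val c) (set_val (h c)) /\
      forall o, asymptotic_to_massless (set_val c) o -> o = set_val (h c).
Proof.
move=> nNb sNb; have meetE := orbits_meetingE nNb sNb.
set D := set_type _; set E := set_type _.
have D0 (c : D) : 0 < set_val c.
  by have := set_mem (valP c); rewrite set_valE /= in_itv /= andbT.
have /choice[h hP] : forall c : D, exists o : E,
    asymptotic_to_massless (set_val c) (set_val o).
  move=> c; have [u au] := asymptotic_orbit_exists (D0 c).
  have uM : u \in orbits_meeting V f eps Nb.
    by apply: mem_set; apply/meetE; exists (set_val c).
  by exists (exist (fun o => o \in orbits_meeting V f eps Nb) u uM); move: au; rewrite !set_valE.
have /choice[h' h'P] : forall o : E, exists c : D,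
    asymptotic_to_massless (set_val c) (set_val o).
  move=> o; have /meetE[c c0 ac] := set_mem (valP o).
  have cM : c \in (`]0, +oo[%classic : set R) by apply: mem_set; rewrite /= in_itv /= c0.
  by exists (exist (fun c => c \in (`]0, +oo[%classic : set R)) c cM); rewrite !set_valE.
exists h; split; last first.
  move=> c; split; first exact: hP.
  by move=> o ao; exact: asymptotic_orbit_unique (D0 c) ao (hP c).
split.
  apply: (@continuous_comp_initial _ _ _ set_val h) => c A; rewrite nbhsE => -[B [oB Bc] BA].
  have [e e0 eP] := asymptotic_orbit_continuous (D0 c) (hP c) oB Bc.
  have cl : {for c, continuous (fun c : D => ln (set_val c))}.
    apply: (@continuous_comp _ _ _ (set_val : D -> R) (@ln R)).
      exact: initial_continuous.
    exact: continuous_ln.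
  have /cvgrPdist_lt/(_ _ e0) := cl; apply: filterS => c' cc'.
  by apply: BA; apply: (eP (set_val c') _ (D0 c') _ (hP c')); rewrite distrC.
exists h'; split.
- move=> c; apply: val_inj; rewrite -!set_valE.
  exact: asymptotic_constant_unique (D0 _) (D0 _) (h'P (h c)) (hP c).
- move=> o; apply: val_inj; rewrite -!set_valE.
  exact: asymptotic_orbit_unique (D0 (h' o)) (hP (h' o)) (h'P o).
apply: (@continuous_comp_initial _ _ _ set_val h') => o A; rewrite nbhsE => -[B [oB Bc] BA].
pose Q := [set o : orbit_space V | exists c, [/\ B c, 0 < c & asymptotic_to_massless c o]].
have oQ : open Q by exact: (asymptotic_open oB).
have nQ : nbhs (set_val o) Q.
  by apply: open_nbhs_nbhs; split => //; exists (set_val (h' o)); split => //; exact: D0.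
have nE : \forall o' \near o, Q (set_val o') by exact: (@initial_continuous E _ set_val o _ nQ).
apply: filterS nE => o' [c [Bc' c0 ac]].
apply: BA => /=.
by rewrite -(asymptotic_constant_unique c0 (D0 _) ac (h'P o')).
Qed.

End Orbits.

Theorem theorem5 (R : realType) (V : R -> R) (N : R)
  (hV : class_WBI 2 V N) (hN : N ^+ 2 < 6)
  (phi0 : R) (f : R -> R) (hf : WBI_chart 2 V N phi0 f)
  (eps : R) (heps : 0 < eps) (hphi0 : phi0 <= eps^-1)
  (hpos : forall phi : R, eps^-1 <= phi -> 0 < V phi) :
  exists2 U : set (R * R), nbhs p_minus U &
    forall Nb : set (R * R), nbhs p_minus Nb -> Nb `<=` U ->
    exists h : set_type (`]0, +oo[%classic : set R) ->
               set_type (orbits_meeting V f eps Nb),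
      homeomorphism h /\
      forall c : set_type (`]0, +oo[%classic : set R),
        asymptotic_to_massless (set_val c) (set_val (h c)) /\
        forall o : orbit_space V,
          asymptotic_to_massless (set_val c) o -> o = set_val (h c).
Proof.
have [V_C2 [_ _ [phi1 [_ _ W0]]] _] := hV.
have [_ [_ f_vanishes] [_ f_decreasing] _ _] := hf.
pose kappa : R := Num.sqrt (3 / 2).
have kappa0 : 0 < kappa by rewrite sqrtr_gt0 divr_gt0.
have kappa2 : kappa ^+ 2 = 3 / 2 by rewrite sqr_sqrtr// divr_ge0.
have kappaV : Num.sqrt (2 / 3) = kappa^-1.
  by rewrite /kappa -sqrtrV ?divr_ge0// invf_div.
have [N1 N2] : - (2 * kappa) < N /\ N < 2 * kappa.
  have : `|N| < 2 * kappa.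
    have k20 : 0 <= 2 * kappa by rewrite mulr_ge0// ltW.
    rewrite ltNge; apply/negP => h.
    have : (2 * kappa) ^+ 2 <= `|N| ^+ 2 by rewrite ler_pXn2r ?nnegrE.
    by rewrite real_normK ?num_real// exprMn kappa2; lra.
  by rewrite ltr_norml => /andP[].
(* The gap [4 * delta] between [N] and [2 * kappa] is used up as follows: [2 * delta] by [theta],
   since [2 * kappa * theta = 2 * kappa - 2 * delta]; [delta] by the oscillation of [V' / V] around
   [N]; and [delta] is left as decay rate of [rho]. That [theta] is positive amounts to
   [N > - 2 * kappa]. *)
pose delta := (2 * kappa - N) / 4.
have delta0 : 0 < delta by rewrite /delta; lra.
pose theta := 1 - delta / kappa.
have kt : kappa * theta = kappa - delta by rewrite /theta; field; rewrite gt_eqF.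
have theta0 : 0 < theta.
  by rewrite -(pmulr_rgt0 _ kappa0) kt /delta; lra.
have theta1 : theta < 1 by rewrite /theta gtrBl divr_gt0.
have /cvgrPdist_lt/(_ _ delta0)[M [_ MP]] := W0.
(* [MP] holds strictly beyond [M], whence [M + 1]. *)
pose Phi := Num.max (M + 1) eps^-1.
have [P1 P2] : M + 1 <= Phi /\ eps^-1 <= Phi by rewrite /Phi !le_max !lexx orbT.
have V_pos x : Phi <= x -> 0 < V x by move=> Px; apply: hpos; exact: le_trans Px.
have V_ratio x : Phi <= x -> `|derive1 V x - N * V x| <= delta * V x.
  move=> Px; have Mx : M < x by lra.
  have V0 := V_pos x Px; have := MP x Mx; rewrite sub0r normrN /W_ => h.
  have -> : derive1 V x - N * V x = (derive1 V x / V x - N) * V x by field; rewrite gt_eqF.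
  by rewrite normrM (gtr0_norm V0); apply: ler_wpM2r; exact: ltW.
have V_growth x : Phi <= x -> derive1 V x <= (2 * kappa * theta - delta) * V x.
  move=> Px; have := V_ratio x Px; rewrite ler_norml => /andP[_ h].
  have -> : 2 * kappa * theta - delta = N + delta by rewrite -mulrA kt /delta; field.
  by lra.
have V_log x : Phi <= x -> `|derive1 V x| <= (`|N| + delta) * V x.
  move=> Px; have h := V_ratio x Px; have V0 := V_pos x Px.
  have := ler_normD (derive1 V x - N * V x) (N * V x).
  by rewrite subrK normrM (gtr0_norm V0); lra.
have [lim limP] := limit_function_exists kappa0 delta0 theta0 theta1
  (potential_derive V_C2) V_pos V_growth.
exists (early_directions theta Phi f).
  exact: (@early_directions_nbhs R theta Phi theta1 f phi0 eps f_vanishes f_decreasing hphi0 P2).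
move=> Nb nNb sNb.
exact: (orbits_meeting_homeomorphic kappa0 kappa2 erefl kappaV delta0 theta0 theta1 V_C2
  V_pos V_growth V_log limP f_vanishes f_decreasing hphi0 nNb sNb).
Qed.
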